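(* Let $(\bm{u}(t),p(t))$ be the (sufficiently smooth) solution of the variational Biot problem, and let $(\bm{u}_h^n,p_h^n)$ be the solutions produced by the explicit fixed-stress split algorithm (both as described in the context), with an inf-sup stable finite element pair $\bm{V}_h\times Q_h$ of approximation orders $k$ (displacement) and $\ell$ (pressure). If $L=\omega\,\frac{\alpha^2}{\lambda+2\mu/d}$ with $\omega\ge 1$, then, with $s=\min(k,\ell)$, there is a constant $C>0$ independent of $h$, $\tau$ and $n$ such that for $1\le n\le N-1$ $$ \begin{aligned} &\|\bm{u}(t_n)-\bm{u}_h^n\|_A+\|p(t_n)-p_h^n\|_B+\|p(t_n)-p_h^n\| \\ &\le C\left(\|e_{\bm{u}}^0\|_A+\|e_p^0\|_B\right)+Ch^s\left(|\bm{u}(t_0)|_{k+1}+|p(t_0)|_{\ell+1}+|\bm{u}(t_n)|_{k+1}+|p(t_n)|_{\ell+1}\right)\\ &\quad+C\tau\left[\left(\int_{t_0}^{t_{n+1}}\|\partial_{tt}p(s)\|^2\,\mathrm{d}s\right)^{1/2}+\left(\int_{t_0}^{t_{n+1}}\|\partial_{tt}\bm{u}(s)\|_1^2\,\mathrm{d}s\right)^{1/2}\right]\\ &\quad+Ch^s\left[\left(\int_{t_0}^{t_{n+1}}|\partial_tp(s)|_{\ell+1}^2\,\mathrm{d}s\right)^{1/2}+\left(\int_{t_0}^{t_{n+1}}\left(|\partial_t\bm{u}(s)|_{k+1}^2+|\partial_tp(s)|_{\ell+1}^2\right)\mathrm{d}s\right)^{1/2}\right], \end{aligned} $$ where $e_{\bm{u}}^0=\bm{u}(t_0)-\bm{u}_h^0$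 and $e_p^0=p(t_0)-p_h^0$.
   Context: **Continuous problem.** $\Omega\subset\mathbb{R}^d$, $d\in\{2,3\}$, is a bounded polygonal/polyhedral domain, $T>0$, $\bm{V}=(H_0^1(\Omega))^d$, $Q=H_0^1(\Omega)$; $(\cdot,\cdot)$ and $\|\cdot\|$ are the $L^2(\Omega)$ inner product and norm; $\|\cdot\|_1$ is the $H^1(\Omega)$ norm and $|\cdot|_m$ the $H^m(\Omega)$ seminorm. The physical parameters are constants: Lamé parameters $\lambda,\mu>0$, Biot coefficient $\alpha>0$, Biot modulus $\beta>0$, hydraulic conductivity $K>0$. With $\varepsilon(\bm{u})=\frac12(\nabla\bm{u}+\nabla^T\bm{u})$, define $$a(\bm{u},\bm{v})=2\mu\int_\Omega\varepsilon(\bm{u}):\varepsilon(\bm{v})+\lambda\int_\Omega\operatorname{div}\bm{u}\operatorname{div}\bm{v},\qquad b(p,q)=\int_\Omega K\nabla p\cdot\nabla q,$$ and $\|\bm{v}\|_A=a(\bm{v},\bm{v})^{1/2}$, $\|q\|_B=b(q,q)^{1/2}$. Given sources $\bm{f},g$, the exact solution $(\bm{u},p)\in C^1([0,T];\bm{V})\times C^1([0,T];Q)$ satisfies for $t\in[0,T]$ $$a(\bm{u},\bm{v})-\alpha(p,\operatorname{div}\bm{v})=(\bm{f},\bm{v})\ \ \forall\bm{v}\in\bm{V},\qquad \tfrac1\beta(\partial_tp,q)+\alpha(\operatorname{div}\partial_t\bm{u},q)+b(p,q)=(g,q)\ \ \forall q\in Q.$$ **Discretization.** $\mathcal{T}_h$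 is a simplicial partition of $\Omega$ with mesh size $h$, and $\bm{V}_h\subset\bm{V}$, $Q_h\subset Q$ are finite element spaces satisfying the inf-sup condition $$\sup_{0\ne\bm{w}_h\in\bm{V}_h}\frac{(\operatorname{div}\bm{w}_h,q_h)}{\|\bm{w}_h\|_A}\ge\frac{\eta}{\sqrt{\lambda+2\mu/d}}\|q_h\|\quad\forall q_h\in Q_h,$$ with $\eta>0$ independent of $h$ and of the physical parameters. Time grid: $t_j=j\tau$, $j=0,\dots,N$, $\tau=T/N$. The discrete source data $\bm{f}_h^j$, $g_h^j$ are those of time $t_j$: $(\bm{f}_h^j,\bm{v}_h)=(\bm{f}(t_j),\bm{v}_h)$ for $0\le j\le N$ and $(g_h^j,q_h)=(g(t_j),q_h)$ for $1\le j\le N$; $g_h^0$ is a given discrete initial datum. **Initial data.** $(\bm{u}_h^0,p_h^0)\in\bm{V}_h\times Q_h$ is assumed to satisfy $a(\bm{u}_h^0,\bm{v}_h)-\alpha(p_h^0,\operatorname{div}\bm{v}_h)=(\bm{f}_h^0,\bm{v}_h)$ for all $\bm{v}_h\in\bm{V}_h$ and $\alpha(\operatorname{div}\bm{u}_h^0,q_h)=(g_h^0,q_h)$ for all $q_h\in Q_h$. **First step (fully implicit).** $(\bm{u}_h^1,p_h^1)\in\bm{V}_h\times Q_h$ solves, for all $\bm{v}_h\in\bm{V}_h$, $q_h\in Q_h$, $$a(\bm{u}_h^1,\bm{v}_h)-\alpha(p_h^1,\operatorname{div}\bm{v}_h)=(\bm{f}_h^1,\bm{v}_h),$$ $$\tfrac1\beta\Big(\tfrac{p_h^1-p_h^0}{\tau},q_h\Big)+\alpha\Big(\operatorname{div}\tfrac{\bm{u}_h^1-\bm{u}_h^0}{\tau},q_h\Big)+b(p_h^1,q_h)=(g_h^1,q_h).$$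 **Explicit fixed-stress split algorithm.** For $j=1,\dots,N-1$, with tuning parameter $L$: first find $p_h^{j+1}\in Q_h$ such that for all $q_h\in Q_h$ $$\tfrac1\beta\Big(\tfrac{p_h^{j+1}-p_h^j}{\tau},q_h\Big)+L\Big(\tfrac{p_h^{j+1}-p_h^j}{\tau},q_h\Big)+b(p_h^{j+1},q_h)=-\alpha\Big(\operatorname{div}\tfrac{\bm{u}_h^j-\bm{u}_h^{j-1}}{\tau},q_h\Big)+L\Big(\tfrac{p_h^j-p_h^{j-1}}{\tau},q_h\Big)+(g_h^{j+1},q_h);$$ then find $\bm{u}_h^{j+1}\in\bm{V}_h$ such that $a(\bm{u}_h^{j+1},\bm{v}_h)=\alpha(p_h^{j+1},\operatorname{div}\bm{v}_h)+(\bm{f}_h^{j+1},\bm{v}_h)$ for all $\bm{v}_h\in\bm{V}_h$. **Approximation assumption.** For each $t$ the elliptic projections $(\bar{\bm{u}}_h(t),\bar p_h(t))\in\bm{V}_h\times Q_h$ are defined by $b(\bar p_h,q_h)=b(p,q_h)$ for all $q_h\in Q_h$ and $a(\bar{\bm{u}}_h,\bm{v}_h)-\alpha(\bar p_h,\operatorname{div}\bm{v}_h)=a(\bm{u},\bm{v}_h)-\alpha(p,\operatorname{div}\bm{v}_h)$ for all $\bm{v}_h\in\bm{V}_h$. The spaces $\bm{V}_h,Q_h$ provide $k$-th and $\ell$-th order approximation to displacement and pressure, respectively, in the sense that $\rho_{\bm{u}}=\bm{u}-\bar{\bm{u}}_h$ and $\rho_p=p-\bar p_h$ satisfy, for all $t$,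 $$\|\rho_{\bm{u}}\|_A\le ch^{\min(k,\ell+1)}(|\bm{u}|_{k+1}+|p|_{\ell+1}),\quad\|\rho_p\|_B\le ch^\ell|p|_{\ell+1},\quad\|\rho_p\|\le ch^{\ell+1}|p|_{\ell+1},$$ with $c$ independent of $h$, and the same estimates hold for $\partial_t\rho_{\bm{u}},\partial_t\rho_p$ with $\partial_t\bm{u},\partial_tp$ on the right-hand side. The constant $C$ may depend on the physical parameters, $\Omega$, $T$, $\eta$, $\omega$ and $c$. The exact solution is assumed regular enough that all quantities on the right-hand side are defined and finite. *)

(* Defs.v *)
From HB Require Import structures.
From mathcomp Require Import all_boot all_order all_algebra.
From mathcomp Require Import all_classical all_reals all_analysis.
Import Order.TTheory GRing.Theory Num.Theory.
Import numFieldNormedType.Exports.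

Set Implicit Arguments.
Unset Strict Implicit.
Unset Printing Implicit Defensive.

Local Open Scope classical_set_scope.
Local Open Scope ring_scope.

(* R^n is 'rV[R]_n; it carries the sigma-algebra generated by the coordinates,
   i.e., its Borel sets. *)
Definition row_display : measure_display.
Proof. exact: default_measure_display. Qed.

Section row_measurable.
Context {R : realType} (n : nat).

Definition row_coord (i : 'I_n) (x : 'rV[R]_n) : measurableTypeR R := x ord0 i.

Let row_set0 : g_sigma_preimage row_coord set0.
Proof. exact: sigma_algebra0. Qed.

Let row_setC A : g_sigma_preimage row_coord A ->
  g_sigma_preimage row_coord (~` A).
Proof. exact: sigma_algebraC. Qed.

Let row_bigcup (F : (set 'rV[R]_n)^nat) :
  (forall i, g_sigma_preimage row_coord (F i)) ->
  g_sigma_preimage row_coord (\bigcup_i (F i)).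
Proof. exact: sigma_algebra_bigcup. Qed.

HB.instance Definition _ := @isMeasurable.Build row_display 'rV[R]_n
  (g_sigma_preimage row_coord) row_set0 row_setC row_bigcup.

Lemma measurable_coord (i : 'I_n) :
  measurable_fun [set: 'rV[R]_n] (fun x : 'rV[R]_n => x ord0 i).
Proof.
move=> _ Y mY; rewrite setTI; apply: sub_sigma_algebra => /=.
rewrite -bigcup_seq/=; exists i => /=; first by rewrite mem_index_enum.
by exists Y => //; rewrite setTI.
Qed.

Lemma measurable_fun_row d (T : measurableType d) (f : T -> 'rV[R]_n) :
  (forall i, measurable_fun [set: T] (fun t => f t ord0 i)) ->
  measurable_fun [set: T] f.
Proof.
move=> mf _ A mA; rewrite setTI.
suff : measurable `<=` [set B : set 'rV[R]_n | measurable (f @^-1` B)] by exact.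
apply: smallest_sub.
  split => //=.
  - by rewrite preimage_set0.
  - by move=> B mB; rewrite setTD preimage_setC; exact: measurableC.
  - by move=> F mF; rewrite preimage_bigcup; exact: bigcupT_measurable.
rewrite -bigcup_seq; apply: bigcup_sub => i _ _ [B mB <-] /=.
by rewrite setTI -comp_preimage -[X in measurable X]setTI; exact: mf.
Qed.

End row_measurable.

(* The canonical sigma-finite structure of a product measure is only found for
   sub-probabilities. *)
Lemma prod_sigma_finite d1 d2 (T1 : measurableType d1) (T2 : measurableType d2)
    (R : realType) (m1 : {sigma_finite_measure set T1 -> \bar R})
    (m2 : {sigma_finite_measure set T2 -> \bar R}) :
  sigma_finite setT (m1 \x m2)%E.
Proof.
have /sigma_finiteP[F [TF ndF Foo]] := sigma_finiteT m1.
have /sigma_finiteP[G [TG ndG Goo]] := sigma_finiteT m2.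
exists (fun n => F n `*` G n).
  rewrite -setXTT TF TG predeqE => -[x y]; split.
    move=> [/= [n _ Fnx] [k _ Gky]]; exists (maxn n k) => //; split.
    - by move: x Fnx; exact/subsetPset/ndF/leq_maxl.
    - by move: y Gky; exact/subsetPset/ndG/leq_maxr.
  by move=> [n _ []/= ? ?]; split; exists n.
move=> k; have [? ?] := Foo k; have [? ?] := Goo k.
split; first exact: measurableX.
by rewrite product_measure1E// lte_mul_pinfty// ge0_fin_numE.
Qed.

Section row_cons.
Context {R : realType} (n : nat).

Definition row_cons (z : measurableTypeR R * 'rV[R]_n) : 'rV[R]_n.+1 :=
  \row_i oapp (z.2 ord0) z.1 (unlift ord0 i).

Definition row_uncons (x : 'rV[R]_n.+1) : measurableTypeR R * 'rV[R]_n :=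
  (x ord0 ord0, \row_i x ord0 (lift ord0 i)).

Lemma row_consK : cancel row_cons row_uncons.
Proof.
move=> [a y]; rewrite /row_uncons !mxE unlift_none /=; congr pair.
by apply/rowP => i; rewrite !mxE liftK.
Qed.

Lemma measurable_row_cons : measurable_fun setT row_cons.
Proof.
apply: measurable_fun_row => i; rewrite /row_cons.
under [X in measurable_fun _ X]eq_fun do rewrite mxE.
case: (unlift ord0 i) => [j|] /=; last exact: measurable_fst.
exact: (measurableT_comp (measurable_coord j) measurable_snd).
Qed.

Lemma measurable_row_uncons : measurable_fun setT row_uncons.
Proof.
apply/measurable_fun_pairP; split; first exact: measurable_coord.
apply: measurable_fun_row => i.
under [X in measurable_fun _ X]eq_fun do rewrite /= mxE.
exact: measurable_coord.
Qed.

Variable mu : {sigma_finite_measure set 'rV[R]_n -> \bar R}.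

Definition lebesgue_cons : set 'rV[R]_n.+1 -> \bar R :=
  pushforward (@lebesgue_measure R \x mu)%E row_cons.

Let lebesgue_cons0 : (lebesgue_cons set0 = 0)%E.
Proof. by rewrite /lebesgue_cons /pushforward preimage_set0 measure0. Qed.

Let measurable_preimage_row_cons A :
  measurable A -> measurable (row_cons @^-1` A).
Proof.
by move=> mA; rewrite -[X in measurable X]setTI; exact: measurable_row_cons.
Qed.

Let lebesgue_cons_ge0 A : (0 <= lebesgue_cons A)%E.
Proof. exact: integral_ge0. Qed.

Let lebesgue_cons_sigma_additive : semi_sigma_additive lebesgue_cons.
Proof.
move=> F mF tF mUF; rewrite /lebesgue_cons /pushforward preimage_bigcup.
apply: measure_semi_sigma_additive.
- by move=> k; exact: measurable_preimage_row_cons.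
- apply/trivIsetP => /= i j _ _ ij; rewrite -preimage_setI.
  by move/trivIsetP : tF => /(_ _ _ _ _ ij) ->//; rewrite preimage_set0.
- by rewrite -preimage_bigcup; exact: measurable_preimage_row_cons.
Qed.

HB.instance Definition _ := isMeasure.Build _ _ _ lebesgue_cons
  lebesgue_cons0 lebesgue_cons_ge0 lebesgue_cons_sigma_additive.

Let lebesgue_cons_sigma_finite : sigma_finite setT lebesgue_cons.
Proof.
have [F FT Foo] : sigma_finite setT (@lebesgue_measure R \x mu)%E.
  exact: prod_sigma_finite.
exists (fun k => row_uncons @^-1` F k).
  by rewrite -preimage_bigcup -FT preimage_setT.
move=> k; have [mF Fk] := Foo k; split.
  by rewrite -[X in measurable X]setTI; exact: measurable_row_uncons.
rewrite /lebesgue_cons /pushforward -comp_preimage.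
by rewrite (_ : row_uncons \o row_cons = id)//; apply/funext => z; exact: row_consK.
Qed.

HB.instance Definition _ := Measure_isSigmaFinite.Build _ _ _ lebesgue_cons
  lebesgue_cons_sigma_finite.

End row_cons.

Fixpoint lebesgue_row {R : realType} (n : nat) :
    {sigma_finite_measure set 'rV[R]_n -> \bar R} :=
  match n with
  | 0%N => \d_(0 : 'rV[R]_0)
  | m.+1 => lebesgue_cons (lebesgue_row m)
  end.

(* An element of H^1 is encoded as a pair of a function and its weak gradient,
   both given by representatives; R^o is R as a module over itself. *)
Notation jet R d := (('rV[R]_d -> R^o) * ('I_d -> 'rV[R]_d -> R^o))%type.
Notation vjet R d := ('I_d -> jet R d).

Section sobolev.
Context {R : realType} {d : nat}.
Local Notation pt := 'rV[R]_d.
Variable D : set pt.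
Implicit Types (f g phi : pt -> R) (v : jet R d) (w : vjet R d).

Definition L2 f : Prop :=
  measurable_fun D f /\
  (lebesgue_row d).-integrable D (fun x => (f x ^+ 2)%:E).

Definition ip f g : R := \int[lebesgue_row d]_(x in D) (f x * g x).

Definition L2norm f : R := Num.sqrt (ip f f).

Definition pderiv (s : seq 'I_d) phi : pt -> R :=
  foldr (fun i psi => fun x => 'D_(delta_mx ord0 i) psi x) phi s.

Definition smooth phi : Prop := forall s : seq 'I_d,
  continuous (pderiv s phi) /\
  forall i x, derivable (pderiv s phi) x (delta_mx ord0 i).

Definition test_function phi : Prop :=
  let supp := closure [set x | phi x != 0] in
  [/\ smooth phi, compact supp & supp `<=` D].

Definition weak_deriv (s : seq 'I_d) f g : Prop :=
  forall phi, test_function phi ->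
    ip f (pderiv s phi) = (-1) ^+ size s * ip g phi.

Definition H1 v : Prop :=
  L2 v.1 /\ forall i, L2 (v.2 i) /\ weak_deriv [:: i] v.1 (v.2 i).

Definition H1norm v : R :=
  Num.sqrt (ip v.1 v.1 + \sum_i ip (v.2 i) (v.2 i)).

Definition test_jet phi : jet R d := (phi, fun i => pderiv [:: i] phi).

Definition H10 v : Prop :=
  H1 v /\ forall e : R, 0 < e ->
    exists2 phi, test_function phi & H1norm (v - test_jet phi) < e.

Definition vH10 w : Prop := forall i, H10 (w i).

Definition vH1norm w : R := Num.sqrt (\sum_i H1norm (w i) ^+ 2).

Definition Hm (m : nat) f : Prop :=
  L2 f /\ forall s : seq 'I_d, (size s <= m)%N ->
    exists2 g, L2 g & weak_deriv s f g.

(* The multi-index a stands for the iterated derivative along the sequence in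
   which the direction i occurs a i times. *)
Definition multi_index_seq m (a : {ffun 'I_d -> 'I_m.+1}) : seq 'I_d :=
  flatten [seq nseq (a i) i | i <- enum 'I_d].

(* Any weak derivative in L^2; it is unique a.e. when there is one. *)
Definition weakD (s : seq 'I_d) f : pt -> R :=
  xget (fun=> 0) [set g | L2 g /\ weak_deriv s f g].

Definition Hsemi (m : nat) f : R :=
  Num.sqrt (\sum_(a : {ffun 'I_d -> 'I_m.+1} | (\sum_i (a i : nat))%N == m)
    L2norm (weakD (multi_index_seq a) f) ^+ 2).

Definition vHsemi (m : nat) w : R :=
  Num.sqrt (\sum_i Hsemi m (w i).1 ^+ 2).

Definition div w : pt -> R := fun x => \sum_i (w i).2 i x.

Definition strain w (i j : 'I_d) : pt -> R :=
  fun x => 2^-1 * ((w i).2 j x + (w j).2 i x).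

Definition vip (f g : 'I_d -> pt -> R) : R :=
  \int[lebesgue_row d]_(x in D) \sum_i f i x * g i x.

Definition value w : 'I_d -> pt -> R := fun i => (w i).1.

Definition aform (lam mu : R) (u w : vjet R d) : R :=
  2 * mu * \int[lebesgue_row d]_(x in D)
             (\sum_i \sum_j strain u i j x * strain w i j x)
  + lam * \int[lebesgue_row d]_(x in D) (div u x * div w x).

Definition bform (kap : R) (p q : jet R d) : R :=
  \int[lebesgue_row d]_(x in D) \sum_i kap * p.2 i x * q.2 i x.

Definition normA (lam mu : R) w : R := Num.sqrt (aform lam mu w w).

Definition normB (kap : R) v : R := Num.sqrt (bform kap v v).

End sobolev.

Section time_derivative.
Context {R : realType} {X : lmodType R}.
Variables (S : set X) (nm : X -> R) (T : R).
Implicit Types u du : R -> X.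

(* The derivative of u : [0,T] -> S in the norm nm, one-sided at 0 and T. *)
Definition has_tderiv u du : Prop :=
  forall t, 0 <= t <= T -> [/\ S (u t), S (du t) &
    (fun r => nm ((r - t)^-1 *: (u r - u t) - du t))
      @ within `[0, T] t^' --> (0 : R)].

Definition is_C1 u du : Prop :=
  has_tderiv u du /\ forall t, 0 <= t <= T ->
    (fun r => nm (du r - du t)) @ within `[0, T] (nbhs t) --> (0 : R).

Definition bounded_functional (phi : X -> R) : Prop :=
  (forall (a : R) x y, S x -> S y -> phi (a *: x + y) = a * phi x + phi y) /\
  exists M : R, forall x, S x -> `|phi x| <= M * nm x.

(* du is the weak derivative of u in L^2(0,T;S): u(t) - u(0) is the integral of
   du over [0,t], tested against all bounded functionals. When is_C1 u du holds
   and S is a Hilbert space for nm, this is satisfied. *)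
Definition has_L2_tderiv u du : Prop :=
  [/\ forall t, 0 <= t <= T -> S (du t),
      lebesgue_measure.-integrable `[0, T] (fun t => (nm (du t) ^+ 2)%:E) &
      forall phi, bounded_functional phi ->
        lebesgue_measure.-integrable `[0, T] (fun t => (phi (du t))%:E) /\
        forall t, 0 <= t <= T ->
          phi (u t) - phi (u 0) = \int[lebesgue_measure]_(r in `[0, t]) phi (du r)].

End time_derivative.

Section finite_elements.
Context {R : realType} {d : nat}.
Local Notation pt := 'rV[R]_d.

Definition simplex (V : 'I_d.+1 -> pt) : set pt :=
  [set x | exists c : 'I_d.+1 -> R,
     [/\ forall i, 0 <= c i, \sum_i c i = 1 & x = \sum_i c i *: V i]].

Definition nondegenerate (V : 'I_d.+1 -> pt) : Prop :=
  (\matrix_(i < d) (V (lift ord0 i) - V ord0)) \in unitmx.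

(* Openness and boundedness follow from D being the interior of a finite union
   of compact simplices. *)
Definition polyhedral_domain (D : set pt) : Prop :=
  [/\ D !=set0, connected D &
      exists m (K : 'I_m -> 'I_d.+1 -> pt),
        (forall i, nondegenerate (K i)) /\
        D = (\bigcup_(i in [set: 'I_m]) simplex (K i))°].

(* The faces of neighbouring simplices are not required to match. *)
Definition simplicial_partition (D : set pt) m (K : 'I_m -> 'I_d.+1 -> pt) : Prop :=
  [/\ forall i, nondegenerate (K i),
      closure D = \bigcup_(i in [set: 'I_m]) simplex (K i) &
      forall i j, i != j -> (simplex (K i))° `&` (simplex (K j))° = set0].

Definition edist (x y : pt) : R :=
  Num.sqrt (\sum_i (x ord0 i - y ord0 i) ^+ 2).

Definition diameter (A : set pt) : R :=
  sup [set r | exists x y, [/\ A x, A y & r = edist x y]].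

Definition mesh_size m (K : 'I_m -> 'I_d.+1 -> pt) : R :=
  \big[Num.max/0]_i diameter (simplex (K i)).

Definition is_polynomial (P : pt -> R) : Prop :=
  exists n (c : {ffun 'I_d -> 'I_n} -> R),
    forall x, P x = \sum_a c a * \prod_i x ord0 i ^+ a i.

Definition piecewise_polynomial m (K : 'I_m -> 'I_d.+1 -> pt) (f : pt -> R) : Prop :=
  forall j, exists2 P, is_polynomial P &
    forall x, (simplex (K j))° x -> f x = P x.

Definition fin_dim_subspace {X : lmodType R} (S : set X) : Prop :=
  exists n (b : 'I_n -> X),
    forall x, S x <-> exists c : 'I_n -> R, x = \sum_i c i *: b i.

Definition fe_pair (D : set pt) m (K : 'I_m -> 'I_d.+1 -> pt)
    (Vh : set (vjet R d)) (Qh : set (jet R d)) : Prop :=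
  [/\ fin_dim_subspace Vh, fin_dim_subspace Qh,
      forall w, Vh w ->
        vH10 D w /\ forall i, piecewise_polynomial K (w i).1 &
      forall q, Qh q -> H10 D q /\ piecewise_polynomial K q.1].

(* vH1norm D w != 0 says that w is nonzero as an element of H^1, that is, up to
   null sets. *)
Definition inf_sup (D : set pt) (lam mu eta : R)
    (Vh : set (vjet R d)) (Qh : set (jet R d)) : Prop :=
  forall q, Qh q ->
    eta / Num.sqrt (lam + 2 * mu / d%:R) * L2norm D q.1 <=
    sup [set ip D (div w) q.1 / normA D lam mu w |
         w in [set w | Vh w /\ vH1norm D w != 0]].

End finite_elements.

Section biot.
Context {R : realType} {d : nat}.
Local Notation pt := 'rV[R]_d.
Variables (D : set pt) (lam mu al be kap T : R).
Local Notation a := (aform D lam mu).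
Local Notation b := (bform D kap).
Local Notation ipD := (ip D).

Definition biot_solution (f : R -> 'I_d -> pt -> R) (g : R -> pt -> R)
    (u du : R -> vjet R d) (p dp : R -> jet R d) : Prop :=
  [/\ is_C1 (vH10 D) (vH1norm D) T u du,
      is_C1 (H10 D) (H1norm D) T p dp &
      forall t, 0 <= t <= T ->
        [/\ forall i, L2 D (f t i), L2 D (g t),
            forall v, vH10 D v ->
              a (u t) v - al * ipD (p t).1 (div v) = vip D (f t) (value v) &
            forall q, H10 D q ->
              be^-1 * ipD (dp t).1 q.1 + al * ipD (div (du t)) q.1
                + b (p t) q = ipD (g t) q.1]].

Definition smooth_solution (k l : nat)
    (u du ddu : R -> vjet R d) (p dp : R -> jet R d) (ddp : R -> pt -> R^o) : Prop :=
  [/\ forall t, 0 <= t <= T ->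
        [/\ forall i, Hm D k.+1 (u t i).1, forall i, Hm D k.+1 (du t i).1,
            Hm D l.+1 (p t).1 & Hm D l.+1 (dp t).1],
      lebesgue_measure.-integrable `[0, T]
        (fun t => (vHsemi D k.+1 (du t) ^+ 2)%:E),
      lebesgue_measure.-integrable `[0, T]
        (fun t => (Hsemi D l.+1 (dp t).1 ^+ 2)%:E),
      has_L2_tderiv (vH10 D) (vH1norm D) T du ddu &
      has_L2_tderiv (L2 D) (L2norm D) T (fun t => (dp t).1) ddp].

(* drho_u and drho_p are the time derivatives of the projection errors. *)
Definition projection_approx (k l : nat) (c h : R)
    (Vh : set (vjet R d)) (Qh : set (jet R d))
    (u du : R -> vjet R d) (p dp : R -> jet R d) : Prop :=
  let estimates (ru : vjet R d) (rp : jet R d) (w : vjet R d) (q : jet R d) :=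
    [/\ normA D lam mu ru <=
          c * h ^+ minn k l.+1 * (vHsemi D k.+1 w + Hsemi D l.+1 q.1),
        normB D kap rp <= c * h ^+ l * Hsemi D l.+1 q.1 &
        L2norm D rp.1 <= c * h ^+ l.+1 * Hsemi D l.+1 q.1] in
  exists (ubar : R -> vjet R d) (pbar : R -> jet R d)
         (drho_u : R -> vjet R d) (drho_p : R -> jet R d),
    [/\ forall t, 0 <= t <= T ->
          [/\ Vh (ubar t), Qh (pbar t),
              forall q, Qh q -> b (pbar t) q = b (p t) q &
              forall v, Vh v ->
                a (ubar t) v - al * ipD (pbar t).1 (div v) =
                a (u t) v - al * ipD (p t).1 (div v)],
        has_tderiv (vH10 D) (vH1norm D) T (fun t => u t - ubar t) drho_u,
        has_tderiv (H10 D) (H1norm D) T (fun t => p t - pbar t) drho_p &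
        forall t, 0 <= t <= T ->
          estimates (u t - ubar t) (p t - pbar t) (u t) (p t) /\
          estimates (drho_u t) (drho_p t) (du t) (dp t)].

Variables (N : nat) (Vh : set (vjet R d)) (Qh : set (jet R d)).

Definition tau : R := T / N%:R.

Definition tj (j : nat) : R := j%:R * tau.

Definition discrete_data (f : R -> 'I_d -> pt -> R) (g : R -> pt -> R)
    (fh : nat -> 'I_d -> pt -> R) (gh : nat -> pt -> R) : Prop :=
  [/\ forall j, (j <= N)%N -> (forall i, L2 D (fh j i)) /\
        forall v, Vh v -> vip D (fh j) (value v) = vip D (f (tj j)) (value v),
      forall j, (j <= N)%N -> L2 D (gh j) &
      forall j, (1 <= j <= N)%N ->
        forall q, Qh q -> ipD (gh j) q.1 = ipD (g (tj j)) q.1].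

Definition momentum_eq (fh : nat -> 'I_d -> pt -> R)
    (uh : nat -> vjet R d) (ph : nat -> jet R d) (j : nat) : Prop :=
  forall v, Vh v ->
    a (uh j) v - al * ipD (ph j).1 (div v) = vip D (fh j) (value v).

Definition initial_data
    (fh : nat -> 'I_d -> pt -> R) (gh : nat -> pt -> R)
    (uh : nat -> vjet R d) (ph : nat -> jet R d) : Prop :=
  momentum_eq fh uh ph 0 /\
  forall q, Qh q -> al * ipD (div (uh 0%N)) q.1 = ipD (gh 0%N) q.1.

(* First-order backward difference quotient at step j.+1. *)
Definition bdiff {X : lmodType R} (x : nat -> X) (j : nat) : X :=
  tau^-1 *: (x j.+1 - x j).

Definition first_step
    (fh : nat -> 'I_d -> pt -> R) (gh : nat -> pt -> R)
    (uh : nat -> vjet R d) (ph : nat -> jet R d) : Prop :=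
  momentum_eq fh uh ph 1 /\
  forall q, Qh q ->
    be^-1 * ipD (bdiff ph 0).1 q.1 + al * ipD (div (bdiff uh 0)) q.1
      + b (ph 1%N) q = ipD (gh 1%N) q.1.

Definition explicit_fixed_stress (L : R)
    (fh : nat -> 'I_d -> pt -> R) (gh : nat -> pt -> R)
    (uh : nat -> vjet R d) (ph : nat -> jet R d) : Prop :=
  forall j, (1 <= j <= N.-1)%N ->
    (forall q, Qh q ->
       be^-1 * ipD (bdiff ph j).1 q.1 + L * ipD (bdiff ph j).1 q.1
         + b (ph j.+1) q
       = - al * ipD (div (bdiff uh j.-1)) q.1
         + L * ipD (bdiff ph j.-1).1 q.1 + ipD (gh j.+1) q.1) /\
    (forall v, Vh v ->
       a (uh j.+1) v = al * ipD (ph j.+1).1 (div v)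
                       + vip D (fh j.+1) (value v)).

Definition discrete_solution (L : R)
    (fh : nat -> 'I_d -> pt -> R) (gh : nat -> pt -> R)
    (uh : nat -> vjet R d) (ph : nat -> jet R d) : Prop :=
  [/\ forall j, (j <= N)%N -> Vh (uh j) /\ Qh (ph j),
      initial_data fh gh uh ph, first_step fh gh uh ph &
      explicit_fixed_stress L fh gh uh ph].

End biot.

(* Main.v *)
Require Import Defs.
From mathcomp Require Import all_boot all_order all_algebra.
From mathcomp Require Import all_classical all_reals all_analysis.
From mathcomp Require Import measurable_realfun ring lra.
Import Order.TTheory GRing.Theory Num.Theory.
Import numFieldNormedType.Exports.
Set Implicit Arguments.
Unset Strict Implicit.
Unset Printing Implicit Defensive.
Local Open Scope classical_set_scope.
Local Open Scope ring_scope.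

(** Write each error as a projection error, bounded by the approximation
    assumption, plus the difference between the elliptic projection and the
    scheme, an element of the finite element spaces. The displacement part of
    this difference is in equilibrium with the pressure part at every time step,
    so it is controlled by it ([coupled_norm_le]), and the pressure part satisfies
    the split scheme with a residual as data.

    Stability. Eliminating the displacement, an explicit step reads
    [y / be + L y - (L - S) x + B e = r], where [x] and [y] are the previous and
    the new pressure increments divided by [tau], and [S] sends a pressure to
    [al] times the divergence of the displacement in equilibrium with it. The
    divergence is the trace of the strain, so
    [S <= al ^+ 2 / (lam + 2 * mu / d)]; with [omega >= 1] the symmetric operator
    [L - S] lies between [0] and [L] ([fixed_stress_form_le]). Testing with [y],
    the terms with [L] telescope and the storage term [y / be] absorbs the
    residual ([explicit_step_energy]); the implicit first step starts the
    recursion ([fixed_stress_energy]). This controls the pressure error in the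
    energy norm and the sum of its squared increments, hence its L^2 norm up to
    the initial pressure error, which the inf-sup condition bounds by the initial
    displacement error ([initial_pressure_error_le], [error_estimate]).

    Consistency. The residual compares difference quotients of the projections
    with exact time derivatives at most two steps away. It is bounded by second
    derivatives in time and by the rates of the projection errors, integrated over
    two time steps ([quotient_consistency]). These rates exist pointwise and are
    dominated by a square-integrable function of time, so the difference quotients
    are estimated by a mean value inequality for such bounds
    ([le_integral_of_right_derivative]), applied to norms of increments.

    Summing over the time steps, with the mesh size bounded in terms of the domain
    ([mesh_size_bounded]), gives the estimate ([error_bound]). *)

(** * Semi-inner products on a subspace *)

Definition lin_closed {R : realType} {X : lmodType R} (S : set X) : Prop :=
  forall (k : R) x y, S x -> S y -> S (k *: x + y).

(** A form that is only known to be symmetric, bilinear and nonnegative on [S]: an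
    integral of a product is bilinear on square-integrable functions only, and
    functions that vanish almost everywhere have norm zero. *)
Record semi_inner {R : realType} {X : lmodType R} (S : set X) (B : X -> X -> R)
    : Prop := SemiInner {
  sip_closed : lin_closed S;
  sip_lin : forall (k : R) x y z, S x -> S y -> S z ->
    B (k *: x + y) z = k * B x z + B y z;
  sip_sym : forall x y, S x -> S y -> B x y = B y x;
  sip_ge0 : forall x, S x -> 0 <= B x x }.

Definition sipnorm {R : realType} {X : lmodType R} (B : X -> X -> R) (x : X) : R :=
  Num.sqrt (B x x).

(** The difference formed with the group structure that [X] has as a module. On a
    type such as [vjet R d] the notation [x - y] may reach the same operation
    along another chain of instances; this name fixes one of them. *)
Definition lsub {R : realType} {X : lmodType R} (x y : X) : X := x - y.

Section lin_closed.
Context {R : realType} {X : lmodType R} {S : set X}.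
Hypothesis cS : lin_closed S.

Lemma lin_closedB x y : S x -> S y -> S (x - y).
Proof. by move=> Sx Sy; rewrite addrC -scaleN1r; exact: cS. Qed.

Lemma lin_closedZ k x : S x -> S (k *: x).
Proof.
move=> Sx; rewrite -[_ *: _]addr0; apply: cS => //.
by rewrite -(subrr x); exact: lin_closedB.
Qed.

Lemma lin_closedD x y : S x -> S y -> S (x + y).
Proof. by move=> Sx Sy; rewrite -[x]scale1r; exact: cS. Qed.

End lin_closed.

Section semi_inner.
Context {R : realType} {X : lmodType R} {S : set X} {B : X -> X -> R}.
Hypothesis sB : semi_inner S B.
Local Notation N := (sipnorm B).
Let cS := sip_closed sB.

Lemma sip_subspace (S' : set X) : lin_closed S' -> S' `<=` S -> semi_inner S' B.
Proof.
move=> cS' sub; split => // *.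
- by apply: (sip_lin sB); exact: sub.
- by apply: (sip_sym sB); exact: sub.
- by apply: (sip_ge0 sB); exact: sub.
Qed.

Lemma sipDl x y z : S x -> S y -> S z -> B (x + y) z = B x z + B y z.
Proof.
by move=> Sx Sy Sz; rewrite -{1}[x]scale1r (sip_lin sB)// mul1r.
Qed.

Lemma sipBl x y z : S x -> S y -> S z -> B (x - y) z = B x z - B y z.
Proof.
by move=> Sx Sy Sz; rewrite addrC -scaleN1r (sip_lin sB)// mulN1r addrC.
Qed.

Lemma sipZl k x z : S x -> S z -> B (k *: x) z = k * B x z.
Proof.
move=> Sx Sz.
have S0 : S (x - x) by exact: lin_closedB.
have := sip_lin sB k Sx S0 Sz.
by rewrite sipBl// !subrr !addr0.
Qed.

Lemma sipDr x y z : S x -> S y -> S z -> B z (x + y) = B z x + B z y.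
Proof.
move=> Sx Sy Sz; rewrite (sip_sym sB)//; last exact: lin_closedD.
by rewrite sipDl// (@sip_sym _ _ _ _ sB x)// (@sip_sym _ _ _ _ sB y).
Qed.

Lemma sipBr x y z : S x -> S y -> S z -> B z (x - y) = B z x - B z y.
Proof.
move=> Sx Sy Sz; rewrite (sip_sym sB)//; last exact: lin_closedB.
by rewrite sipBl// (@sip_sym _ _ _ _ sB x)// (@sip_sym _ _ _ _ sB y).
Qed.

Lemma sipZr k x z : S x -> S z -> B z (k *: x) = k * B z x.
Proof.
move=> Sx Sz; rewrite (sip_sym sB)//; last exact: lin_closedZ.
by rewrite sipZl// (@sip_sym _ _ _ _ sB x).
Qed.

Lemma sipnorm_ge0 x : 0 <= N x.
Proof. exact: sqrtr_ge0. Qed.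

Lemma sipnorm_sqr x : S x -> N x ^+ 2 = B x x.
Proof. by move=> Sx; rewrite sqr_sqrtr// (sip_ge0 sB). Qed.

(** The form is nonnegative on every [x - k *: y], a quadratic polynomial in [k].
    It is evaluated at its minimum, or, when [B y y = 0], where it is negative
    unless [B x y = 0]. *)
Lemma sip_CauchySchwarz x y : S x -> S y -> `|B x y| <= N x * N y.
Proof.
move=> Sx Sy.
have h k : 0 <= B x x - 2 * k * B x y + k ^+ 2 * B y y.
  have SK : S (k *: y) by exact: lin_closedZ.
  have := sip_ge0 sB (lin_closedB cS Sx SK).
  rewrite sipBl//; last exact: lin_closedB.
  rewrite !sipBr// !sipZl// !sipZr// (sip_sym sB Sy Sx)//.
  by move/le_trans; apply; rewrite le_eqVlt; apply/orP; left; apply/eqP; ring.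
have hs : B x y ^+ 2 <= B x x * B y y.
  have [y0|ypos] := eqVneq (B y y) 0.
    rewrite y0 mulr0.
    have := h ((B x x + 1) / (2 * B x y)); rewrite y0 mulr0 addr0.
    have [->|xy0] := eqVneq (B x y) 0; first by rewrite expr0n/=.
    rewrite (_ : _ - _ = -1); first by rewrite lerNr oppr0 ler10.
    by field.
  have yp : 0 < B y y by rewrite lt_neqAle eq_sym ypos (sip_ge0 sB).
  have := h (B x y / B y y).
  rewrite (_ : _ + _ = (B x x * B y y - B x y ^+ 2) / B y y); last by field.
  by rewrite pmulr_lge0 ?invr_gt0// subr_ge0.
rewrite -(ler_pXn2r (n := 2))// ?nnegrE ?mulr_ge0 ?sipnorm_ge0//.
by rewrite exprMn !sipnorm_sqr// real_normK// num_real.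
Qed.

Lemma sipnormD x y : S x -> S y -> N (x + y) <= N x + N y.
Proof.
move=> Sx Sy; have Sxy := lin_closedD cS Sx Sy.
rewrite -(ler_pXn2r (n := 2))// ?nnegrE ?addr_ge0 ?sipnorm_ge0//.
rewrite sqrrD !sipnorm_sqr// sipDl// !sipDr// (sip_sym sB Sy Sx)//.
have := sip_CauchySchwarz Sx Sy; rewrite ler_norml => /andP[_].
by rewrite mulr2n; lra.
Qed.

Lemma sipnormZ k x : S x -> N (k *: x) = `|k| * N x.
Proof.
move=> Sx; rewrite /sipnorm sipZl// ?sipZr//; last exact: lin_closedZ.
by rewrite mulrA -expr2 sqrtrM ?sqr_ge0// sqrtr_sqr.
Qed.

Lemma sipnormBC x y : S x -> S y -> N (x - y) = N (y - x).
Proof.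
move=> Sx Sy; rewrite -[in LHS]opprB -[- (y - x)]scaleN1r sipnormZ; last exact: lin_closedB.
by rewrite normrN1 mul1r.
Qed.

Lemma sipnormB x y : S x -> S y -> N (x - y) <= N x + N y.
Proof.
move=> Sx Sy; rewrite -[- y]scaleN1r.
apply: le_trans (sipnormD Sx _) _; first exact: lin_closedZ.
by rewrite sipnormZ// normrN1 mul1r.
Qed.

Lemma sipnorm_triangle y x z : S x -> S y -> S z ->
  N (x - z) <= N (x - y) + N (y - z).
Proof.
move=> Sx Sy Sz; rewrite -(subrKA y x).
by apply: sipnormD; exact: lin_closedB.
Qed.

End semi_inner.

(** * Integrating a pointwise bound on the derivative *)

(** Continuous induction: the points up to which the bound holds have a supremum
    that belongs to them, by the behaviour of [f] on the left and the monotonicity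
    of [F]; the local bound on the right would carry it further. *)
Lemma le_increment_of_right_increments {R : realType} (a b : R) (f F : R -> R) :
  a <= b ->
  {in `[a, b] &, {homo F : x y / x <= y}} ->
  (forall t, a <= t -> t < b -> exists2 e, 0 < e &
    forall y, t < y -> y < t + e -> y <= b -> f y - f t <= F y - F t) ->
  (forall t, a < t -> t <= b -> forall e, 0 < e -> exists2 e', 0 < e' &
    forall y, t - e' < y -> y < t -> a <= y -> f t - f y <= e) ->
  f b - f a <= F b - F a.
Proof.
move=> ab ndF right_incr left_lsc.
pose A := [set x | a <= x <= b /\ f x - f a <= F x - F a].
have Aa : A a by rewrite /A /= lexx ab !subrr.
have supA : has_sup A.
  by split; [exists a|exists b => x [/andP[]]].
have aS : a <= sup A by exact: ub_le_sup supA.2 _ Aa.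
have Sb : sup A <= b by apply: ge_sup; [exists a|move=> x [/andP[]]].
have AS : A (sup A).
  split; first by rewrite aS Sb.
  have [->|aSneq] := eqVneq (sup A) a; first by rewrite !subrr.
  have aS' : a < sup A by rewrite lt_neqAle eq_sym aSneq.
  apply/ler_addgt0Pr => e e0.
  have [e' e'0 he'] := left_lsc _ aS' Sb e e0.
  have [y Ay Sy] := sup_adherent e'0 supA.
  have yS : y <= sup A by exact: ub_le_sup supA.2 _ Ay.
  have [/andP[ay yb] fy] := Ay.
  move: yS; rewrite le_eqVlt => /predU1P[<-|yS].
    by apply: le_trans fy _; rewrite lerDl ltW.
  have := he' _ Sy yS ay.
  have : F y <= F (sup A) by apply: ndF; rewrite ?in_itv/= ?ay ?yb ?aS ?Sb// ltW.
  lra.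
move: Sb; rewrite le_eqVlt => /predU1P[<-|Sb]; first exact: AS.2.
have [e e0 he] := right_incr _ aS Sb.
pose y := Num.min (sup A + e / 2) b.
have Sy : sup A < y by rewrite lt_min Sb andbT ltrDl divr_gt0.
have ye : y < sup A + e by rewrite gt_min ltrD2l gtr_pMr// invf_lt1// ltr1n.
have yb : y <= b by rewrite ge_min lexx orbT.
have : A y.
  split; first by rewrite yb andbT (le_trans aS)// ltW.
  have := he _ Sy ye yb; have := AS.2; lra.
by move=> /(ub_le_sup supA.2); rewrite leNgt Sy.
Qed.

Section open_layers.
Context {R : realType}.
Notation leb := (@lebesgue_measure R).
Variables (a b eps : R) (G : R -> R).
Hypotheses (ab : a <= b) (eps0 : 0 < eps).
Hypothesis G0 : forall t, a <= t <= b -> 0 <= G t.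
Hypothesis iG : leb.-integrable `[a, b] (EFin \o G).

Let layer (k : nat) : set R :=
  `[a, b] `&` G @^-1` `[k%:R * eps, k.+1%:R * eps[.

Let measurable_layer k : measurable (layer k).
Proof.
have /measurable_EFinP mG := measurable_int leb iG.
exact: mG.
Qed.

Let layer_subset k : layer k `<=` `[a, b].
Proof. by move=> x []. Qed.

Let trivIset_layer : trivIset setT layer.
Proof.
apply/trivIsetP => i j _ _; wlog ij : i j / (i < j)%N.
  move=> h; rewrite neq_ltn => /orP[ij|ji]; first by rewrite h// ltn_eqF.
  by rewrite setIC h// ltn_eqF.
move=> _; rewrite -subset0 => x [[_ /=]]; rewrite in_itv/= => /andP[_ xi].
move=> [_ /=]; rewrite in_itv/= => /andP[xj _].
have := le_lt_trans xj xi; rewrite ltr_pM2r// ltr_nat ltnS => ji.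
by rewrite ltnNge ji in ij.
Qed.

Let bigcup_layer : \bigcup_k layer k = `[a, b]%classic.
Proof.
apply/seteqP; split; first by move=> x [k _ []].
move=> x xab; exists (Num.truncn (G x / eps)) => //; split => //=.
have G0x : 0 <= G x / eps.
  by rewrite divr_ge0 ?(ltW eps0)// G0//; move: xab; rewrite /= in_itv.
have /andP[h1 h2] := truncn_itv G0x.
by rewrite in_itv/= -ler_pdivlMr// h1 -ltr_pdivrMr.
Qed.

Let leb_itv_fin A : A `<=` `[a, b]%classic -> measurable A -> (leb A < +oo)%E.
Proof.
move=> Aab mA; apply: (@le_lt_trans _ _ (leb `[a, b]%classic)).
  by apply: le_measure; rewrite ?inE//; exact: measurable_itv.
by rewrite lebesgue_measure_itv/=; case: ifP; rewrite ltry.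
Qed.

Let sum_layers :
  (\sum_(k <oo) (k.+1%:R * eps)%:E * leb (layer k) <=
   (\int[leb]_(t in `[a, b]) G t + eps * (b - a))%:E)%E.
Proof.
have -> : ((\int[leb]_(t in `[a, b]) G t + eps * (b - a))%:E =
           \int[leb]_(t in `[a, b]) (G t + eps)%:E)%E.
  rewrite EFinD /Rintegral fineK; last exact: integrable_fin_num.
  rewrite integralD_EFin//=; last first.
    apply/integrableP; split; first exact: measurable_cst.
    by rewrite integral_cst//= lte_mul_pinfty// leb_itv_fin.
  rewrite integral_cst//= lebesgue_measure_itv/= lte_fin.
  congr (_ + _)%E; case: ltP => [//|ba].
  by rewrite (le_anti (introT andP (conj ab ba))) subrr !mulr0 mule0.
rewrite -bigcup_layer ge0_integral_bigcup//=.
- apply: lee_nneseries => [k _ _|k _]; first by rewrite mule_ge0// lee_fin mulr_ge0// ltW.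
  rewrite -integral_cst; last exact: measurable_layer.
  apply: ge0_le_integral.
  + exact: measurable_layer.
  + by move=> x _; rewrite /= lee_fin mulr_ge0// ltW.
  + exact: measurable_cst.
  + have /measurable_EFinP mG := measurable_int leb iG.
    apply/measurable_EFinP; apply: measurable_funD => //.
    exact: measurable_funS mG.
  + move=> x [_ /=]; rewrite in_itv/= => /andP[h _].
    by rewrite lee_fin -natr1 mulrDl mul1r lerD2r.
- have /measurable_EFinP mG := measurable_int leb iG.
  rewrite bigcup_layer.
  by apply/measurable_EFinP; apply: measurable_funD.
- rewrite bigcup_layer => x /=; rewrite in_itv/= => xab.
  by rewrite lee_fin addr_ge0 ?G0// ltW.
Qed.

(** The Vitali-Caratheodory idea. The layer [k * eps <= G < k.+1 * eps] lies in an
    open set [V k] of almost the same measure, and [F x] is the sum of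
    [k.+1 * eps] times the measure of [V k] within [[a, x]]. A point [t] of the
    layer has a neighbourhood in [V k], on which [F] grows at a rate of at least
    [k.+1 * eps > G t]. *)
Lemma increasing_majorant_of_primitive : exists F : R -> R,
  [/\ {in `[a, b] &, {homo F : x y / x <= y}},
      forall t, a <= t -> t < b -> exists2 e, 0 < e &
        forall y, t < y -> y < t + e -> y <= b -> G t * (y - t) <= F y - F t &
      F b - F a <= \int[leb]_(t in `[a, b]) G t + eps * (b - a) + eps].
Proof.
pose w k : R := k.+1%:R * eps.
(* the excess of [V k] is chosen so that all layers together cost at most [eps] *)
have w0 k : 0 < w k by rewrite mulr_gt0.
have /choice[V hV] : forall k, exists U : set R,
    [/\ open U, layer k `<=` U &
        (leb (U `\` layer k) < (eps / (2 ^ k.+1)%:R / w k)%:E)%E].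
  move=> k; apply: lebesgue_regularity_outer => //; last first.
    by rewrite divr_gt0// divr_gt0// ltr0n expn_gt0.
  by apply: leb_itv_fin => //; exact: layer_subset.
have mV k : measurable (V k) by case: (hV k) => oV _ _; exact: open_measurable.
have mVi k (i : interval R) : measurable (V k `&` [set` i]).
  by apply: measurableI.
pose Fe x : \bar R := (\sum_(k <oo) (w k)%:E * leb (V k `&` `[a, x]))%E.
have term0 k A : (0 <= (w k)%:E * leb A)%E.
  by rewrite mule_ge0// lee_fin ltW.
have Fe0 x : (0 <= Fe x)%E by exact: nneseries_ge0.
have Feb : (Fe b <= (\int[leb]_(t in `[a, b]) G t + eps * (b - a) + eps)%:E)%E.
  rewrite EFinD; apply: le_trans (leeD2r _ sum_layers).
  apply: le_trans (epsilon_trick _ _ (ltW eps0)); last by move=> *; exact: term0.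
  apply: lee_nneseries => // k _.
  have [_ _ hk] := hV k.
  apply: (@le_trans _ _ ((w k)%:E * (leb (layer k) + leb (V k `\` layer k)))%E).
    rewrite lee_pmul2l// ?lte_fin//.
    have mVD : measurable (V k `\` layer k) by apply: measurableD.
    apply: (le_trans _ (measureU2 leb (measurable_layer k) mVD)).
    apply: le_measure.
    - by rewrite inE; exact: mVi.
    - by rewrite inE; exact: (measurableU _ _ (measurable_layer k) mVD).
    - move=> x [Vx _]; have [?|?] := pselect (layer k x); [by left|by right].
  rewrite ge0_muleDr// leeD2l//.
  apply: le_trans (lee_wpmul2l _ (ltW hk)) _; first by rewrite lee_fin ltW.
  by rewrite -EFinM lee_fin mulrCA divff ?mulr1// gt_eqF.
have Fele x y : x <= y -> (Fe x <= Fe y)%E.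
  move=> xy; apply: lee_nneseries => // k _.
  rewrite lee_pmul2l// ?lte_fin//; apply: le_measure.
  - by rewrite inE; exact: mVi.
  - by rewrite inE; exact: mVi.
  by apply: setIS; apply: subset_itvl; rewrite bnd_simp.
have Fefin x : x <= b -> Fe x \is a fin_num.
  move=> xb; rewrite ge0_fin_numE//.
  by apply: le_lt_trans (Fele _ _ xb) _; apply: le_lt_trans Feb _; exact: ltry.
exists (fine \o Fe); split => /=.
- move=> x y; rewrite !in_itv/= => /andP[_ xb] /andP[_ yb] xy.
  by rewrite fine_le ?Fefin// Fele.
- move=> t at_ tb.
  have tab : `[a, b]%classic t by rewrite /= in_itv/= at_ ltW.
  have [k _ kt] : (\bigcup_k layer k) t by rewrite bigcup_layer.
  have [oVk lV _] := hV k.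
  have /nbhs_ballP[e /= e0 he] := oVk _ (lV _ kt).
  exists e => // y ty ye yb.
  apply: (@le_trans _ _ (w k * (y - t))).
    rewrite ler_wpM2r ?subr_ge0 ?(ltW ty)//.
    by case: kt => _ /=; rewrite in_itv/= => /andP[_ /ltW].
  rewrite -lee_fin EFinB !fineK ?Fefin ?(ltW tb)//.
  rewrite leeBrDl ?Fefin ?(ltW tb)//.
  have split_itv j : (leb (V j `&` `[a, y]) =
      leb (V j `&` `[a, t]) + leb (V j `&` `]t, y]))%E.
    rewrite -measureU//.
    - rewrite -setIUr; congr (leb (_ `&` _)).
      apply: itv_bndbnd_setU; rewrite bnd_simp//; exact: ltW.
    - exact: mVi.
    - exact: mVi.
    - rewrite -subset0 => x [[_ /=]]; rewrite in_itv/= => /andP[_ xt].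
      by move=> [_ /=]; rewrite in_itv/= ltNge xt.
  have -> : Fe y = (\sum_(j <oo) ((w j)%:E * leb (V j `&` `[a, t]) +
      (w j)%:E * leb (V j `&` `]t, y])))%E.
    by apply: eq_eseriesr => j _; rewrite split_itv ge0_muleDr.
  rewrite nneseriesD//; apply: leeD2l.
  rewrite (@nneseriesD1 _ _ k)//.
  apply: le_trans (leeDl _ (nneseries_ge0 _)) => //.
  rewrite EFinM lee_pmul2l// ?lte_fin//.
  rewrite (_ : V k `&` _ = `]t, y]%classic).
    by rewrite lebesgue_measure_itv/= lte_fin ty.
  apply/setIidPr => x /=; rewrite in_itv/= => /andP[tx xy]; apply: he.
  rewrite /ball/= ltr_distlC; apply/andP; split.
    by rewrite (lt_trans _ tx)// ltrBlDr ltrDl.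
  exact: le_lt_trans ye.
- rewrite -lee_fin; apply: le_trans Feb.
  rewrite -[leRHS]fineK ?Fefin// lee_fin.
  by rewrite lerBlDr lerDl fine_ge0.
Qed.

End open_layers.

(** The fundamental inequality of calculus for a bound [G] on the derivative that is
    merely integrable; the estimates of the projection errors provide no more
    regularity in time than that. The increasing function of the previous lemma
    replaces the primitive of [G]. *)
Lemma le_integral_of_right_derivative {R : realType} (a b : R) (f G : R -> R) :
  a <= b ->
  (forall t, a <= t <= b -> 0 <= G t) ->
  lebesgue_measure.-integrable `[a, b] (EFin \o G) ->
  (forall t, a <= t -> t < b -> forall eps, 0 < eps -> exists2 e, 0 < e &
    forall y, t < y -> y < t + e -> y <= b -> f y - f t <= (G t + eps) * (y - t)) ->
  (forall t, a < t -> t <= b -> forall e, 0 < e -> exists2 e', 0 < e' &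
    forall y, t - e' < y -> y < t -> a <= y -> f t - f y <= e) ->
  f b - f a <= \int[lebesgue_measure]_(t in `[a, b]) G t.
Proof.
move=> ab G0 iG hright hleft.
apply/ler_addgt0Pr => e e0.
have ba0 : 0 < 2 * (b - a) + 1 by rewrite ltr_wpDl// mulr_ge0// subr_ge0.
pose eps := e / (2 * (b - a) + 1).
have eps0 : 0 < eps by rewrite divr_gt0.
have [F [ndF hF Fb]] := increasing_majorant_of_primitive ab eps0 G0 iG.
pose F' t := F t + eps * t.
apply: (@le_trans _ _ (F' b - F' a)).
  apply: le_increment_of_right_increments => //.
  - move=> x y xab yab xy; rewrite /F' lerD ?ndF// ler_wpM2l// ltW//.
  - move=> t at_ tb.
    have [e1 e10 h1] := hright _ at_ tb _ eps0.
    have [e2 e20 h2] := hF _ at_ tb.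
    exists (Num.min e1 e2); first by rewrite lt_min e10.
    move=> y ty yt yb.
    have ye1 : y < t + e1 by apply: lt_le_trans yt _; rewrite lerD2l ge_min lexx.
    have ye2 : y < t + e2.
      by apply: lt_le_trans yt _; rewrite lerD2l ge_min lexx orbT.
    have := h1 _ ty ye1 yb; have := h2 _ ty ye2 yb; rewrite /F'; nra.
have -> : e = eps * (2 * (b - a) + 1) by rewrite divfK// gt_eqF.
rewrite /F'; lra.
Qed.

(** * Differentiable curves in a seminorm *)

Section integrable_real.
Context d (T : measurableType d) {R : realType}.
Variables (mu : {measure set T -> \bar R}) (D : set T).
Hypothesis mD : measurable D.
Implicit Types f g : T -> R.

Lemma integrable_lin k f g :
  mu.-integrable D (fun x => (f x)%:E) -> mu.-integrable D (fun x => (g x)%:E) ->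
  mu.-integrable D (fun x => (k * f x + g x)%:E).
Proof.
move=> f_int g_int.
exact: (integrableD mD (integrableZl mD k f_int) g_int).
Qed.

Lemma integrable_add f g :
  mu.-integrable D (fun x => (f x)%:E) -> mu.-integrable D (fun x => (g x)%:E) ->
  mu.-integrable D (fun x => (f x + g x)%:E).
Proof. by move=> f_int g_int; exact: (integrableD mD f_int g_int). Qed.

Lemma integrable_scale k f :
  mu.-integrable D (fun x => (f x)%:E) -> mu.-integrable D (fun x => (k * f x)%:E).
Proof. by move=> f_int; exact: (integrableZl mD k f_int). Qed.

Lemma integrable_dominated f g :
  measurable_fun D f -> (forall x, D x -> `|f x| <= g x) ->
  mu.-integrable D (fun x => (g x)%:E) -> mu.-integrable D (fun x => (f x)%:E).
Proof.
move=> mf fg; apply: le_integrable => //; first exact/measurable_EFinP.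
move=> x Dx /=; rewrite lee_fin; apply: le_trans (fg _ Dx) _; exact: ler_norm.
Qed.

Lemma Rintegral_lin k f g :
  mu.-integrable D (fun x => (f x)%:E) -> mu.-integrable D (fun x => (g x)%:E) ->
  \int[mu]_(x in D) (k * f x + g x) =
  k * \int[mu]_(x in D) f x + \int[mu]_(x in D) g x.
Proof.
move=> f_int g_int; rewrite RintegralD//; last exact: integrable_scale.
by rewrite RintegralZl.
Qed.

End integrable_real.

Section square_root_integral.
Context {R : realType}.
Notation leb := (@lebesgue_measure R).

Lemma integrable_cst_itv (a b k : R) : leb.-integrable `[a, b] (fun=> k%:E).
Proof.
apply/integrableP; split; first exact: measurable_cst.
under eq_integral do rewrite abse_EFin.
rewrite integral_cst//= lebesgue_measure_itv/=.
by case: ifP => _; rewrite -?EFinB -?EFinM ?mule0 ltry.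
Qed.

Lemma Rintegral_cst_itv (a b k : R) : a <= b ->
  \int[leb]_(t in `[a, b]) k = k * (b - a).
Proof.
move=> ab.
have len : fine (leb `[a, b]%classic) = b - a.
  rewrite lebesgue_measure_itv/= lte_fin; case: ltP => //= ba.
  by apply/esym/eqP; rewrite subr_eq0 eq_le ab ba.
by rewrite Rintegral_cst// len.
Qed.

Lemma integrable_sqrt (a b : R) (W : R -> R) :
  (forall t, a <= t <= b -> 0 <= W t) ->
  leb.-integrable `[a, b] (fun t => (W t)%:E) ->
  leb.-integrable `[a, b] (fun t => (Num.sqrt (W t))%:E).
Proof.
move=> W0 W_int.
apply: (@integrable_dominated _ _ _ leb `[a, b]%classic _ _ (fun t => 1 + W t)) => //.
- have /measurable_EFinP mW := measurable_int leb W_int.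
  exact: (measurableT_comp (continuous_measurable_fun (@sqrt_continuous R)) mW).
- move=> t; rewrite /= in_itv/= => /W0 Wt0.
  rewrite ger0_norm ?sqrtr_ge0// -[X in 1 + X]sqr_sqrtr//.
  by have := sqr_ge0 (Num.sqrt (W t) - 2^-1); nra.
- by apply: integrable_add => //; exact: integrable_cst_itv.
Qed.

(** Cauchy-Schwarz on a bounded interval: the variance of [sqrt W] around its
    mean is nonnegative. *)
Lemma sqr_Rintegral_sqrt (a b : R) (W : R -> R) : a <= b ->
  (forall t, a <= t <= b -> 0 <= W t) ->
  leb.-integrable `[a, b] (fun t => (W t)%:E) ->
  (\int[leb]_(t in `[a, b]) Num.sqrt (W t)) ^+ 2 <=
  (b - a) * \int[leb]_(t in `[a, b]) W t.
Proof.
move=> ab W0 W_int; have g_int := integrable_sqrt W0 W_int.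
have cst_int k := Rintegral_cst_itv k ab.
move: ab; rewrite le_eqVlt => /predU1P[ab|ab].
  rewrite -ab subrr mul0r [X in X ^+ 2](_ : _ = 0) ?expr0n//.
  by rewrite set_itv1 Rintegral_set1.
set I := Rintegral _ _ _; pose m := I / (b - a).
have ba : 0 < b - a by rewrite subr_gt0.
have : 0 <= \int[leb]_(t in `[a, b]) (Num.sqrt (W t) - m) ^+ 2.
  by apply: Rintegral_ge0 => t _; exact: sqr_ge0.
rewrite (@eq_Rintegral _ _ _ leb _
  (fun t => - (2 * m) * Num.sqrt (W t) + (W t + m ^+ 2))); last first.
  move=> t; rewrite inE/= in_itv/= => /W0 Wt0; rewrite sqrrB sqr_sqrtr// mulr2n; ring.
have mc := integrable_cst_itv a b (m ^+ 2).
rewrite Rintegral_lin//; last exact: integrable_add.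
rewrite RintegralD// cst_int -/I.
have -> : I = m * (b - a) by rewrite /m divfK// gt_eqF.
set J := Rintegral _ _ _; nra.
Qed.

Lemma Rintegral_itv_split (a b c : R) (W : R -> R) : a <= b -> b <= c ->
  leb.-integrable `[a, c] (fun t => (W t)%:E) ->
  \int[leb]_(t in `[a, c]) W t - \int[leb]_(t in `[a, b]) W t =
  \int[leb]_(t in `[b, c]) W t.
Proof.
move=> ab bc W_int.
rewrite (@Rintegral_itvB _ W (BLeft a) (BRight c) b)//; try by rewrite bnd_simp.
rewrite Rintegral_itv_obnd_cbnd//; apply: integrableS W_int => //.
by apply: subset_itvr; rewrite bnd_simp.
Qed.

Lemma integrable_itvS (a b a' b' : R) (W : R -> R) : a <= a' -> b' <= b ->
  leb.-integrable `[a, b] (fun t => (W t)%:E) ->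
  leb.-integrable `[a', b'] (fun t => (W t)%:E).
Proof.
move=> aa bb; apply: integrableS => //.
by apply: subset_itv; rewrite bnd_simp.
Qed.

Lemma le_Rintegral_itvS (a b a' b' : R) (W : R -> R) : a <= a' -> b' <= b ->
  (forall t, a <= t <= b -> 0 <= W t) ->
  leb.-integrable `[a, b] (fun t => (W t)%:E) ->
  \int[leb]_(t in `[a', b']) W t <= \int[leb]_(t in `[a, b]) W t.
Proof.
move=> aa bb W0 W_int; have W_int' := integrable_itvS aa bb W_int.
rewrite /Rintegral fine_le ?integrable_fin_num//.
have g0 r : `[a, b]%classic r -> (0 <= (W r)%:E)%E.
  by rewrite /= in_itv/= => /W0; rewrite lee_fin.
have ss : `[a', b'] `<=` `[a, b]%classic by apply: subset_itv; rewrite bnd_simp.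
exact: (@ge0_subset_integral _ _ _ leb _ _ (measurable_itv _) (measurable_itv _)
  _ (measurable_int leb W_int) g0 ss).
Qed.

End square_root_integral.

Section time_derivative_estimates.
Context {R : realType} {X : lmodType R} (S S' : set X) (B : X -> X -> R).
Variables (nm : X -> R) (C0 T : R).
Hypotheses (sB : semi_inner S B) (S'S : S' `<=` S).
Notation leb := (@lebesgue_measure R).
Local Notation N := (sipnorm B).
Let cS := sip_closed sB.

Lemma has_tderiv_increment x dx : (forall v, S v -> N v <= C0 * nm v) ->
  has_tderiv S' nm T x dx -> forall t z eps, 0 <= t <= T -> S z -> 0 < eps ->
  exists2 e, 0 < e & forall r, 0 <= r <= T -> `|r - t| < e ->
    N (x r - x t - (r - t) *: z) <= `|r - t| * (eps + N (dx t - z)).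
Proof.
move=> NC xdx t z eps tT Sz eps0.
have [/S'S Sxt /S'S Sdxt dxt] := xdx t tT.
have C1 : 0 < `|C0| + 1 by rewrite ltr_wpDl.
have : \forall r \near within `[0, T] t^',
    `|nm ((r - t)^-1 *: (x r - x t) - dx t)| < eps / (`|C0| + 1).
  by apply: (cvgr0Pnorm_lt _).1 dxt _ _; rewrite divr_gt0.
move=> /nbhs_ballP[e /= e0 he]; exists e => // r rT rte.
have [->|rt] := eqVneq r t.
  by rewrite !subrr scale0r subr0 normr0 mul0r -(scale0r z) (sipnormZ sB)// normr0 mul0r.
have rt0 : r - t != 0 by rewrite subr_eq0.
have [/S'S Sxr _ _] := xdx r rT.
have Sq : S ((r - t)^-1 *: (x r - x t)).
  by apply: lin_closedZ => //; exact: lin_closedB.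
have -> : x r - x t - (r - t) *: z =
    (r - t) *: (((r - t)^-1 *: (x r - x t) - dx t) + (dx t - z)).
  by rewrite subrKA scalerBr scalerA divff// scale1r.
have Sqd := lin_closedB cS Sq Sdxt; have Sdz := lin_closedB cS Sdxt Sz.
rewrite (sipnormZ sB); last exact: lin_closedD.
rewrite ler_wpM2l//; apply: le_trans (sipnormD sB Sqd Sdz) _; rewrite lerD2r.
apply: le_trans (NC _ Sqd) _.
have : `|nm ((r - t)^-1 *: (x r - x t) - dx t)| < eps / (`|C0| + 1).
  by apply: he => //=; rewrite ?in_itv//= /ball/= distrC.
set y := nm _; rewrite ltr_pdivlMr// => ylt.
apply: le_trans (ler_norm _) _; rewrite normrM.
by have := normr_ge0 y; nra.
Qed.

(** The scalar inequality is applied to the norm of [x t - x a - (t - a) *: z], whose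
    right derivative is at most [N (dx t - z)]; so no vector-valued integral has to
    be formed. Squares are used throughout because the energy argument sums
    squares. *)
Lemma has_tderiv_mean_value x dx : (forall v, S v -> N v <= C0 * nm v) ->
  has_tderiv S' nm T x dx -> forall a b z (W : R -> R),
  0 <= a -> a <= b -> b <= T -> S z ->
  (forall t, a <= t <= b -> N (dx t - z) ^+ 2 <= W t) ->
  leb.-integrable `[a, b] (fun t => (W t)%:E) ->
  N (x b - x a - (b - a) *: z) ^+ 2 <= (b - a) * \int[leb]_(t in `[a, b]) W t.
Proof.
move=> NC xdx a b z W a0 ab bT Sz dxW W_int.
have W0 t : a <= t <= b -> 0 <= W t.
  by move=> /dxW; apply: le_trans; exact: sqr_ge0.
have Sx t : a <= t <= b -> S (x t).
  move=> /andP[at_ tb].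
  by have [|/S'S] := xdx t _; first by rewrite (le_trans a0)// (le_trans tb).
have aab : a <= a <= b by rewrite lexx.
have bab : a <= b <= b by rewrite lexx ab.
pose f t := N (x t - x a - (t - a) *: z).
have Sf t : a <= t <= b -> S (x t - x a - (t - a) *: z).
  move=> tab; apply: (lin_closedB cS); last exact: (lin_closedZ cS).
  by apply: (lin_closedB cS); exact: Sx.
have f_incr t r : a <= t <= b -> a <= r <= b ->
    f r - f t <= N (x r - x t - (r - t) *: z).
  move=> tab rab; rewrite lerBlDr /f.
  have -> : x r - x a - (r - a) *: z =
      (x r - x t - (r - t) *: z) + (x t - x a - (t - a) *: z).
    rewrite addrACA -opprD -scalerDl !subrKA; congr (_ - _).
  apply: (sipnormD sB); last exact: Sf.
  apply: (lin_closedB cS); last exact: (lin_closedZ cS).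
  by apply: (lin_closedB cS); exact: Sx.
have f0 : f a = 0.
  by rewrite /f !subrr scale0r subr0 -(scale0r z) (sipnormZ sB)// normr0 mul0r.
have fb : f b <= \int[leb]_(t in `[a, b]) Num.sqrt (W t).
  rewrite -[leLHS]subr0 -[in leLHS]f0; apply: le_integral_of_right_derivative => //.
  - exact: (integrable_sqrt W0 W_int).
  - move=> t at_ tb eps eps0.
    have tab : a <= t <= b by rewrite at_ ltW.
    have tT : 0 <= t <= T by rewrite (le_trans a0)// (le_trans (ltW tb)).
    have [e e0 he] := has_tderiv_increment NC xdx tT Sz eps0.
    exists e => // y ty ye yb.
    have yab : a <= y <= b by rewrite yb (le_trans at_)// ltW.
    apply: le_trans (f_incr _ _ tab yab) _.
    apply: le_trans (he y _ _) _.
    + by rewrite (le_trans a0) ?(le_trans yb)//; case/andP: yab.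
    + by rewrite gtr0_norm ?subr_gt0// ltrBlDl.
    rewrite gtr0_norm ?subr_gt0// mulrC ler_wpM2r ?subr_ge0 ?(ltW ty)//.
    rewrite addrC lerD2r -[leLHS]ger0_norm ?sipnorm_ge0// -sqrtr_sqr.
    by rewrite ler_wsqrtr// dxW.
  - move=> t at_ tb e e0.
    have tab : a <= t <= b by rewrite tb ltW.
    have tT : 0 <= t <= T by rewrite (le_trans a0 (ltW at_)) (le_trans tb).
    have [e1 e10 he] := has_tderiv_increment NC xdx tT Sz ltr01.
    set K := 1 + N (dx t - z) in he.
    have K0 : 0 < K by rewrite ltr_pwDl// sipnorm_ge0.
    exists (Num.min e1 (e / K)); first by rewrite lt_min e10 divr_gt0.
    move=> y yt ty ay.
    have yab : a <= y <= b by rewrite ay (le_trans (ltW ty)).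
    have [yt1 yt2] : t - y < e1 /\ t - y < e / K.
      by apply/andP; rewrite -lt_min ltrBlDr addrC -ltrBlDr.
    apply: le_trans (f_incr _ _ yab tab) _.
    have Sy := Sx _ yab; have St := Sx _ tab.
    have -> : N (x t - x y - (t - y) *: z) = N (x y - x t - (y - t) *: z).
      have -> : x t - x y - (t - y) *: z = -1 *: (x y - x t - (y - t) *: z).
        by rewrite scaleN1r [in RHS]opprD opprK [in RHS]opprB -scaleNr opprB.
      rewrite (sipnormZ sB) ?normrN1 ?mul1r//.
      apply: (lin_closedB cS); last exact: (lin_closedZ cS).
      exact: (lin_closedB cS).
    have yt0 : `|y - t| = t - y by rewrite distrC gtr0_norm// subr_gt0.
    apply: le_trans (he y _ _) _; rewrite ?yt0//.
      by rewrite (le_trans a0 ay) (le_trans (ltW ty))//; case/andP: tT.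
    by rewrite -/K -ler_pdivlMr// ltW.
apply: le_trans (sqr_Rintegral_sqrt ab W0 W_int).
by rewrite ler_pXn2r ?nnegrE ?sipnorm_ge0// Rintegral_ge0// => t _; exact: sqrtr_ge0.
Qed.

(** The weak derivative is tested with the functional that represents the increment
    itself, [B (u b - u a)], which turns the scalar identity into a bound on its
    norm. *)
Lemma has_L2_tderiv_increment u du : (forall v, S v -> N v <= C0 * nm v) ->
  (forall t, 0 <= t <= T -> S (u t)) ->
  has_L2_tderiv S' nm T u du -> forall a b (W : R -> R),
  0 <= a -> a <= b -> b <= T ->
  (forall t, a <= t <= b -> N (du t) ^+ 2 <= W t) ->
  leb.-integrable `[a, b] (fun t => (W t)%:E) ->
  N (u b - u a) ^+ 2 <= (b - a) * \int[leb]_(t in `[a, b]) W t.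
Proof.
move=> NC Su [S'du _ udu] a b W a0 ab bT duW W_int.
have W0 t : a <= t <= b -> 0 <= W t.
  by move=> /duW; apply: le_trans; exact: sqr_ge0.
have aT : 0 <= a <= T by rewrite a0 (le_trans ab).
have bT' : 0 <= b <= T by rewrite bT (le_trans a0).
have [Sa Sb] := (Su _ aT, Su _ bT').
set w := u b - u a; have Sw : S w by exact: (lin_closedB cS).
have bw : bounded_functional S' nm (B w).
  split=> [k x y /S'S Sx /S'S Sy|].
    rewrite (sipDr sB) ?(sipZr sB)//; exact: (lin_closedZ cS).
  exists (N w * C0) => x /S'S Sx.
  apply: le_trans (sip_CauchySchwarz sB Sw Sx) _.
  by rewrite -mulrA ler_wpM2l ?sipnorm_ge0// NC.
have [int_phi FTC] := udu _ bw.
have W2 := sqr_Rintegral_sqrt ab W0 W_int; apply: le_trans W2.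
rewrite ler_pXn2r ?nnegrE ?sipnorm_ge0//; last first.
  by apply: Rintegral_ge0 => t _; exact: sqrtr_ge0.
have [->|w0] := eqVneq (N w) 0.
  by apply: Rintegral_ge0 => t _; exact: sqrtr_ge0.
have wpos : 0 < N w by rewrite lt_neqAle eq_sym w0 sipnorm_ge0.
rewrite -(ler_pM2l wpos) -expr2 (sipnorm_sqr sB)//.
have int_phi_b : leb.-integrable `[0, b] (fun t => (B w (du t))%:E).
  exact: integrable_itvS int_phi.
rewrite {2}/w (sipBr sB)//.
have -> : B w (u b) - B w (u a) = \int[leb]_(r in `[a, b]) B w (du r).
  rewrite -(Rintegral_itv_split a0 ab int_phi_b) -!FTC// opprB addrA subrK.
  by [].
have g_int := integrable_sqrt W0 W_int.
rewrite -RintegralZl//; apply: le_Rintegral => //.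
- exact: integrable_itvS int_phi.
- exact: integrable_scale.
move=> t; rewrite /= in_itv/= => tab.
have tT : 0 <= t <= T.
  by case/andP: tab => at_ tb; rewrite (le_trans a0)// (le_trans tb).
have Sdu := S'S (S'du _ tT).
apply: le_trans (ler_norm _) _; apply: le_trans (sip_CauchySchwarz sB Sw Sdu) _.
rewrite ler_wpM2l ?sipnorm_ge0// -[leLHS]ger0_norm ?sipnorm_ge0// -sqrtr_sqr.
by rewrite ler_wsqrtr// duW.
Qed.

End time_derivative_estimates.

(** * Polyhedral domains and their triangulations *)

Section polyhedral.
Context {R : realType} {n : nat}.
Implicit Types (D : set 'rV[R]_n).

Let box (qk : 'rV[rat]_n * nat) : set 'rV[R]_n :=
  [set x | forall i, `|x ord0 i - ratr (qk.1 ord0 i)| < qk.2.+1%:R^-1].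

Let measurable_box qk : measurable (box qk).
Proof.
have -> : box qk = \bigcap_(i in [set: 'I_n])
    ((fun x : 'rV[R]_n => x ord0 i) @^-1`
       `]ratr (qk.1 ord0 i) - qk.2.+1%:R^-1, ratr (qk.1 ord0 i) + qk.2.+1%:R^-1[).
  apply/seteqP; split => x /=.
    by move=> bx i _ /=; rewrite in_itv/= -ltr_distl.
  by move=> bx i; rewrite ltr_distl; have := bx i I; rewrite /= in_itv.
apply: fin_bigcap_measurable; first exact: finite_finset.
move=> i _; rewrite -[X in measurable X]setTI.
exact: measurable_coord.
Qed.

(** An open set is the union of the boxes with rational centre and radius
    [1 / k.+1] that it contains, and these are countably many. *)
Lemma row_open_measurable D : open D -> measurable D.
Proof.
move=> oD.
pose F' qk := if pselect (box qk `<=` D) then box qk else set0.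
pose F (j : nat) := oapp F' set0 (unpickle j).
have mF' qk : measurable (F' qk).
  by rewrite /F'; case: pselect => ? /=; [exact: measurable_box|exact: measurable0].
have F'D qk : F' qk `<=` D by rewrite /F'; case: pselect => ? //=.
suff -> : D = \bigcup_j F j.
  by apply: bigcupT_measurable => j; rewrite /F; case: (unpickle j) => [qk|] /=;
    [exact: mF'|exact: measurable0].
apply/seteqP; split; last first.
  by move=> x [j _]; rewrite /F; case: (unpickle j) => //= qk; exact: F'D.
move=> x Dx; have /nbhs_ballP[e /= e0 xeD] := oD x Dx.
(* the box has radius [r < e / 2] around a point at distance [r] from [x] *)
have e20 : 0 < e / 2 by rewrite divr_gt0.
have [k ke] : exists k, (k.+1%:R^-1 : R) < e / 2.
  have [k _ /(_ k (leqnn _)) h] := near_infty_natSinv_lt (PosNum e20).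
  by exists k.
pose r : R := k.+1%:R^-1.
have r0 : 0 < r by rewrite invr_gt0.
have /choice[q qx] : forall i, exists q : rat, `|x ord0 i - ratr q| < r.
  move=> i; have xr : x ord0 i - r < x ord0 i + r by lra.
  have [q] := rat_in_itvoo xr; rewrite in_itv/= => /andP[q1 q2]; exists q.
  by rewrite ltr_distlC q1.
exists (pickle ((\row_i q i, k) : 'rV[rat]_n * nat)) => //.
rewrite /F pickleK /= /F'; case: pselect => [? i /=|[]]; first by rewrite /= mxE.
move=> y yb; apply: xeD; split => // i j; rewrite (ord1 i) /ball/=.
have := yb j; rewrite /= mxE distrC -/r => yq; have xq := qx j.
apply: le_lt_trans (ler_distD (ratr (q j)) _ _) _.
by move: xq yq ke; rewrite -/r; lra.
Qed.

Lemma polyhedral_domain_measurable D : polyhedral_domain D -> measurable D.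
Proof.
by move=> [_ _ [m [K [_ ->]]]]; apply: row_open_measurable; exact: open_interior.
Qed.

Lemma simplex_bounded (V : 'I_n.+1 -> 'rV[R]_n) x j : simplex V x ->
  `|x ord0 j| <= \sum_i \sum_l `|V i ord0 l|.
Proof.
move=> [c [c0 c1 ->]]; rewrite summxE.
apply: le_trans (ler_norm_sum _ _ _) _; apply: ler_sum => i _.
rewrite mxE normrM ger0_norm//.
apply: (@le_trans _ _ `|V i ord0 j|).
  rewrite ler_piMl// -c1 (bigD1 i)//= lerDl sumr_ge0//.
by rewrite (bigD1 j)//= lerDl sumr_ge0.
Qed.

Lemma mesh_size_ge0 m (K : 'I_m -> 'I_n.+1 -> 'rV[R]_n) : 0 <= mesh_size K.
Proof. exact: bigmax_ge_id. Qed.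

(** Some approximation orders exceed the order [s] of the final estimate; a bound on
    [h] by the domain alone absorbs the surplus powers into the constant. *)
Lemma mesh_size_bounded D : polyhedral_domain D -> exists2 H : R, 1 <= H &
  forall m (K : 'I_m -> 'I_n.+1 -> 'rV[R]_n),
    simplicial_partition D K -> mesh_size K <= H.
Proof.
move=> [_ _ [m0 [K0 [_ DK0]]]].
pose M := \sum_k \sum_i \sum_l `|K0 k i ord0 l|.
have DM x j : D x -> `|x ord0 j| <= M.
  rewrite DK0 => /interior_subset[k _ Kx].
  apply: le_trans (simplex_bounded j Kx) _.
  rewrite /M [leRHS](bigD1 k)//= lerDl.
  by apply: sumr_ge0 => *; apply: sumr_ge0 => *; exact: sumr_ge0.
have cDM x j : closure D x -> `|x ord0 j| <= M.
  move=> cDx; apply/ler_addgt0Pr => e e0.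
  have [y [Dy [_ xy]]] := cDx _ (nbhsx_ballx x e e0).
  have := xy ord0 j; rewrite /ball/= => xye.
  rewrite -[x ord0 j](subrK (y ord0 j)).
  apply: le_trans (ler_normD _ _) _; have := DM y j Dy; lra.
have M0 : 0 <= M.
  by apply: sumr_ge0 => *; apply: sumr_ge0 => *; apply: sumr_ge0.
pose H := Num.sqrt (\sum_(i < n) (2 * M) ^+ 2).
exists (1 + H) => [|m K [_ cDK _]]; first by rewrite lerDl sqrtr_ge0.
apply: bigmax_le => [|k _]; first by rewrite addr_ge0// sqrtr_ge0.
apply: (@le_trans _ _ H); last by rewrite lerDr.
have Kc x : simplex (K k) x -> closure D x by move=> Kx; rewrite cDK; exists k.
apply: ge_sup.
  exists (Defs.edist (K k ord0) (K k ord0)) => /=; exists (K k ord0); exists (K k ord0).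
  suff v0 : simplex (K k) (K k ord0) by split.
  exists (fun i => (i == ord0)%:R); split.
  - by move=> i; rewrite ler0n.
  - rewrite (bigD1 ord0)//= big1 ?addr0// => i /negPf ->; by [].
  - rewrite (bigD1 ord0)//= scale1r big1 ?addr0// => i /negPf ->.
    by rewrite scale0r.
move=> _ [x [y [/Kc cx /Kc cy ->]]].
rewrite ler_wsqrtr// ler_sum// => i _.
rewrite -real_normK ?num_real// ler_pXn2r ?nnegrE ?mulr_ge0//.
apply: le_trans (ler_normB _ _) _.
by have := cDM x i cx; have := cDM y i cy; lra.
Qed.

End polyhedral.

(** * Square-integrable functions *)

Section sip_constructions.
Context {R : realType}.

Lemma sip_pullback {X Y : lmodType R} (S : set X) (S' : set Y) (B : Y -> Y -> R)
    (f : X -> Y) :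
  semi_inner S' B -> lin_closed S -> (forall x, S x -> S' (f x)) ->
  (forall k x y, f (k *: x + y) = k *: f x + f y) ->
  semi_inner S (fun x y => B (f x) (f y)).
Proof.
move=> sB cS SS' f_lin; split => //.
- move=> k x y z Sx Sy Sz; rewrite f_lin.
  by apply: (sip_lin sB); exact: SS'.
- by move=> x y Sx Sy; apply: (sip_sym sB); exact: SS'.
- by move=> x Sx; apply: (sip_ge0 sB); exact: SS'.
Qed.

Lemma sip_sum {X : lmodType R} (S : set X) (I : finType)
    (B : I -> X -> X -> R) : lin_closed S ->
  (forall i, semi_inner S (B i)) -> semi_inner S (fun x y => \sum_i B i x y).
Proof.
move=> cS sB; split => //.
- move=> k x y z Sx Sy Sz; rewrite mulr_sumr -big_split/=.
  by apply: eq_bigr => i _; rewrite (sip_lin (sB i)).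
- by move=> x y Sx Sy; apply: eq_bigr => i _; rewrite (sip_sym (sB i)).
- by move=> x Sx; apply: sumr_ge0 => i _; rewrite (sip_ge0 (sB i)).
Qed.

Lemma sip_addZ {X : lmodType R} (S : set X) (B1 B2 : X -> X -> R) (c1 c2 : R) :
  0 <= c1 -> 0 <= c2 -> semi_inner S B1 -> semi_inner S B2 ->
  semi_inner S (fun x y => c1 * B1 x y + c2 * B2 x y).
Proof.
move=> c10 c20 s1 s2; split.
- exact: sip_closed s1.
- by move=> k x y z Sx Sy Sz; rewrite (sip_lin s1)// (sip_lin s2)//; ring.
- by move=> x y Sx Sy; rewrite (sip_sym s1)// (sip_sym s2).
- by move=> x Sx; rewrite addr_ge0// mulr_ge0// ?(sip_ge0 s1)// (sip_ge0 s2).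
Qed.

Lemma sip_ext {X : lmodType R} (S : set X) (B B' : X -> X -> R) :
  (forall x y, S x -> S y -> B x y = B' x y) -> semi_inner S B ->
  semi_inner S B'.
Proof.
move=> BB' sB; split; first exact: sip_closed sB.
- move=> k x y z Sx Sy Sz; rewrite -!BB'//; last exact: (sip_closed sB).
  exact: sip_lin sB _ _ _ _ _ _ _.
- by move=> x y Sx Sy; rewrite -!BB'//; exact: sip_sym sB _ _ _ _.
- by move=> x Sx; rewrite -BB'//; exact: sip_ge0 sB _ _.
Qed.

Lemma sip_le_half {X : lmodType R} (S : set X) (B : X -> X -> R) x y :
  semi_inner S B -> S x -> S y -> 2 * B x y <= B x x + B y y.
Proof.
move=> sB Sx Sy.
have Sxy := lin_closedB (sip_closed sB) Sx Sy.
have := sip_ge0 sB Sxy; rewrite (sipBl sB)// !(sipBr sB)// (sip_sym sB Sy Sx).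
by lra.
Qed.

Lemma sip_add_sqr_le {X : lmodType R} (S : set X) (B : X -> X -> R) x y :
  semi_inner S B -> S x -> S y -> B (x + y) (x + y) <= 2 * B x x + 2 * B y y.
Proof.
move=> sB Sx Sy; have Sxy := lin_closedD (sip_closed sB) Sx Sy.
rewrite (sipDl sB)// !(sipDr sB)// (sip_sym sB Sy Sx).
have := sip_le_half sB Sx Sy; lra.
Qed.

(** Expand the square of the sum and bound each product by the mean of the two
    squares. *)
Lemma sip_sum_sqr_le {X : lmodType R} (S : set X) (B : X -> X -> R)
    (n : nat) (x : 'I_n -> X) : S 0 ->
  semi_inner S B -> (forall i, S (x i)) ->
  B (\sum_i x i) (\sum_i x i) <= n%:R * \sum_i B (x i) (x i).
Proof.
move=> S0 sB Sx.
have Ssum (s : seq 'I_n) : S (\sum_(i <- s) x i).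
  elim: s => [|i s IH]; first by rewrite big_nil.
  by rewrite big_cons; apply: (lin_closedD (sip_closed sB)).
have B0 z : S z -> B 0 z = 0.
  by move=> Sz; rewrite -(scale0r 0) (sipZl sB)// mul0r.
have Bsum (s : seq 'I_n) z : S z -> B (\sum_(i <- s) x i) z = \sum_(i <- s) B (x i) z.
  move=> Sz; elim: s => [|i s IH]; first by rewrite !big_nil B0.
  by rewrite !big_cons (sipDl sB)// IH.
rewrite Bsum//.
have -> : \sum_i B (x i) (\sum_j x j) = \sum_i \sum_j B (x i) (x j).
  apply: eq_bigr => i _; rewrite (sip_sym sB)// Bsum//.
  by apply: eq_bigr => j _; rewrite (sip_sym sB).
suff : 2 * (\sum_i \sum_j B (x i) (x j)) <= 2 * (n%:R * \sum_i B (x i) (x i)).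
  by rewrite ler_pM2l.
have -> : 2 * (n%:R * \sum_i B (x i) (x i)) =
    \sum_(i < n) \sum_(j < n) (B (x i) (x i) + B (x j) (x j)).
  under [RHS]eq_bigr do rewrite big_split/= sumr_const card_ord.
  rewrite big_split/= sumrMnl sumr_const card_ord -[X in X + _]mulr_natl.
  by rewrite -[X in _ + X]mulr_natl mulr_natl mulr2n.
rewrite mulr_sumr ler_sum// => i _; rewrite mulr_sumr ler_sum// => j _.
exact: (sip_le_half sB (Sx i) (Sx j)).
Qed.

End sip_constructions.

Section square_integrable.
Context {R : realType} {d : nat} (D : set 'rV[R]_d).
Hypothesis mD : measurable D.
Local Notation pt := 'rV[R]_d.
Notation leb := (@lebesgue_row R d).
Implicit Types f g : pt -> R^o.

Lemma L2_integrable_mul f g : L2 D f -> L2 D g ->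
  leb.-integrable D (fun x => (f x * g x)%:E).
Proof.
move=> [mf f2] [mg g2].
apply: (@integrable_dominated _ _ _ leb D mD _ (fun x => f x ^+ 2 + g x ^+ 2)).
- exact: measurable_funM.
- move=> x _; rewrite normrM -[f x ^+ 2]real_normK ?num_real//.
  rewrite -[g x ^+ 2]real_normK ?num_real//.
  by have := sqr_ge0 (`|f x| - `|g x|); have := sqr_ge0 (`|f x| + `|g x|); nra.
- exact: integrable_add.
Qed.

Lemma L2_lin_closed : lin_closed (L2 D : set (pt -> R^o)).
Proof.
move=> k f g [mf f2] [mg g2]; split.
  apply: measurable_funD => //; exact: measurable_funM.
have mh : measurable_fun D (fun x => (k * f x + g x) ^+ 2 : R).
  by apply: measurable_funX; apply: measurable_funD => //; exact: measurable_funM.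
apply: (integrable_dominated mD mh
  (g := fun x => (2 * k ^+ 2) * f x ^+ 2 + 2 * g x ^+ 2)).
- move=> x _; rewrite ger0_norm ?sqr_ge0//.
  by have := sqr_ge0 (k * f x - g x); nra.
- by apply: integrable_lin => //; exact: integrable_scale.
Qed.

Lemma L2_0 : L2 D (0 : pt -> R^o).
Proof.
split; first exact: measurable_cst.
rewrite (_ : (fun x => _) = cst 0%E); first exact: integrable0.
by apply/funext => x; rewrite /= expr0n.
Qed.

Lemma ip_semi_inner : semi_inner (L2 D : set (pt -> R^o)) (ip D).
Proof.
split; first exact: L2_lin_closed.
- move=> k f g e Lf Lg Le; rewrite /ip -Rintegral_lin//; last 2 first.
    exact: L2_integrable_mul.
    exact: L2_integrable_mul.
  apply: eq_Rintegral => x _.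
  by change ((k * f x + g x) * e x = k * (f x * e x) + g x * e x); ring.
- by move=> f g _ _; apply: eq_Rintegral => x _; rewrite mulrC.
- by move=> f _; apply: Rintegral_ge0 => x _; rewrite -expr2 sqr_ge0.
Qed.

Lemma Rintegral_sum_L2 (I : finType) (f g : I -> pt -> R^o) :
  (forall i, L2 D (f i)) -> (forall i, L2 D (g i)) ->
  \int[leb]_(x in D) (\sum_i f i x * g i x) = \sum_i ip D (f i) (g i).
Proof.
move=> Lf Lg.
suff h : forall s : seq I,
    leb.-integrable D (fun x => (\sum_(i <- s) f i x * g i x)%:E) /\
    \int[leb]_(x in D) (\sum_(i <- s) f i x * g i x) = \sum_(i <- s) ip D (f i) (g i).
  by case: (h (index_enum I)).
elim=> [|i s [s_int IH]].
  split.
    rewrite (_ : (fun x => _) = cst 0%E); first exact: integrable0.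
    by apply/funext => x; rewrite big_nil.
  rewrite big_nil; under eq_Rintegral do rewrite big_nil.
  by rewrite Rintegral_cst// mul0r.
have fg_int := L2_integrable_mul (Lf i) (Lg i).
split.
  under eq_fun do rewrite big_cons.
  exact: integrable_add.
rewrite big_cons -IH -RintegralD//.
by under eq_Rintegral do rewrite big_cons.
Qed.

End square_integrable.

(** * The bilinear forms of poroelasticity *)

Section componentwise.
Context {R : realType}.

Lemma fct_lin {I : Type} {V : lmodType R} (k : R) (f g : I -> V) i :
  (k *: f + g) i = k *: f i + g i.
Proof. by []. Qed.

Lemma fst_lin {V W : lmodType R} (k : R) (x y : (V * W)%type) :
  (k *: x + y).1 = k *: x.1 + y.1.
Proof. by []. Qed.

Lemma snd_lin {V W : lmodType R} (k : R) (x y : (V * W)%type) :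
  (k *: x + y).2 = k *: x.2 + y.2.
Proof. by []. Qed.

End componentwise.

Section jets.
Context {R : realType} {d : nat} (D : set 'rV[R]_d).
Hypothesis mD : measurable D.
Local Notation pt := 'rV[R]_d.

Definition jetL2 : set (jet R d) :=
  [set v | L2 D v.1 /\ forall i, L2 D (v.2 i)].

Definition vjetL2 : set (vjet R d) := [set w | forall i, jetL2 (w i)].

Definition ipH1 (v w : jet R d) : R :=
  ip D v.1 w.1 + \sum_i ip D (v.2 i) (w.2 i).

Definition vipH1 (w z : vjet R d) : R := \sum_i ipH1 (w i) (z i).

Lemma H10_jetL2 : H10 D `<=` jetL2.
Proof. by move=> v [[v1 v2] _]; split => // i; case: (v2 i). Qed.

Lemma vH10_vjetL2 : vH10 D `<=` vjetL2.
Proof. by move=> w Hw i; exact: H10_jetL2. Qed.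

Lemma jetL2_lin_closed : lin_closed jetL2.
Proof.
move=> k v w [v1 v2] [w1 w2]; split => [|i].
  by rewrite fst_lin; exact: L2_lin_closed.
by rewrite snd_lin fct_lin; exact: L2_lin_closed.
Qed.

Lemma vjetL2_lin_closed : lin_closed vjetL2.
Proof. by move=> k v w Lv Lw i; exact: jetL2_lin_closed. Qed.

Lemma ip_value_semi_inner : semi_inner jetL2 (fun p q => ip D p.1 q.1).
Proof.
apply: (sip_pullback (f := fun p : jet R d => p.1) (ip_semi_inner mD)) => //.
  exact: jetL2_lin_closed.
by move=> p [].
Qed.

Lemma ip_gradient_semi_inner i :
  semi_inner jetL2 (fun p q => ip D (p.2 i) (q.2 i)).
Proof.
apply: (sip_pullback (f := fun p : jet R d => p.2 i) (ip_semi_inner mD)) => //.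
  exact: jetL2_lin_closed.
by move=> p [].
Qed.

Lemma ipH1_semi_inner : semi_inner jetL2 ipH1.
Proof.
have s := sip_sum jetL2_lin_closed ip_gradient_semi_inner.
apply: sip_ext (sip_addZ ler01 ler01 ip_value_semi_inner s).
by move=> x y _ _; rewrite !mul1r.
Qed.

Lemma L2norm_value_le_H1norm v : jetL2 v -> L2norm D v.1 <= H1norm D v.
Proof.
move=> Lv; rewrite ler_wsqrtr// lerDl sumr_ge0// => i _.
exact: (sip_ge0 (ip_gradient_semi_inner i)).
Qed.

Lemma vipH1_semi_inner : semi_inner vjetL2 vipH1.
Proof.
apply: sip_sum; first exact: vjetL2_lin_closed.
move=> i; apply: (sip_pullback (f := fun w : vjet R d => w i) ipH1_semi_inner) => //.
exact: vjetL2_lin_closed.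
Qed.

Lemma vH1normE w : vjetL2 w -> vH1norm D w = sipnorm vipH1 w.
Proof.
move=> Lw; congr Num.sqrt; apply: eq_bigr => i _.
by rewrite sqr_sqrtr//; exact: (sip_ge0 ipH1_semi_inner).
Qed.

Lemma bformE kap p q : jetL2 p -> jetL2 q ->
  bform D kap p q = kap * \sum_i ip D (p.2 i) (q.2 i).
Proof.
move=> [_ Lp] [_ Lq]; rewrite -Rintegral_sum_L2// /bform.
pose p' i : pt -> R^o := kap *: (p.2 i).
have Lp' i : L2 D (p' i) by apply: (lin_closedZ (L2_lin_closed mD)).
rewrite [LHS](_ : _ = \int[lebesgue_row d]_(x in D) (\sum_i p' i x * q.2 i x))//.
rewrite !Rintegral_sum_L2// mulr_sumr; apply: eq_bigr => i _.
exact: (sipZl (ip_semi_inner mD)).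
Qed.

Lemma bform_semi_inner kap : 0 <= kap -> semi_inner jetL2 (bform D kap).
Proof.
move=> kap0.
have s := sip_sum jetL2_lin_closed ip_gradient_semi_inner.
apply: sip_ext (sip_addZ kap0 (lexx 0) s s) => p q Lp Lq.
by rewrite mul0r addr0 bformE.
Qed.

Lemma divE (w : vjet R d) : div w = \sum_i ((w i).2 i : pt -> R^o).
Proof. by rewrite fct_sumE. Qed.

Lemma L2_sum (I : Type) (s : seq I) (f : I -> pt -> R^o) :
  (forall i, L2 D (f i)) -> L2 D (\sum_(i <- s) f i).
Proof.
move=> Lf; elim: s => [|i s IH]; first by rewrite big_nil; exact: L2_0.
by rewrite big_cons; apply: (lin_closedD (L2_lin_closed mD)).
Qed.

Lemma L2_div w : vjetL2 w -> L2 D (div w).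
Proof. by move=> Lw; rewrite divE; apply: L2_sum => i; case: (Lw i). Qed.

Lemma div_lin k (w z : vjet R d) :
  div (k *: w + z) = (k *: (div w : pt -> R^o) + div z) :> (pt -> R^o).
Proof.
apply/funext => x; rewrite /div.
change (\sum_i (k * (w i).2 i x + (z i).2 i x) =
        k * (\sum_i (w i).2 i x) + \sum_i (z i).2 i x).
by rewrite mulr_sumr big_split.
Qed.

Lemma ip_div_semi_inner :
  semi_inner vjetL2 (fun w z => ip D (div w) (div z)).
Proof.
apply: (sip_pullback (f := fun w : vjet R d => (div w : pt -> R^o)) (ip_semi_inner mD)) => //.
- exact: vjetL2_lin_closed.
- exact: L2_div.
- exact: div_lin.
Qed.

Lemma strainE (w : vjet R d) i j :
  strain w i j = (2^-1 : R) *: ((w i).2 j + (w j).2 i) :> (pt -> R^o).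
Proof. by []. Qed.

Lemma L2_strain w i j : vjetL2 w -> L2 D (strain w i j).
Proof.
move=> Lw; rewrite strainE; apply: (lin_closedZ (L2_lin_closed mD)).
by apply: (lin_closedD (L2_lin_closed mD)); [case: (Lw i)|case: (Lw j)].
Qed.

Lemma ip_strain_semi_inner i j :
  semi_inner vjetL2 (fun w z => ip D (strain w i j) (strain z i j)).
Proof.
apply: (sip_pullback (f := fun w : vjet R d => (strain w i j : pt -> R^o))
  (ip_semi_inner mD)) => //.
- exact: vjetL2_lin_closed.
- by move=> w; exact: L2_strain.
- move=> k w z; rewrite !strainE.
  have E a b : ((k *: w + z) a).2 b = k *: ((w a).2 b : pt -> R^o) + (z a).2 b.
    by rewrite fct_lin snd_lin fct_lin.
  have abs (V : lmodType R) (h : R) (x y x' y' : V) :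
      h *: ((k *: x + y) + (k *: x' + y')) = k *: (h *: (x + x')) + h *: (y + y').
    by rewrite addrACA -scalerDr [LHS]scalerDr !scalerA mulrC.
  by rewrite 2!E abs.
Qed.

Lemma aformE lam mu u w : vjetL2 u -> vjetL2 w ->
  aform D lam mu u w =
  2 * mu * (\sum_i \sum_j ip D (strain u i j) (strain w i j))
  + lam * ip D (div u) (div w).
Proof.
move=> Lu Lw; rewrite /aform; congr (_ * _ + _).
rewrite pair_bigA/=.
rewrite -(@Rintegral_sum_L2 _ _ _ mD _
  (fun ij : 'I_d * 'I_d => strain u ij.1 ij.2 : pt -> R^o)
  (fun ij => strain w ij.1 ij.2 : pt -> R^o)); last 2 first.
  by move=> ij; exact: L2_strain.
  by move=> ij; exact: L2_strain.
by apply: eq_Rintegral => x _; rewrite pair_bigA.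
Qed.

Lemma aform_semi_inner lam mu : 0 <= lam -> 0 <= mu ->
  semi_inner vjetL2 (aform D lam mu).
Proof.
move=> lam0 mu0.
have s : semi_inner vjetL2
    (fun u w => \sum_i \sum_j ip D (strain u i j) (strain w i j)).
  apply: sip_sum => [|i]; first exact: vjetL2_lin_closed.
  apply: sip_sum => [|j]; first exact: vjetL2_lin_closed.
  exact: ip_strain_semi_inner.
have m20 : 0 <= 2 * mu by rewrite mulr_ge0.
apply: sip_ext (sip_addZ m20 lam0 s ip_div_semi_inner) => u w Lu Lw.
by rewrite aformE.
Qed.

(** The divergence is the trace of the strain, so that its square is at most [d]
    times the squared norm of the strain. *)
Lemma div_le_aform lam mu w : (0 < d)%N -> 0 <= mu -> vjetL2 w ->
  (lam + 2 * mu / d%:R) * ip D (div w) (div w) <= aform D lam mu w w.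
Proof.
move=> d0 mu0 Lw; rewrite aformE// mulrDl addrC lerD2r.
rewrite -!mulrA ler_wpM2l// ler_wpM2l//.
have dR0 : (0 : R) < d%:R by rewrite ltr0n.
rewrite mulrC ler_pdivrMr// mulrC.
have Ld i : L2 D ((w i).2 i) by case: (Lw i).
rewrite divE.
apply: le_trans (sip_sum_sqr_le (@L2_0 _ _ D) (ip_semi_inner mD) Ld) _.
rewrite ler_wpM2l// ler_sum// => i _.
rewrite (bigD1 i)//=.
have -> : strain w i i = (w i).2 i by apply/funext => x; rewrite /strain; lra.
rewrite lerDl sumr_ge0// => j _.
exact: (sip_ge0 (ip_strain_semi_inner i j) Lw).
Qed.

(** The strain is a mean of two partial derivatives and the divergence a sum of [d]
    of them. *)
Lemma aform_le_vipH1 lam mu w : 0 <= lam -> 0 <= mu -> vjetL2 w ->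
  aform D lam mu w w <= (2 * mu + lam * d%:R) * vipH1 w w.
Proof.
move=> lam0 mu0 Lw; rewrite aformE// [in leRHS]mulrDl.
have Lij i j : L2 D ((w i).2 j) by case: (Lw i).
have ip0 i j : 0 <= ip D ((w i).2 j) ((w i).2 j).
  exact: (sip_ge0 (ip_semi_inner mD)).
have grad_le : \sum_i \sum_j ip D ((w i).2 j) ((w i).2 j) <= vipH1 w w.
  rewrite ler_sum// => i _; rewrite lerDr.
  by apply: (sip_ge0 (ip_semi_inner mD)); case: (Lw i).
apply: lerD.
  rewrite ler_wpM2l ?mulr_ge0//; apply: le_trans grad_le.
  apply: (@le_trans _ _ (\sum_i \sum_j (2^-1 * ip D ((w i).2 j) ((w i).2 j)
      + 2^-1 * ip D ((w j).2 i) ((w j).2 i)))).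
    rewrite ler_sum// => i _; rewrite ler_sum// => j _.
    have Lsum : L2 D ((w i).2 j + (w j).2 i).
      exact: (lin_closedD (L2_lin_closed mD)).
    rewrite strainE (sipZl (ip_semi_inner mD))// ?(sipZr (ip_semi_inner mD))//; last first.
      exact: (lin_closedZ (L2_lin_closed mD)).
    have := sip_add_sqr_le (ip_semi_inner mD) (Lij i j) (Lij j i).
    lra.
  under eq_bigr do rewrite big_split/=.
  rewrite big_split/= [X in _ + X]exchange_big/= -big_split/=.
  rewrite ler_sum// => i _; rewrite -big_split/= ler_sum// => j _.
  by lra.
rewrite -mulrA ler_wpM2l// divE.
apply: le_trans (sip_sum_sqr_le (@L2_0 _ _ D) (ip_semi_inner mD) (fun i => Lij i i)) _.
rewrite ler_wpM2l//; apply: le_trans grad_le; rewrite ler_sum// => i _.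
by rewrite (bigD1 i)//= lerDl sumr_ge0.
Qed.

End jets.

(** * Stability of the fixed-stress split *)

Section fixed_stress_stability.
Context {R : realType} {V Q : lmodType R}.
Variables (Vh : set V) (Qh : set Q).
Variables (a : V -> V -> R) (b m : Q -> Q -> R) (c : V -> Q -> R).
Variables (al be L s tau : R).
Hypotheses (sa : semi_inner Vh a) (sb : semi_inner Qh b) (sm : semi_inner Qh m).
Hypothesis c_linr : forall k v p q, Vh v -> Qh p -> Qh q ->
  c v (k *: p + q) = k * c v p + c v q.
Hypothesis c_bound : forall v q, Vh v -> Qh q ->
  s * c v q <= sipnorm a v * sipnorm m q.
Hypotheses (al0 : 0 < al) (be0 : 0 < be) (s0 : 0 < s) (tau0 : 0 < tau).
Hypothesis L_large : al ^+ 2 / s ^+ 2 <= L.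

Let cV := sip_closed sa.
Let cQ := sip_closed sm.

Let L0 : 0 < L.
Proof. by apply: lt_le_trans L_large; rewrite divr_gt0// exprn_gt0. Qed.

(** Mechanical equilibrium of a displacement [u] with a pressure [p] without body
    force: the relation that the two components of the error satisfy at every time
    step. *)
Definition coupled (u : V) (p : Q) : Prop := forall v, Vh v -> a u v = al * c v p.

Lemma coupled_lin k u w p q : Vh u -> Vh w -> Qh p -> Qh q ->
  coupled u p -> coupled w q -> coupled (k *: u + w) (k *: p + q).
Proof.
move=> Vu Vw Qp Qq up wq v Vv.
by rewrite (sip_lin sa)// up// wq// c_linr//; ring.
Qed.

Lemma coupledB u w p q : Vh u -> Vh w -> Qh p -> Qh q ->
  coupled u p -> coupled w q -> coupled (u - w) (p - q).
Proof.
move=> Vu Vw Qp Qq up wq; have := @coupled_lin (-1) w u q p Vw Vu Qq Qp wq up.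
by rewrite !scaleN1r ![- _ + _]addrC.
Qed.

Lemma coupledZ k u p : Vh u -> Qh p -> coupled u p -> coupled (k *: u) (k *: p).
Proof.
move=> Vu Qp up; have := coupledB Vu Vu Qp Qp up up; rewrite !subrr => c0.
have V0 : Vh 0 by rewrite -(subrr u); exact: lin_closedB.
have Q0 : Qh 0 by rewrite -(subrr p); exact: lin_closedB.
by have := coupled_lin k Vu V0 Qp Q0 up c0; rewrite !addr0.
Qed.

(** Test the equilibrium with [u] itself. *)
Lemma coupled_norm_le u p : Vh u -> Qh p -> coupled u p ->
  s * sipnorm a u <= al * sipnorm m p.
Proof.
move=> Vu Qp up.
have [->|Nu0] := eqVneq (sipnorm a u) 0.
  by rewrite mulr0 mulr_ge0 ?(ltW al0)// sipnorm_ge0.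
have Nu : 0 < sipnorm a u by rewrite lt_neqAle eq_sym Nu0 sipnorm_ge0.
rewrite -(ler_pM2r Nu) -mulrA -expr2 (sipnorm_sqr sa)// up//.
by have := ler_wpM2l (ltW al0) (c_bound Vu Qp); lra.
Qed.

Lemma coupled_energy_le u p : Vh u -> Qh p -> coupled u p -> a u u <= L * m p p.
Proof.
move=> Vu Qp up; rewrite -(sipnorm_sqr sa)// -(sipnorm_sqr sm)//.
apply: le_trans (ler_wpM2r (sqr_ge0 _) L_large).
rewrite -expr_div_n -exprMn.
have als : 0 <= al / s by rewrite divr_ge0// ltW.
rewrite ler_pXn2r ?nnegrE ?sipnorm_ge0//; last by rewrite mulr_ge0// sipnorm_ge0.
by rewrite mulrAC ler_pdivlMr// mulrC coupled_norm_le.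
Qed.

(** The operator sending [x] to [L x - al div u_x], where [u_x] is the
    displacement in equilibrium with the pressure [x], is symmetric and lies
    between [0] and [L]; this is where the size of [L] enters. The inequality is
    its positivity on [x - y]. *)
Lemma fixed_stress_form_le u w x y : Vh u -> Vh w -> Qh x -> Qh y ->
  coupled u x -> coupled w y ->
  2 * (L * m x y - al * c u y) <= L * (m x x + m y y).
Proof.
move=> Vu Vw Qx Qy ux wy.
have Vuw := lin_closedB cV Vu Vw; have Qxy := lin_closedB cQ Qx Qy.
have := coupled_energy_le Vuw Qxy (coupledB Vu Vw Qx Qy ux wy).
rewrite (sipBl sa)// !(sipBr sa)// (sip_sym sa Vw Vu).
rewrite (sipBl sm)// !(sipBr sm)// (sip_sym sm Qy Qx).
rewrite -(wy u Vu) (sip_sym sa Vw Vu).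
have := sip_ge0 sa Vu; have := sip_ge0 sa Vw; lra.
Qed.

Let increment_energy e e' y : Qh e -> Qh e' -> Qh y -> e' = e + tau *: y ->
  b e' e' - b e e <= 2 * tau * b e' y.
Proof.
move=> Qe Qe' Qy e'E.
rewrite -mulrA; have <- : b e' (e' - e) = tau * b e' y.
  by rewrite {2}e'E [e + _]addrC addrK (sipZr sb).
rewrite (sipBr sb)//; have := sip_le_half sb Qe' Qe; lra.
Qed.

Let young rho y : Qh y -> 2 * (rho * sipnorm m y) <= be * rho ^+ 2 + be^-1 * m y y.
Proof.
move=> Qy; rewrite -(sipnorm_sqr sm)//; set z := sipnorm m y.
have : 0 <= be * (rho - be^-1 * z) ^+ 2 by rewrite mulr_ge0 ?sqr_ge0// ltW.
have -> : be * (rho - be^-1 * z) ^+ 2 =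
    be * rho ^+ 2 + be^-1 * z ^+ 2 - 2 * (rho * z).
  by field; exact: lt0r_neq0.
by rewrite subr_ge0.
Qed.

(** The first step is fully implicit, so its coupling term [c w y] is the nonnegative
    energy [a w w] of the displacement increment. *)
Lemma implicit_step_energy e e' y w rho : Qh e -> Qh e' -> Qh y -> Vh w ->
  e' = e + tau *: y -> coupled w y ->
  be^-1 * m y y + al * c w y + b e' y <= rho * sipnorm m y ->
  b e' e' + tau / be * m y y <= b e e + be * (tau * rho ^+ 2).
Proof.
move=> Qe Qe' Qy Vw e'E wy; rewrite -(wy w Vw) => step.
have h1 := increment_energy Qe Qe' Qy e'E.
have h2 := young rho Qy; have h3 := sip_ge0 sa Vw.
have h4 : tau * (be^-1 * m y y + 2 * b e' y - be * rho ^+ 2) <= 0.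
  by rewrite pmulr_rle0//; lra.
move: h4; rewrite !mulrBr !mulrDr -mulrA => h4.
set X := be^-1 * m y y in h4 *.
lra.
Qed.

(** Test with the new pressure increment [y]. The lagged coupling costs half of
    [L * m x x] and half of [L * m y y] by the previous bound, which leaves a
    telescoping term; the residual is absorbed by half of the storage term
    [m y y / be]. *)
Lemma explicit_step_energy e e' x y u w rho : Qh e -> Qh e' -> Qh x -> Qh y ->
  Vh u -> Vh w -> e' = e + tau *: y -> coupled u x -> coupled w y ->
  be^-1 * m y y + L * m y y - L * m x y + al * c u y + b e' y
    <= rho * sipnorm m y ->
  b e' e' + tau * L * m y y + tau / be * m y y <=
  b e e + tau * L * m x x + be * (tau * rho ^+ 2).
Proof.
move=> Qe Qe' Qx Qy Vu Vw e'E ux wy step.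
have h1 := increment_energy Qe Qe' Qy e'E.
have h2 := young rho Qy; have h3 := fixed_stress_form_le Vu Vw Qx Qy ux wy.
have h4 : tau * (be^-1 * m y y + L * m y y - L * m x x + 2 * b e' y
    - be * rho ^+ 2) <= 0.
  by rewrite pmulr_rle0//; lra.
move: h4; rewrite !mulrBr !mulrDr -[tau / be * _]mulrA => h4.
set X := be^-1 * m y y in h4 *.
lra.
Qed.

Variables (N : nat) (eu : nat -> V) (ep : nat -> Q) (rho : nat -> R).
Hypothesis Vu : forall j, (j <= N)%N -> Vh (eu j).
Hypothesis Qp : forall j, (j <= N)%N -> Qh (ep j).
Hypothesis eup : forall j, (j <= N)%N -> coupled (eu j) (ep j).
Let du j := tau^-1 *: (eu j.+1 - eu j).
Let dp j := tau^-1 *: (ep j.+1 - ep j).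
Hypothesis step0 : (0 < N)%N -> forall q, Qh q ->
  be^-1 * m (dp 0) q + al * c (du 0) q + b (ep 1) q <= rho 0 * sipnorm m q.
Hypothesis stepS : forall j, (j.+2 <= N)%N -> forall q, Qh q ->
  be^-1 * m (dp j.+1) q + L * m (dp j.+1) q - L * m (dp j) q
    + al * c (du j) q + b (ep j.+2) q <= rho j.+1 * sipnorm m q.

Let Vdu j : (j < N)%N -> Vh (du j).
Proof.
move=> jN; apply: (lin_closedZ cV).
by apply: (lin_closedB cV); [exact: Vu|exact: Vu (ltnW jN)].
Qed.

Let Qdp j : (j < N)%N -> Qh (dp j).
Proof.
move=> jN; apply: (lin_closedZ cQ).
by apply: (lin_closedB cQ); [exact: Qp|exact: Qp (ltnW jN)].
Qed.

Let dup j : (j < N)%N -> coupled (du j) (dp j).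
Proof.
move=> jN; have jN' := ltnW jN; apply: coupledZ.
- by apply: (lin_closedB cV); exact: Vu.
- by apply: (lin_closedB cQ); exact: Qp.
- by apply: coupledB; [exact: Vu|exact: Vu|exact: Qp|exact: Qp|exact: eup|exact: eup].
Qed.

Let epS j : ep j.+1 = ep j + tau *: dp j.
Proof. by rewrite /dp scalerA divff ?gt_eqF// scale1r addrC subrK. Qed.

Let Z n := \sum_(j < n) tau * m (dp j) (dp j).

(** The explicit steps telescope. The term [tau * L * m (dp 0) (dp 0)] that they
    inherit from the first step is paid by the storage term of that step, whence
    the factor [1 + L * be]. *)
Lemma fixed_stress_energy n : (0 < n <= N)%N ->
  b (ep n) (ep n) + be^-1 * \sum_(j < n) tau * m (dp j) (dp j) <=
  (1 + L * be) * (b (ep 0) (ep 0) + be * \sum_(j < n) tau * rho j ^+ 2).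
Proof.
case: n => [//|n] nN.
suff h : b (ep n.+1) (ep n.+1) + tau * L * m (dp n) (dp n) + be^-1 * Z n.+1 <=
    (1 + L * be) * (b (ep 0) (ep 0) + be * \sum_(j < n.+1) tau * rho j ^+ 2).
  apply: le_trans h; rewrite -/(Z _) lerD2r lerDl.
  by rewrite mulr_ge0 ?(sip_ge0 sm (Qdp _))// mulr_ge0// ltW.
elim: n nN => [|n IH] nN.
  rewrite /Z !big_ord1.
  have h := implicit_step_energy (Qp (leq0n N)) (Qp nN) (Qdp nN) (Vdu nN) (epS 0)
    (dup nN) (step0 nN (Qdp nN)).
  have h0 : 0 <= b (ep 1) (ep 1) by exact: (sip_ge0 sb (Qp nN)).
  have h1 := ler_wpM2l (ltW (mulr_gt0 L0 be0)) h.
  have E : L * be * (tau / be * m (dp 0) (dp 0)) = tau * L * m (dp 0) (dp 0).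
    by field; exact: lt0r_neq0.
  have E' : be^-1 * (tau * m (dp 0) (dp 0)) = tau / be * m (dp 0) (dp 0) by ring.
  have h2 : 0 <= L * be * b (ep 1) (ep 1) by rewrite mulr_ge0// ltW// mulr_gt0.
  by rewrite mulrDl mul1r E'; rewrite mulrDr E in h1; lra.
have nN' := ltnW nN.
have h := explicit_step_energy (Qp nN') (Qp nN) (Qdp nN') (Qdp nN)
  (Vdu nN') (Vdu nN) (epS _) (dup nN') (dup nN) (stepS nN (Qdp nN)).
have {}IH := IH nN'.
rewrite /Z big_ord_recr/= -/(Z _) [in leRHS]big_ord_recr/=.
have h1 : 0 <= L * be * (be * (tau * rho n.+1 ^+ 2)).
  exact: (mulr_ge0 (ltW (mulr_gt0 L0 be0))
    (mulr_ge0 (ltW be0) (mulr_ge0 (ltW tau0) (sqr_ge0 _)))).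
have E' : be^-1 * (Z n.+1 + tau * m (dp n.+1) (dp n.+1)) =
  be^-1 * Z n.+1 + tau / be * m (dp n.+1) (dp n.+1) by ring.
rewrite E'; set P := \sum_(_ < _) _ in IH *.
lra.
Qed.

(** Cauchy-Schwarz for the sum of the increments, proved by induction. It bounds the
    pressure itself by the increments that the energy controls. *)
Lemma telescoped_norm_le n : (n <= N)%N ->
  m (ep n - ep 0) (ep n - ep 0) <=
  n%:R * tau * \sum_(j < n) tau * m (dp j) (dp j).
Proof.
elim: n => [|n IH] nN.
  have Q0 := Qp (leq0n N).
  by rewrite (sipBl sm Q0 Q0 (lin_closedB cQ Q0 Q0)) subrr big_ord0 mulr0.
have {}IH := IH (ltnW nN).
have Qd : Qh (ep n - ep 0) := lin_closedB cQ (Qp (ltnW nN)) (Qp (leq0n N)).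
have Qy := Qdp nN.
have -> : ep n.+1 - ep 0 = (ep n - ep 0) + tau *: dp n by rewrite epS addrAC.
have Qty : Qh (tau *: dp n) by exact: (lin_closedZ cQ).
rewrite (sipDl sm Qd Qty (lin_closedD cQ Qd Qty)).
rewrite (sipDr sm Qd Qty Qd) (sipDr sm Qd Qty Qty) (sip_sym sm Qty Qd).
rewrite (sipZr sm _ Qy Qd) (sipZl sm _ Qy Qty) (sipZr sm _ Qy Qy).
rewrite big_ord_recr/= -/(Z n) in IH *.
case: n => [|n] in IH nN Qd Qy Qty *.
  have z0 : m (ep 0 - ep 0) (dp 0) = 0.
    by rewrite (sipBl sm (Qp (leq0n N)) (Qp (leq0n N)) Qy) subrr.
  by move: IH; rewrite z0 /Z big_ord0 !mulr0 !add0r mul1r addr0; lra.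
(* Young's inequality with the weight [n.+1], for which the induction is exact *)
have n0 : (0 : R) < n.+1%:R by rewrite ltr0n.
pose k := (n.+1%:R * tau : R).
have k0 : 0 < k by rewrite mulr_gt0.
have Qs : Qh (ep n.+1 - ep 0 - k *: dp n.+1).
  by apply: (lin_closedB cQ) => //; exact: (lin_closedZ cQ).
have := sip_ge0 sm Qs.
have Qky : Qh (k *: dp n.+1) by exact: (lin_closedZ cQ).
rewrite (sipBl sm Qd Qky Qs) (sipBr sm Qd Qky Qd) (sipBr sm Qd Qky Qky).
rewrite (sip_sym sm Qky Qd) (sipZr sm _ Qy Qd) (sipZl sm _ Qy Qky) (sipZr sm _ Qy Qy).
set X := m _ _ in IH *; set Y := m (ep _ - _) (dp _); set W := m (dp _) _.
rewrite -[n.+2%:R]natr1.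
have -> : (n.+1%:R + 1) * tau = k + tau by rewrite mulrDl mul1r.
rewrite -/k in IH; set z := Z _ in IH *.
move=> h.
have h2 : 2 * Y * tau <= tau / k * X + tau * k * W.
  have -> : tau / k * X + tau * k * W = (X + k ^+ 2 * W) / k * tau.
    by field; exact: lt0r_neq0.
  by rewrite ler_pM2r// ler_pdivlMr//; lra.
have h3 : tau / k * X <= tau * z.
  have : tau / k * X <= tau / k * (k * z).
    by rewrite ler_wpM2l// divr_ge0// ltW.
  by rewrite [_ * (k * z)]mulrA divfK// gt_eqF.
lra.
Qed.

End fixed_stress_stability.

(** * Consistency of difference quotients *)

Section consistency.
Context {R : realType} {X : lmodType R} (S S' : set X) (B : X -> X -> R).
Variables (nm : X -> R) (C0 T : R).
Hypotheses (sB : semi_inner S B) (S'S : S' `<=` S).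
Hypothesis NC : forall v, S v -> sipnorm B v <= C0 * nm v.
Notation leb := (@lebesgue_measure R).
Local Notation N := (sipnorm B).
Let cS := sip_closed sB.

(** Split the quotient of the projection [xbar] into the quotient of [x], which
    differs from [dx t] by the variation of [dx] over the interval, and the quotient
    of the projection error, which is a mean of [drho]. *)
Lemma difference_quotient_error (x dx xbar drho : R -> X) (a b r0 r1 t M : R)
    (W : R -> R) :
  has_tderiv S' nm T x dx ->
  has_tderiv S' nm T (fun r => x r - xbar r) drho ->
  0 <= a -> b <= T -> a <= r0 -> r0 < r1 -> r1 <= b -> a <= t <= b ->
  (forall r, a <= r <= b -> N (dx r - dx t) ^+ 2 <= M) ->
  (forall r, a <= r <= b -> N (drho r) ^+ 2 <= W r) ->
  leb.-integrable `[a, b] (fun r => (W r)%:E) ->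
  N ((r1 - r0)^-1 *: (xbar r1 - xbar r0) - dx t) ^+ 2 <=
  2 * M + 2 * ((r1 - r0)^-1 * \int[leb]_(r in `[a, b]) W r).
Proof.
move=> xdx rho_d a0 bT ar0 r01 r1b tab dxM drhoW W_int.
have inT r : a <= r <= b -> 0 <= r <= T.
  by move=> /andP[ar rb]; rewrite (le_trans a0)// (le_trans rb).
have r0ab : a <= r0 <= b by rewrite ar0 (le_trans (ltW r01)).
have r1ab : a <= r1 <= b by rewrite r1b (le_trans ar0)// ltW.
have r00 := le_trans a0 ar0.
have r1T := le_trans r1b bT.
have W0 r : a <= r <= b -> 0 <= W r.
  by move=> /drhoW; apply: le_trans; exact: sqr_ge0.
have Sx r : a <= r <= b -> S (x r) by move=> /inT /xdx[/S'S].
have Sdx r : a <= r <= b -> S (dx r) by move=> /inT /xdx[_ /S'S].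
have Srho r : a <= r <= b -> S (x r - xbar r) by move=> /inT /rho_d[/S'S].
set q := r1 - r0; have q0 : 0 < q by rewrite subr_gt0.
have S0 : S 0 by rewrite -(subrr (x r0)); apply: (lin_closedB cS); exact: Sx.
have sub r : r0 <= r <= r1 -> a <= r <= b.
  by move=> /andP[rr rr1]; rewrite (le_trans ar0 rr) (le_trans rr1 r1b).
have h1 : N (x r1 - x r0 - q *: dx t) ^+ 2 <= q ^+ 2 * M.
  have := has_tderiv_mean_value (W := fun=> M) sB S'S NC xdx r00 (ltW r01) r1T (Sdx _ tab)
    (fun r rr => dxM r (sub r rr)) (integrable_cst_itv r0 r1 M).
  move=> /le_trans; apply; rewrite (Rintegral_cst_itv M (ltW r01)) -/q.
  by rewrite expr2 -mulrA [q * M]mulrC.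
have h2 : N (x r1 - xbar r1 - (x r0 - xbar r0)) ^+ 2 <= q * \int[leb]_(r in `[a, b]) W r.
  have W_int' : leb.-integrable `[r0, r1] (fun r => (W r)%:E).
    exact: integrable_itvS W_int.
  have := has_tderiv_mean_value (W := W) sB S'S NC rho_d r00 (ltW r01) r1T S0 _ W_int'.
  rewrite scaler0 subr0 => h.
  apply: le_trans (h _) _.
    move=> r rr; have [_ /S'S Sd _] := rho_d r (inT r (sub r rr)).
    by rewrite subr0; exact: drhoW (sub r rr).
  rewrite ler_wpM2l ?(ltW q0)//.
  by apply: le_Rintegral_itvS.
have Sxx : S (x r1 - x r0 - q *: dx t).
  apply: (lin_closedB cS); last by apply: (lin_closedZ cS); exact: Sdx.
  by apply: (lin_closedB cS); exact: Sx.
have Srr : S (x r1 - xbar r1 - (x r0 - xbar r0)).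
  by apply: (lin_closedB cS); exact: Srho.
have -> : q^-1 *: (xbar r1 - xbar r0) - dx t =
    q^-1 *: ((x r1 - x r0 - q *: dx t) - (x r1 - xbar r1 - (x r0 - xbar r0))).
  have E (y z y' z' w : X) : (y - z - w) - (y - y' - (z - z')) = (y' - z') - w.
    by rewrite addrAC opprB addrA subrKA opprB [X in X - w]addrC subrKA.
  by rewrite E [RHS]scalerBr scalerA mulVf ?gt_eqF// scale1r.
rewrite (sipnormZ sB) ?exprMn; last exact: (lin_closedB cS).
rewrite ger0_norm ?invr_ge0 ?(ltW q0)//.
set Y := x r1 - x r0 - _ in h1 Sxx *; set Z := x r1 - _ - _ in h2 Srr *.
set J := Rintegral _ _ _ in h2 *.
have h3 : N (Y - Z) ^+ 2 <= 2 * (q ^+ 2 * M) + 2 * (q * J).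
  have := sipnormB sB Sxx Srr; have := (@sipnorm_ge0 _ _ B (Y - Z)).
  have := @sipnorm_ge0 _ _ B Y; have := @sipnorm_ge0 _ _ B Z.
  have := sqr_ge0 (N Y - N Z).
  set yz := N (Y - Z); set y := N Y in h1 *; set z := N Z in h2 *; nra.
apply: le_trans (ler_wpM2l (sqr_ge0 _) h3) _.
rewrite le_eqVlt; apply/orP; left; apply/eqP; field; exact: lt0r_neq0.
Qed.

End consistency.

Definition quotient_error {R : realType} {X : lmodType R} (T : R) (N : nat)
  (x : nat -> X) (i : nat) (z : X) : X := bdiff T N x i - z.

(** The constant in [quotient_consistency] for a norm bounded by [k] times the norm
    in which [dx] has a weak derivative, and for [A] times the weight as a bound on
    the squared rate of the projection error. *)
Definition consistency_const {R : realType} (k A : R) : R :=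
  Num.sqrt (4 * k ^+ 2 + 2 * A).

Lemma le_sqrt_mul {R : realType} (x A J : R) : 0 <= x -> 0 <= A ->
  x ^+ 2 <= A * J -> x <= Num.sqrt A * Num.sqrt J.
Proof.
move=> x0 A0 xAJ; rewrite -sqrtrM// -[leLHS]ger0_norm// -sqrtr_sqr.
by rewrite ler_wsqrtr.
Qed.

Section quotient_consistency.
Context {R : realType} {X Y : lmodType R}.
Variables (S S' : set X) (B : X -> X -> R) (nmX : X -> R) (CX : R).
Variables (SY SY' : set Y) (BY : Y -> Y -> R) (nmY : Y -> R) (CY : R).
Variables (pi : X -> Y) (k A T : R) (N : nat).
Hypotheses (sB : semi_inner S B) (S'S : S' `<=` S).
Hypothesis NCX : forall v, S v -> sipnorm B v <= CX * nmX v.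
Hypotheses (sBY : semi_inner SY BY) (SY'SY : SY' `<=` SY).
Hypothesis NCY : forall v, SY v -> sipnorm BY v <= CY * nmY v.
Hypothesis pi_lin : forall r x y, pi (r *: x + y) = r *: pi x + pi y.
Hypothesis pi_S : forall x, S x -> SY (pi x).
Hypothesis k0 : 0 <= k.
Hypothesis A0 : 0 <= A.
Hypothesis pi_norm : forall x, S x -> sipnorm B x <= k * sipnorm BY (pi x).
Notation leb := (@lebesgue_measure R).
Local Notation tau := (tau T N).
Local Notation t := (tj T N).

Variables (x dx xbar drho : R -> X) (ddx : R -> Y) (W : R -> R).
Hypothesis xdx : has_tderiv S' nmX T x dx.
Hypothesis rho_d : has_tderiv S' nmX T (fun r => x r - xbar r) drho.
Hypothesis dxddx : has_L2_tderiv SY' nmY T (fun r => pi (dx r)) ddx.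
Hypothesis W0 : forall r, 0 <= W r.
Hypothesis W_int : leb.-integrable `[0, T] (fun r => (W r)%:E).
Hypothesis ddxW : forall r, 0 <= r <= T -> sipnorm BY (ddx r) ^+ 2 <= tau ^- 2 * W r.
Hypothesis drhoW : forall r, 0 <= r <= T -> sipnorm B (drho r) ^+ 2 <= A * W r.
Hypothesis tau0 : 0 < tau.

Let step i : t i.+1 - t i = tau.
Proof. by rewrite /tj -mulrBl -natrB// subSnn mul1r. Qed.

Let dx_increment (a b r r' : R) : 0 <= a -> b <= T -> b - a <= 2 * tau ->
  a <= r <= b -> a <= r' <= b ->
  sipnorm B (dx r - dx r') ^+ 2 <=
  k ^+ 2 * (2 * (tau^-1 * \int[leb]_(z in `[a, b]) W z)).
Proof.
move=> a0 bT ba rab rab'.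
have inT z : a <= z <= b -> 0 <= z <= T.
  by move=> /andP[az zb]; rewrite (le_trans a0)// (le_trans zb).
have Sdx z : a <= z <= b -> S (dx z) by move=> /inT /xdx[_ /S'S].
have cS := sip_closed sB.
wlog rr : r r' rab rab' / r' <= r.
  move=> hw; have [rr|/ltW rr] := leP r' r; first exact: hw.
  by rewrite (sipnormBC sB (Sdx _ rab) (Sdx _ rab')); exact: hw.
have Sd := lin_closedB cS (Sdx _ rab) (Sdx _ rab').
apply: (@le_trans _ _ ((k * sipnorm BY (pi (dx r - dx r'))) ^+ 2)).
  by rewrite ler_pXn2r ?nnegrE ?mulr_ge0 ?sipnorm_ge0// pi_norm.
rewrite exprMn ler_wpM2l ?sqr_ge0//.
have piB y z : pi (y - z) = pi y - pi z.
  by rewrite addrC -scaleN1r pi_lin scaleN1r addrC.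
rewrite piB; case/andP: rab rab' => [ar rb] /andP[ar' rb'].
have r'0 : 0 <= r' := le_trans a0 ar'.
have rT : r <= T := le_trans rb bT.
have len0 : 0 <= r - r' by lra.
have len : r - r' <= 2 * tau by lra.
have Wi' : leb.-integrable `[r', r] (fun z => (W z)%:E).
  exact: integrable_itvS W_int.
have Wi'' : leb.-integrable `[r', r] (fun z => (tau ^- 2 * W z)%:E).
  exact: integrable_scale.
have Sdx0 z : 0 <= z <= T -> SY (pi (dx z)) by move=> /xdx[_ /S'S /pi_S].
have ddxW' z : r' <= z <= r -> sipnorm BY (ddx z) ^+ 2 <= tau ^- 2 * W z.
  by move=> /andP[rz zr]; apply: ddxW; rewrite (le_trans r'0)// (le_trans zr).
apply: le_trans (has_L2_tderiv_increment sBY SY'SY NCY Sdx0 dxddx r'0 rr rT ddxW' Wi'') _.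
rewrite RintegralZl//.
have le1 : \int[leb]_(z in `[r', r]) W z <= \int[leb]_(z in `[a, b]) W z.
  by apply: le_Rintegral_itvS => //; exact: integrable_itvS W_int.
have ge0 : 0 <= \int[leb]_(z in `[r', r]) W z.
  by apply: Rintegral_ge0 => z _; exact: W0.
have -> : 2 * (tau^-1 * \int[leb]_(x in `[a, b]) W x) =
    2 * tau * (tau ^- 2 * \int[leb]_(x in `[a, b]) W x).
  by field; exact: lt0r_neq0.
have tt : 0 <= tau ^- 2 by rewrite invr_ge0 sqr_ge0.
by apply: ler_pM => //; [exact: mulr_ge0|exact: ler_wpM2l].
Qed.

(** One weight [W] measures both sources of error: it dominates [tau ^+ 2] times the
    squared second derivative and the squared rate of the projection error. The map
    [pi] passes to the space in which the second derivative lives: the values for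
    the pressure, the same space for the displacement. *)
Lemma quotient_consistency (a b y : R) i : 0 <= a -> b <= T -> b - a <= 2 * tau ->
  a <= t i -> t i.+1 <= b -> a <= y <= b ->
  sipnorm B (quotient_error T N (fun j => xbar (t j)) i (dx y)) <=
  consistency_const k A * Num.sqrt (tau^-1 * \int[leb]_(r in `[a, b]) W r).
Proof.
move=> a0 bT ba ati tib yab.
have inT r : a <= r <= b -> 0 <= r <= T.
  by move=> /andP[ar rb]; rewrite (le_trans a0)// (le_trans rb).
have Wi : leb.-integrable `[a, b] (fun r => (W r)%:E) by exact: integrable_itvS W_int.
have Wi' : leb.-integrable `[a, b] (fun r => (A * W r)%:E) by exact: integrable_scale.
have ti : t i < t i.+1 by rewrite -subr_gt0 step.
have := difference_quotient_error sB S'S NCX xdx rho_d a0 bT ati ti tib yab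
  (fun r rab => dx_increment a0 bT ba rab yab) (fun r rab => drhoW (inT r rab)) Wi'.
rewrite step RintegralZl// => E.
apply: le_sqrt_mul; first exact: sqrtr_ge0.
  by rewrite addr_ge0// mulr_ge0// sqr_ge0.
apply: le_trans E _; set J := Rintegral _ _ _; lra.
Qed.

End quotient_consistency.

(** * The error equations *)

Lemma scalerB_ACA {R : realType} {X : lmodType R} (r : R) (x y x' y' : X) :
  r *: ((x' - y') - (x - y)) = r *: (x' - x) - r *: (y' - y).
Proof. by rewrite -scalerBr [in LHS]opprD addrACA -opprD. Qed.

(** The discrete equation subtracted from the exact one, with the difference quotients
    of the projections [P1], [P0], [U], those of the scheme [Q1], [Q0], [UQ], and the
    exact rates [DP], [DU] at the new time. *)
Lemma residual_arith {R : realType} (bi L al P1 P0 Q1 Q0 DP U UQ DU BP BQ G E1 E2 : R) :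
  0 <= bi -> 0 <= L -> 0 <= al ->
  bi * DP + al * DU + BP = G ->
  bi * Q1 + L * Q1 + BQ = - al * UQ + L * Q0 + G ->
  `|P1 - DP| <= E1 -> `|P0 - DP| <= E1 -> `|U - DU| <= E2 ->
  bi * (P1 - Q1) + L * (P1 - Q1) - L * (P0 - Q0) + al * (U - UQ) + (BP - BQ)
  <= (bi + 2 * L) * E1 + al * E2.
Proof.
move=> bi0 L0 al0 ex dis; rewrite !ler_norml => /andP[_ h1] /andP[h2 _] /andP[_ h3].
have k1 := ler_wpM2l (addr_ge0 bi0 L0) h1.
have k2 := ler_wpM2l L0 h2; have k3 := ler_wpM2l al0 h3.
lra.
Qed.


Lemma error_splitting {R : realType} {X : lmodType R} (S : set X) (B : X -> X -> R)
    (x xbar y : X) : semi_inner S B -> S x -> S xbar -> S y ->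
  sipnorm B (lsub x y) <= sipnorm B (lsub x xbar) + sipnorm B (lsub xbar y) /\
  sipnorm B (lsub xbar y) <= sipnorm B (lsub x y) + sipnorm B (lsub x xbar).
Proof.
rewrite /lsub; move=> sB Sx Sb Sy; split; first exact: (sipnorm_triangle sB Sx Sb Sy).
by rewrite (sipnormBC sB Sx Sb) [leRHS]addrC; exact: (sipnorm_triangle sB Sb Sx Sy).
Qed.

Section error_estimate.
Context {R : realType} {V Q : lmodType R}.
Variables (SV Vh : set V) (SQ Qh : set Q).
Variables (a : V -> V -> R) (b m : Q -> Q -> R) (c : V -> Q -> R) (nd : V -> R).
Variables (T al be L s gam : R) (N : nat).
Hypotheses (sa : semi_inner SV a) (sb : semi_inner SQ b) (sm : semi_inner SQ m).
Hypotheses (VhS : Vh `<=` SV) (QhS : Qh `<=` SQ).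
Hypotheses (Vlin : lin_closed Vh) (Qlin : lin_closed Qh).
Hypothesis c_linl : forall k v w q, SV v -> SV w -> SQ q ->
  c (k *: v + w) q = k * c v q + c w q.
Hypothesis c_linr : forall k v p q, SV v -> SQ p -> SQ q ->
  c v (k *: p + q) = k * c v p + c v q.
Hypothesis c_bound : forall v q, SV v -> SQ q ->
  s * c v q <= sipnorm a v * sipnorm m q.
Hypothesis c_nd : forall v q, SV v -> SQ q -> `|c v q| <= nd v * sipnorm m q.
Hypotheses (al0 : 0 < al) (be0 : 0 < be) (s0 : 0 < s) (T0 : 0 < T) (N0 : (0 < N)%N).
Hypothesis L_large : al ^+ 2 / s ^+ 2 <= L.
Hypothesis gam0 : 0 < gam.
Hypothesis inf_sup_bound : forall q M, Qh q -> 0 <= M ->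
  (forall v, Vh v -> c v q <= M * sipnorm a v) -> gam * sipnorm m q <= M.

Variables (ub uh dut : nat -> V) (pb ph dpt : nat -> Q).
Variables (F : nat -> V -> R) (G : nat -> Q -> R).
Hypothesis Vub : forall j, (j <= N)%N -> Vh (ub j).
Hypothesis Vuh : forall j, (j <= N)%N -> Vh (uh j).
Hypothesis Qpb : forall j, (j <= N)%N -> Qh (pb j).
Hypothesis Qph : forall j, (j <= N)%N -> Qh (ph j).
Hypothesis Sdu : forall j, (j <= N)%N -> SV (dut j).
Hypothesis Sdp : forall j, (j <= N)%N -> SQ (dpt j).
Hypothesis exact_momentum : forall j, (j <= N)%N -> forall v, Vh v ->
  a (ub j) v - al * c v (pb j) = F j v.
Hypothesis discrete_momentum : forall j, (j <= N)%N -> forall v, Vh v ->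
  a (uh j) v - al * c v (ph j) = F j v.
Hypothesis exact_mass : forall j, (j < N)%N -> forall q, Qh q ->
  be^-1 * m (dpt j.+1) q + al * c (dut j.+1) q + b (pb j.+1) q = G j.+1 q.
Hypothesis first_mass : forall q, Qh q ->
  be^-1 * m (bdiff T N ph 0) q + al * c (bdiff T N uh 0) q + b (ph 1%N) q = G 1%N q.
Hypothesis split_mass : forall j, (j.+2 <= N)%N -> forall q, Qh q ->
  be^-1 * m (bdiff T N ph j.+1) q + L * m (bdiff T N ph j.+1) q + b (ph j.+2) q =
  - al * c (bdiff T N uh j) q + L * m (bdiff T N ph j) q + G j.+2 q.

Variables (Kp Ku : R) (eps : nat -> R).
Local Notation tau := (tau T N).
Local Notation nm := (sipnorm m).
Hypotheses (Kp0 : 0 <= Kp) (eps0 : forall j, 0 <= eps j).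
Hypothesis cons_p : forall j, (j < N)%N ->
  nm (quotient_error T N pb j (dpt j.+1)) <= Kp * eps j.
Hypothesis cons_p' : forall j, (j.+2 <= N)%N ->
  nm (quotient_error T N pb j (dpt j.+2)) <= Kp * eps j.+1.
Hypothesis cons_u0 : nd (quotient_error T N ub 0 (dut 1)) <= Ku * eps 0.
Hypothesis cons_u : forall j, (j.+2 <= N)%N ->
  nd (quotient_error T N ub j (dut j.+2)) <= Ku * eps j.+1.

Let tau0 : 0 < tau.
Proof. by rewrite divr_gt0// ltr0n. Qed.

Local Notation disp_error j := (lsub (ub j) (uh j)).
Local Notation pres_error j := (lsub (pb j) (ph j)).
Definition residual_const : R := (be^-1 + 2 * L) * Kp + al * Ku.

Let cSV := sip_closed sa.
Let cSQ := sip_closed sm.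

Lemma disp_error_in j : (j <= N)%N -> Vh (disp_error j).
Proof. by move=> jN; exact: (lin_closedB Vlin (Vub jN) (Vuh jN)). Qed.

Lemma pres_error_in j : (j <= N)%N -> Qh (pres_error j).
Proof. by move=> jN; exact: (lin_closedB Qlin (Qpb jN) (Qph jN)). Qed.

Let cBl v w q : SV v -> SV w -> SQ q -> c (v - w) q = c v q - c w q.
Proof. by move=> Lv Lw Lq; rewrite addrC -scaleN1r c_linl// mulN1r addrC. Qed.

Let cBr v q q' : SV v -> SQ q -> SQ q' -> c v (q - q') = c v q - c v q'.
Proof. by move=> Lv Lq Lq'; rewrite addrC -scaleN1r c_linr// mulN1r addrC. Qed.

Lemma disp_error_coupled j : (j <= N)%N ->
  coupled Vh a c al (disp_error j) (pres_error j).
Proof.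
rewrite /lsub.
move=> jN v Vv; have := exact_momentum jN Vv; have := discrete_momentum jN Vv.
rewrite (sipBl sa (VhS (Vub jN)) (VhS (Vuh jN)) (VhS Vv)).
rewrite (cBr (VhS Vv) (QhS (Qpb jN)) (QhS (Qph jN))).
lra.
Qed.

Let Sbd {X : lmodType R} (S : set X) (x : nat -> X) j : lin_closed S ->
  (forall i, (i <= N)%N -> S (x i)) -> (j < N)%N -> S (bdiff T N x j).
Proof.
move=> cS Sx jN; apply: (lin_closedZ cS).
exact: (lin_closedB cS (Sx _ jN) (Sx _ (ltnW jN))).
Qed.

Let diffE {X : lmodType R} (x y : nat -> X) j :
  tau^-1 *: ((x j.+1 - y j.+1) - (x j - y j)) = bdiff T N x j - bdiff T N y j.
Proof. exact: scalerB_ACA. Qed.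

Let pressure_term j z q E : (j < N)%N -> SQ z -> Qh q ->
  nm (quotient_error T N pb j z) <= E ->
  `|m (bdiff T N pb j) q - m z q| <= E * nm q.
Proof.
move=> jN Sz Qq hE.
have Sb := QhS (Sbd Qlin Qpb jN); have Lq := QhS Qq.
rewrite -(sipBl sm Sb Sz Lq).
apply: le_trans (sip_CauchySchwarz sm (lin_closedB cSQ Sb Sz) Lq) _.
by rewrite ler_wpM2r ?sipnorm_ge0.
Qed.

Let displacement_term j z q E : (j < N)%N -> SV z -> Qh q ->
  nd (quotient_error T N ub j z) <= E ->
  `|c (bdiff T N ub j) q - c z q| <= E * nm q.
Proof.
move=> jN Sz Qq hE.
have Sb := VhS (Sbd Vlin Vub jN); have Lq := QhS Qq.
rewrite -(cBl Sb Sz Lq).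
apply: le_trans (c_nd (lin_closedB cSV Sb Sz) Lq) _.
by rewrite ler_wpM2r ?sipnorm_ge0.
Qed.

Let L0 : 0 <= L.
Proof. by apply: le_trans L_large; rewrite divr_ge0 ?sqr_ge0. Qed.

Let bi0 : 0 <= be^-1.
Proof. by rewrite invr_ge0 ltW. Qed.

Lemma split_step_residual j q : (j.+2 <= N)%N -> Qh q ->
  be^-1 * m (tau^-1 *: (pres_error j.+2 - pres_error j.+1)) q
  + L * m (tau^-1 *: (pres_error j.+2 - pres_error j.+1)) q
  - L * m (tau^-1 *: (pres_error j.+1 - pres_error j)) q
  + al * c (tau^-1 *: (disp_error j.+1 - disp_error j)) q
  + b (pres_error j.+2) q
  <= residual_const * eps j.+1 * nm q.
Proof.
move=> jN Qq; have Lq := QhS Qq.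
have jN1 : (j.+1 < N)%N := jN; have jN0 := ltnW jN1.
rewrite /lsub !diffE.
rewrite (sipBl sm (QhS (Sbd Qlin Qpb jN1)) (QhS (Sbd Qlin Qph jN1)) Lq).
rewrite (sipBl sm (QhS (Sbd Qlin Qpb jN0)) (QhS (Sbd Qlin Qph jN0)) Lq).
rewrite (cBl (VhS (Sbd Vlin Vub jN0)) (VhS (Sbd Vlin Vuh jN0)) Lq).
rewrite (sipBl sb (QhS (Qpb jN)) (QhS (Qph jN)) Lq).
have e1 := pressure_term jN1 (Sdp jN) Qq (cons_p jN1).
have e2 := pressure_term jN0 (Sdp jN) Qq (cons_p' jN).
have e3 := displacement_term jN0 (Sdu jN) Qq (cons_u jN).
apply: le_trans (residual_arith bi0 L0 (ltW al0) (exact_mass jN1 Qq)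
  (split_mass jN Qq) e1 e2 e3) _.
by rewrite /residual_const !mulrDl !mulrA.
Qed.

Lemma first_step_residual q : Qh q ->
  be^-1 * m (tau^-1 *: (pres_error 1 - pres_error 0)) q
  + al * c (tau^-1 *: (disp_error 1 - disp_error 0)) q
  + b (pres_error 1) q
  <= residual_const * eps 0 * nm q.
Proof.
move=> Qq; have Lq := QhS Qq.
rewrite /lsub !diffE.
rewrite (sipBl sm (QhS (Sbd Qlin Qpb N0)) (QhS (Sbd Qlin Qph N0)) Lq).
rewrite (cBl (VhS (Sbd Vlin Vub N0)) (VhS (Sbd Vlin Vuh N0)) Lq).
rewrite (sipBl sb (QhS (Qpb N0)) (QhS (Qph N0)) Lq).
have e1 := pressure_term N0 (Sdp N0) Qq (cons_p N0).
have e3 := displacement_term N0 (Sdu N0) Qq cons_u0.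
have ex := exact_mass N0 Qq; have dis := first_mass Qq.
have K0 : 0 <= 2 * L * (Kp * eps 0 * nm q).
  exact: (mulr_ge0 (mulr_ge0 (ler0n _ 2) L0)
    (mulr_ge0 (mulr_ge0 Kp0 (eps0 _)) (sipnorm_ge0 _))).
move: e1 e3; rewrite !ler_norml => /andP[_ h1] /andP[_ h3].
have k1 := ler_wpM2l bi0 h1; have k3 := ler_wpM2l (ltW al0) h3.
rewrite /residual_const; lra.
Qed.

Definition growth : R := 1 + L * be.

Let growth0 : 0 <= growth.
Proof. by rewrite addr_ge0// mulr_ge0// ltW. Qed.

Let sa' : semi_inner Vh a := sip_subspace sa Vlin VhS.
Let sb' : semi_inner Qh b := sip_subspace sb Qlin QhS.
Let sm' : semi_inner Qh m := sip_subspace sm Qlin QhS.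

(** The inf-sup condition bounds the initial pressure error by the energy norm of the
    displacement error in equilibrium with it. *)
Lemma initial_pressure_error_le :
  gam * nm (pres_error 0) <= al^-1 * sipnorm a (disp_error 0).
Proof.
have V0 := disp_error_in (leq0n N); have Q0 := pres_error_in (leq0n N).
apply: inf_sup_bound => //.
  by rewrite mulr_ge0 ?sipnorm_ge0// invr_ge0 ltW.
move=> v Vv; rewrite -mulrA mulrC ler_pdivlMr// mulrC.
rewrite -(disp_error_coupled (leq0n N) Vv).
by apply: le_trans (ler_norm _) _; exact: (sip_CauchySchwarz sa (VhS V0) (VhS Vv)).
Qed.

(** The energy bounds the pressure error in the norm of [b]; adding up its increments
    to the initial one bounds it in the norm of [m]; and equilibrium transfers this
    to the displacement error. *)
Lemma error_estimate n P : (0 < n <= N)%N ->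
  \sum_(j < n) tau * (residual_const * eps j) ^+ 2 <= P ->
  let E := Num.sqrt growth * (sipnorm b (pres_error 0) + Num.sqrt be * Num.sqrt P) in
  let M := gam^-1 * al^-1 * sipnorm a (disp_error 0) + Num.sqrt (T * be) * E in
  [/\ sipnorm b (pres_error n) <= E, nm (pres_error n) <= M &
      sipnorm a (disp_error n) <= al / s * M].
Proof.
move=> /andP[n0 nN] hP E M.
have Q0 := pres_error_in (leq0n N); have Qn := pres_error_in nN.
have P0 : 0 <= P.
  apply: le_trans hP; apply: sumr_ge0 => j _.
  exact: (mulr_ge0 (ltW tau0) (sqr_ge0 _)).
have c_linr' k v p q : Vh v -> Qh p -> Qh q -> c v (k *: p + q) = k * c v p + c v q.
  by move=> /VhS Lv /QhS Lp /QhS Lq; exact: c_linr.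
have c_bound' v q : Vh v -> Qh q -> s * c v q <= sipnorm a v * nm q.
  by move=> /VhS Lv /QhS Lq; exact: c_bound.
have energy := fixed_stress_energy (rho := fun j => residual_const * eps j)
  sa' sb' sm' c_linr' c_bound' al0 be0 s0 tau0 L_large
  (eu := fun j => disp_error j) (ep := fun j => pres_error j)
  disp_error_in pres_error_in disp_error_coupled
  (fun _ q Qq => first_step_residual Qq)
  (fun j jN q Qq => split_step_residual jN Qq) (introT andP (conj n0 nN)).
have telescoped := telescoped_norm_le (ep := fun j => pres_error j) sm' tau0 pres_error_in nN.
have Z0 : 0 <= \sum_(j < n) tau * m (tau^-1 *: (pres_error j.+1 - pres_error j))
    (tau^-1 *: (pres_error j.+1 - pres_error j)).
  apply: sumr_ge0 => j _; rewrite mulr_ge0 ?(ltW tau0)//; apply: (sip_ge0 sm').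
  have jN : (j < N)%N := leq_trans (ltn_ord j) nN.
  apply: (lin_closedZ Qlin).
  exact: (lin_closedB Qlin (pres_error_in jN) (pres_error_in (ltnW jN))).
move: energy telescoped Z0; set Z := \sum_(j < n) _; set P' := \sum_(_ < _) _ in hP *.
move=> energy telescoped Z0.
have bn0 := sip_ge0 sb' Qn; have b00 := sip_ge0 sb' Q0.
have rhs : growth * (b (pres_error 0) (pres_error 0) + be * P') <= E ^+ 2.
  rewrite /E exprMn sqr_sqrtr// ler_wpM2l// sqrrD (sipnorm_sqr sb')//.
  rewrite exprMn sqr_sqrtr ?(ltW be0)// sqr_sqrtr//.
  have c1 : be * P' <= be * P by rewrite ler_wpM2l// ltW.
  have c2 : 0 <= sipnorm b (pres_error 0) * (Num.sqrt be * Num.sqrt P).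
    exact: (mulr_ge0 (sipnorm_ge0 _) (mulr_ge0 (sqrtr_ge0 _) (sqrtr_ge0 _))).
  lra.
have E0 : 0 <= E.
  exact: (mulr_ge0 (sqrtr_ge0 _) (addr_ge0 (sipnorm_ge0 _)
    (mulr_ge0 (sqrtr_ge0 _) (sqrtr_ge0 _)))).
have h1 : sipnorm b (pres_error n) <= E.
  rewrite -(ler_pXn2r (n := 2))// ?nnegrE ?sipnorm_ge0// (sipnorm_sqr sb')//.
  apply: le_trans rhs; apply: le_trans energy.
  by rewrite lerDl mulr_ge0.
have h2 : nm (pres_error n - pres_error 0) <= Num.sqrt (T * be) * E.
  have Tbe0 : 0 <= T * be by rewrite mulr_ge0// ltW.
  rewrite -(ler_pXn2r (n := 2))// ?nnegrE ?sipnorm_ge0//; last first.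
    exact: (mulr_ge0 (sqrtr_ge0 _) E0).
  rewrite (sipnorm_sqr sm'); last exact: (lin_closedB Qlin).
  rewrite exprMn sqr_sqrtr//; apply: le_trans telescoped _.
  have Zle : be^-1 * Z <= E ^+ 2.
    by apply: le_trans rhs; apply: le_trans energy; rewrite lerDr.
  have nT : n%:R * tau <= T.
    have N1 : (0 : R) < N%:R by rewrite ltr0n.
    have -> : n%:R * tau = n%:R / N%:R * T.
      by rewrite /Defs.tau mulrCA mulrC.
    rewrite -[leRHS]mul1r ler_wpM2r ?(ltW T0)// ler_pdivrMr// mul1r.
    by rewrite ler_nat.
  apply: (@le_trans _ _ (T * Z)); first by rewrite ler_wpM2r.
  rewrite -mulrA ler_wpM2l ?(ltW T0)//.
  by rewrite mulrC ler_pdivrMr// mulrC in Zle.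
have h3 : nm (pres_error n) <= M.
  have -> : pres_error n = pres_error 0 + (pres_error n - pres_error 0).
    by rewrite addrC subrK.
  apply: le_trans (sipnormD sm' Q0 (lin_closedB Qlin Qn Q0)) _.
  apply: lerD => //.
  have := initial_pressure_error_le; rewrite -ler_pdivlMl//.
  by rewrite mulrA.
split=> //.
have := coupled_norm_le sa' c_bound' al0 (disp_error_in nN) Qn (disp_error_coupled nN).
rewrite -ler_pdivlMl// => /le_trans; apply.
rewrite mulrA mulrC [al / s]mulrC; rewrite mulrC ler_wpM2l//.
by rewrite mulr_ge0 ?invr_ge0 ?ltW.
Qed.

End error_estimate.

(** * The Biot discretization *)

Lemma fin_dim_subspace_lin_closed {R : realType} {X : lmodType R} (S : set X) :
  fin_dim_subspace S -> lin_closed S.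
Proof.
move=> [n [b Sb]] k x y /Sb[cx ->] /Sb[cy ->].
apply/Sb; exists (fun i => k * cx i + cy i).
rewrite scaler_sumr -big_split/=; apply: eq_bigr => i _.
by rewrite scalerDl scalerA.
Qed.

Lemma expr_le_bound {R : realType} (h H : R) (s a M : nat) :
  0 <= h -> h <= H -> 1 <= H -> (s <= a)%N -> (a - s <= M)%N ->
  h ^+ a <= H ^+ M * h ^+ s.
Proof.
move=> h0 hH H1 sa aM; rewrite -(subnK sa) exprD ler_wpM2r ?exprn_ge0//.
apply: (@le_trans _ _ (H ^+ (a - s))).
  by rewrite lerXn2r ?nnegrE// (le_trans h0).
by rewrite ler_weXn2l.
Qed.

Lemma jet_subE {R : realType} {d : nat} (x y : jet R d) : x - y = lsub x y.
Proof. by []. Qed.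

Lemma vjet_subE {R : realType} {d : nat} (x y : vjet R d) : x - y = lsub x y.
Proof. by []. Qed.

Lemma sqrtrD_le {R : realType} (x y : R) : 0 <= x -> 0 <= y ->
  Num.sqrt (x + y) <= Num.sqrt x + Num.sqrt y.
Proof.
move=> x0 y0; rewrite -(ler_pXn2r (n := 2)) ?nnegrE ?addr_ge0 ?sqrtr_ge0//.
rewrite sqrrD !sqr_sqrtr ?addr_ge0// mulr2n.
by have := mulr_ge0 (sqrtr_ge0 x) (sqrtr_ge0 y); lra.
Qed.

Lemma distribute_const {R : realType} (C A e D w I J : R) :
  C * (A + e * D + w * I + e * J) = C * A + C * e * D + C * w * I + C * e * J.
Proof. by ring. Qed.

(** In the final estimate [X] is the right-hand side for the constant [1], with [e] the
    power of the mesh size and [w] the time step, so that each source of error can be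
    replaced by [X]. *)
Lemma bounds_by_total {R : realType} (A B v q v' q' r i i' e w : R) :
  0 <= A -> 0 <= B -> 0 <= v -> 0 <= q -> 0 <= v' -> 0 <= q' ->
  0 <= r -> 0 <= i -> 0 <= i' -> 0 <= e -> 0 <= w ->
  let X := (A + B) + e * (v + q + v' + q') + w * r + e * (i + i') in
  [/\ 0 <= X, A <= X, B <= X, e * (v + q) <= X &
      [/\ e * q <= X, e * (v' + q') <= X, e * q' <= X & w * r + e * i' <= X]].
Proof.
move=> A0 B0 v0 q0 v0' q0' r0 i0 i0' e0 w0 /=.
have := (mulr_ge0 e0 v0, mulr_ge0 e0 q0, mulr_ge0 e0 v0', mulr_ge0 e0 q0').
have := (mulr_ge0 e0 i0, mulr_ge0 e0 i0', mulr_ge0 w0 r0).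
by move=> [[? ?] ?] [[[? ?] ?] ?]; split; [| | | |split]; lra.
Qed.

Lemma collect_bounds {R : realType} (pc g sb k1 k2 k3 rs X A0 B0 S0 : R)
    (RA RB RL EA EB EL : R) :
  0 <= g -> 0 <= sb -> 0 <= k1 -> 0 <= k2 -> 0 <= k3 -> 0 <= X ->
  A0 <= (1 + pc) * X -> B0 <= (1 + pc) * X -> S0 <= rs * X ->
  RA <= pc * X -> RB <= pc * X -> RL <= pc * X ->
  let E := g * (B0 + sb * S0) in let M := k1 * A0 + k2 * E in
  EB <= E -> EL <= M -> EA <= k3 * M ->
  let CE := g * ((1 + pc) + sb * rs) in let CM := k1 * (1 + pc) + k2 * CE in
  (RA + EA) + (RB + EB) + (RL + EL) <= (3 * pc + CE + CM + k3 * CM + 1) * X.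
Proof.
move=> g0 sb0 k10 k20 k30 X0 hA hB hS hRA hRB hRL.
cbv zeta; set E := g * (B0 + _); set M := _ + k2 * E => hEB hEL hEA.
set CE := g * (_ + _ * rs); set CM := _ + k2 * CE.
have hE : E <= CE * X.
  by rewrite /E /CE -mulrA ler_wpM2l// [leRHS]mulrDl lerD// -mulrA ler_wpM2l.
have hM : M <= CM * X.
  rewrite [leRHS]mulrDl -[k1 * _ * X]mulrA -[k2 * _ * X]mulrA.
  exact: (lerD (ler_wpM2l k10 hA) (ler_wpM2l k20 hE)).
have hkM := ler_wpM2l k30 hM; clearbody CM CE M E; lra.
Qed.

Section biot_discretization.
Context {R : realType} {d : nat} (D : set 'rV[R]_d).
Variables (lam mu al be kap T eta om c H : R) (k l : nat).
Hypotheses (d0 : (0 < d)%N) (mD : measurable D).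
Hypotheses (lam0 : 0 < lam) (mu0 : 0 < mu) (al0 : 0 < al) (be0 : 0 < be).
Hypotheses (kap0 : 0 < kap) (T0 : 0 < T) (eta0 : 0 < eta) (om1 : 1 <= om).
Hypotheses (c0 : 0 < c) (H1 : 1 <= H).

Notation leb := (@lebesgue_measure R).
Notation NA := (normA D lam mu).
Notation NB := (normB D kap).
Notation NL := (L2norm D).

(** The drained bulk modulus of the porous medium. *)
Definition bulk_modulus : R := lam + 2 * mu / d%:R.
Definition sqrt_bulk : R := Num.sqrt bulk_modulus.
Definition stabilization : R := om * (al ^+ 2 / bulk_modulus).
Definition proj_const : R := c * H ^+ (k + l).+1.
Definition normA_const : R := Num.sqrt (2 * mu + lam * d%:R).
Definition div_const : R := normA_const / sqrt_bulk.

Lemma bulk_modulus_gt0 : 0 < bulk_modulus.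
Proof. by rewrite addr_gt0// divr_gt0 ?mulr_gt0 ?ltr0n. Qed.

Lemma sqrt_bulk_gt0 : 0 < sqrt_bulk.
Proof. by rewrite sqrtr_gt0 bulk_modulus_gt0. Qed.

Lemma sqrt_bulk_sqr : sqrt_bulk ^+ 2 = bulk_modulus.
Proof. by rewrite sqr_sqrtr// ltW// bulk_modulus_gt0. Qed.

Lemma stabilization_large : al ^+ 2 / sqrt_bulk ^+ 2 <= stabilization.
Proof.
rewrite sqrt_bulk_sqr ler_peMl// divr_ge0 ?sqr_ge0//; exact/ltW/bulk_modulus_gt0.
Qed.

Lemma proj_const_ge0 : 0 <= proj_const.
Proof. by rewrite mulr_ge0 ?(ltW c0)// exprn_ge0// (le_trans ler01). Qed.

Let sL2 := ip_semi_inner mD.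
Let sval := ip_value_semi_inner mD.
Let svH1 := vipH1_semi_inner mD.
Let sdiv := ip_div_semi_inner mD.
Let sA : semi_inner (vjetL2 D) (aform D lam mu) :=
  aform_semi_inner mD (ltW lam0) (ltW mu0).
Let sB : semi_inner (jetL2 D) (bform D kap) := bform_semi_inner mD (ltW kap0).

Lemma normA_le_vH1norm w : vjetL2 D w -> NA w <= normA_const * vH1norm D w.
Proof.
move=> Lw; rewrite (vH1normE mD)// -sqrtrM; last first.
  by rewrite addr_ge0// mulr_ge0 ?ler0n// ltW.
by rewrite ler_wsqrtr// aform_le_vipH1// ltW.
Qed.

Lemma L2norm_div_le_normA w : vjetL2 D w -> sqrt_bulk * NL (div w) <= NA w.
Proof.
move=> Lw; rewrite -sqrtrM; last exact/ltW/bulk_modulus_gt0.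
by rewrite ler_wsqrtr// (div_le_aform mD)// ltW.
Qed.

Lemma L2norm_div_le_vH1norm w : vjetL2 D w ->
  NL (div w) <= div_const * vH1norm D w.
Proof.
move=> Lw; rewrite /div_const mulrAC ler_pdivlMr ?sqrt_bulk_gt0// mulrC.
exact: le_trans (L2norm_div_le_normA Lw) (normA_le_vH1norm Lw).
Qed.

Lemma ip_div_le v q : vjetL2 D v -> jetL2 D q ->
  sqrt_bulk * ip D (div v) q.1 <= NA v * NL q.1.
Proof.
move=> Lv Lq.
have CS := sip_CauchySchwarz sL2 (L2_div mD Lv) Lq.1.
have := le_trans (ler_norm _) CS; rewrite -(ler_pM2l sqrt_bulk_gt0) => h.
apply: le_trans h _; rewrite mulrA ler_wpM2r ?sqrtr_ge0//.
exact: L2norm_div_le_normA.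
Qed.

Variables (m : nat) (K : 'I_m -> 'I_d.+1 -> 'rV[R]_d).
Variables (Vh : set (vjet R d)) (Qh : set (jet R d)) (N : nat).
Variables (f : R -> 'I_d -> 'rV[R]_d -> R) (g : R -> 'rV[R]_d -> R).
Variables (u du ddu : R -> vjet R d) (p dp : R -> jet R d).
Variables (ddp : R -> 'rV[R]_d -> R^o).
Variables (fh : nat -> 'I_d -> 'rV[R]_d -> R) (gh : nat -> 'rV[R]_d -> R).
Variables (uh : nat -> vjet R d) (ph : nat -> jet R d).
Variables (ubar drho_u : R -> vjet R d) (pbar drho_p : R -> jet R d).
Local Notation h := (mesh_size K).
Local Notation s := (minn k l).
Local Notation t := (tj T N).
Local Notation tau := (tau T N).
Local Notation L := stabilization.
Hypothesis hH : h <= H.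
Hypothesis fe : fe_pair D K Vh Qh.
Hypothesis infsup : inf_sup D lam mu eta Vh Qh.
Hypothesis sol : biot_solution D lam mu al be kap T f g u du p dp.
Hypothesis smooth_sol : smooth_solution D T k l u du ddu p dp ddp.
Let estimates (ru : vjet R d) (rp : jet R d) (w : vjet R d) (q : jet R d) :=
  [/\ NA ru <= c * h ^+ minn k l.+1 * (vHsemi D k.+1 w + Hsemi D l.+1 q.1),
      NB rp <= c * h ^+ l * Hsemi D l.+1 q.1 &
      NL rp.1 <= c * h ^+ l.+1 * Hsemi D l.+1 q.1].
Hypothesis proj : forall r, 0 <= r <= T ->
  [/\ Vh (ubar r), Qh (pbar r),
      forall q, Qh q -> bform D kap (pbar r) q = bform D kap (p r) q &
      forall v, Vh v ->
        aform D lam mu (ubar r) v - al * ip D (pbar r).1 (div v) =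
        aform D lam mu (u r) v - al * ip D (p r).1 (div v)].
Hypothesis proj_u : has_tderiv (vH10 D) (vH1norm D) T (fun r => u r - ubar r) drho_u.
Hypothesis proj_p : has_tderiv (H10 D) (H1norm D) T (fun r => p r - pbar r) drho_p.
Hypothesis approx : forall r, 0 <= r <= T ->
  estimates (u r - ubar r) (p r - pbar r) (u r) (p r) /\
  estimates (drho_u r) (drho_p r) (du r) (dp r).
Hypothesis data : discrete_data D T N Vh Qh f g fh gh.
Hypothesis dsol : discrete_solution D lam mu al be kap T N Vh Qh L fh gh uh ph.
Hypothesis N0 : (0 < N)%N.

Let tau0 : 0 < tau.
Proof. by rewrite divr_gt0// ltr0n. Qed.

Let t0 : t 0 = 0.
Proof. by rewrite /tj mul0r. Qed.

Let tS j : t j.+1 - t j = tau.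
Proof. by rewrite /tj -mulrBl -natrB// subSnn mul1r. Qed.

Let t_le i j : (i <= j)%N -> t i <= t j.
Proof. by move=> ij; rewrite ler_wpM2r ?ler_nat// ltW. Qed.

Let tN : t N = T.
Proof. by rewrite /tj /Defs.tau mulrC divfK// pnatr_eq0 -lt0n. Qed.

Let t_in j : (j <= N)%N -> 0 <= t j <= T.
Proof.
by move=> jN; rewrite -[leLHS]t0 -[X in _ && (_ <= X)]tN !t_le.
Qed.

(** The density in time of all sources of error: the time discretization and the
    approximation by finite elements. *)
Definition weight (r : R) : R :=
  tau ^+ 2 * (NL (ddp r) ^+ 2 + vH1norm D (ddu r) ^+ 2)
  + (h ^+ s) ^+ 2 * (vHsemi D k.+1 (du r) ^+ 2 + Hsemi D l.+1 (dp r).1 ^+ 2).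

Local Notation W := weight.

Lemma weight_ge0 r : 0 <= W r.
Proof. by rewrite addr_ge0// mulr_ge0 ?sqr_ge0// addr_ge0 ?sqr_ge0. Qed.

Lemma weight_integrable : leb.-integrable `[0, T] (fun r => (W r)%:E).
Proof.
case: smooth_sol => _ int_u int_p [_ int_ddu _] [_ int_ddp _].
by apply: integrable_add => //; apply: integrable_scale => //; exact: integrable_add.
Qed.

Lemma weight_integrable_itv a b : 0 <= a -> b <= T ->
  leb.-integrable `[a, b] (fun r => (W r)%:E).
Proof. by move=> a0 bT; exact: integrable_itvS weight_integrable. Qed.

Let VhS : Vh `<=` vjetL2 D.
Proof. by case: fe => _ _ hV _ v /hV[/vH10_vjetL2]. Qed.

Let QhS : Qh `<=` jetL2 D.
Proof. by case: fe => _ _ _ hQ q /hQ[/H10_jetL2]. Qed.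

Let Vlin : lin_closed Vh.
Proof. by case: fe => /fin_dim_subspace_lin_closed. Qed.

Let Qlin : lin_closed Qh.
Proof. by case: fe => _ /fin_dim_subspace_lin_closed. Qed.

Let Su r : 0 <= r <= T -> vjetL2 D (u r) /\ vjetL2 D (du r).
Proof.
by case: sol => [[hu _] _ _] /hu[Hu Hdu _]; split; exact: vH10_vjetL2.
Qed.

Let Sp r : 0 <= r <= T -> jetL2 D (p r) /\ jetL2 D (dp r).
Proof.
by case: sol => [_ [hp _] _] /hp[Hp Hdp _]; split; exact: H10_jetL2.
Qed.

Let h0 : 0 <= h := mesh_size_ge0 K.

Lemma projection_rate a : (s <= a)%N -> (a <= s + (k + l).+1)%N ->
  c * h ^+ a <= proj_const * h ^+ s.
Proof.
move=> sa aM; rewrite /proj_const -mulrA ler_wpM2l ?(ltW c0)//.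
by apply: expr_le_bound => //; rewrite leq_subLR.
Qed.

Let Hsemi0 q : 0 <= Hsemi D l.+1 q.
Proof. exact: sqrtr_ge0. Qed.

Let vHsemi0 w : 0 <= vHsemi D k.+1 w.
Proof. exact: sqrtr_ge0. Qed.

Lemma estimates_uniform ru rp w q : estimates ru rp w q ->
  [/\ NA ru <= proj_const * h ^+ s * (vHsemi D k.+1 w + Hsemi D l.+1 q.1),
      NB rp <= proj_const * h ^+ s * Hsemi D l.+1 q.1 &
      NL rp.1 <= proj_const * h ^+ s * Hsemi D l.+1 q.1].
Proof.
move=> [e1 e2 e3]; split.
- apply: le_trans e1 _; rewrite ler_wpM2r ?addr_ge0// projection_rate//.
    by rewrite leq_min geq_minl leqW// geq_minr.
  apply: leq_trans (leq_addl _ _).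
  by apply: leq_trans (geq_minl _ _) _; rewrite leqW// leq_addr.
- apply: le_trans e2 _; rewrite ler_wpM2r// projection_rate ?geq_minr//.
  by apply: leq_trans (leq_addl _ _); rewrite leqW// leq_addl.
- apply: le_trans e3 _; rewrite ler_wpM2r// projection_rate//.
    by rewrite leqW// geq_minr.
  by apply: leq_trans (leq_addl _ _); rewrite ltnS leq_addl.
Qed.

Definition pres_consist_const : R := consistency_const 1 (proj_const ^+ 2).
Definition disp_consist_const : R :=
  consistency_const div_const (2 * (proj_const / sqrt_bulk) ^+ 2).

Let t2 : 0 < tau ^+ 2.
Proof. exact: exprn_gt0. Qed.

Let ddp_le_weight r : NL (ddp r) ^+ 2 <= tau ^- 2 * W r.
Proof.
rewrite mulrC ler_pdivlMr// mulrC /weight mulrDr -addrA lerDl.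
exact: (addr_ge0 (mulr_ge0 (sqr_ge0 _) (sqr_ge0 _))
  (mulr_ge0 (sqr_ge0 _) (addr_ge0 (sqr_ge0 _) (sqr_ge0 _)))).
Qed.

Let ddu_le_weight r : vH1norm D (ddu r) ^+ 2 <= tau ^- 2 * W r.
Proof.
rewrite mulrC ler_pdivlMr// mulrC /weight mulrDr addrAC lerDr.
exact: (addr_ge0 (mulr_ge0 (sqr_ge0 _) (sqr_ge0 _))
  (mulr_ge0 (sqr_ge0 _) (addr_ge0 (sqr_ge0 _) (sqr_ge0 _)))).
Qed.

Let drho_p_bound r : 0 <= r <= T ->
  NL (drho_p r).1 ^+ 2 <= proj_const ^+ 2 * W r.
Proof.
move=> rT; have [_ /estimates_uniform[_ _ e]] := approx rT.
have pc0 : 0 <= proj_const * h ^+ s by rewrite mulr_ge0 ?proj_const_ge0// exprn_ge0.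
have h1 : NL (drho_p r).1 ^+ 2 <= (proj_const * h ^+ s * Hsemi D l.+1 (dp r).1) ^+ 2.
  by rewrite ler_pXn2r ?nnegrE ?sqrtr_ge0// mulr_ge0.
apply: le_trans h1 _; rewrite -mulrA exprMn ler_wpM2l ?sqr_ge0// exprMn.
apply: ler_wpDl; first by rewrite mulr_ge0 ?sqr_ge0// addr_ge0 ?sqr_ge0.
by rewrite ler_wpM2l ?sqr_ge0// lerDr sqr_ge0.
Qed.

Let drho_u_bound r : 0 <= r <= T ->
  NL (div (drho_u r)) ^+ 2 <= 2 * (proj_const / sqrt_bulk) ^+ 2 * W r.
Proof.
move=> rT; have [_ /estimates_uniform[e _ _]] := approx rT.
have [_ /vH10_vjetL2 Ld _] := proj_u rT.
have pc0 : 0 <= proj_const * h ^+ s by rewrite mulr_ge0 ?proj_const_ge0// exprn_ge0.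
have h1 := le_trans (L2norm_div_le_normA Ld) e.
have sd := sqrt_bulk_gt0.
have h2 : NL (div (drho_u r)) ^+ 2 <=
    (proj_const / sqrt_bulk * (h ^+ s * (vHsemi D k.+1 (du r) + Hsemi D l.+1 (dp r).1))) ^+ 2.
  rewrite ler_pXn2r ?nnegrE ?sqrtr_ge0//.
    by rewrite mulrAC ler_pdivlMr// mulrC mulrA.
  by rewrite mulr_ge0 ?divr_ge0 ?proj_const_ge0 ?(ltW sd)// mulr_ge0 ?exprn_ge0 ?addr_ge0.
apply: le_trans h2 _; rewrite exprMn [leRHS]mulrAC [leRHS]mulrC.
rewrite ler_wpM2l ?sqr_ge0// exprMn /weight.
have h3 (x y A B : R) : 0 <= A -> 0 <= B ->
    B * (x + y) ^+ 2 <= 2 * (A + B * (x ^+ 2 + y ^+ 2)).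
  by move=> A0 B0; have := mulr_ge0 B0 (sqr_ge0 (x - y)); nra.
apply: h3; last exact: sqr_ge0.
by apply: mulr_ge0; [exact: sqr_ge0|apply: addr_ge0; exact: sqr_ge0].
Qed.

Definition pres_ip (q q' : jet R d) : R := ip D q.1 q'.1.
Definition div_ip (v : vjet R d) (q : jet R d) : R := ip D (div v) q.1.

(** The residual of a step involves the last two time steps, but only one in the first
    step, where the truncated [j.-1] is [0]. *)
Definition window_error j : R :=
  Num.sqrt (tau^-1 * \int[leb]_(r in `[t j.-1, t j.+1]) W r).

Let div_const_ge0 : 0 <= div_const.
Proof. by rewrite divr_ge0// sqrtr_ge0. Qed.

Let pressure_consistency (a b x : R) i : 0 <= a -> b <= T -> b - a <= 2 * tau ->
  a <= t i -> t i.+1 <= b -> a <= x <= b ->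
  sipnorm pres_ip (quotient_error T N (fun j => pbar (t j)) i (dp x)) <=
  pres_consist_const * Num.sqrt (tau^-1 * \int[leb]_(r in `[a, b]) W r).
Proof.
have NC v : jetL2 D v -> sipnorm pres_ip v <= 1 * H1norm D v.
  by move=> Lv; rewrite mul1r (L2norm_value_le_H1norm mD).
have NCY (v : 'rV[R]_d -> R^o) : L2 D v -> sipnorm (ip D) v <= 1 * NL v.
  by rewrite mul1r.
have [_ [tdp _] _] := sol; have [_ _ _ _ tddp] := smooth_sol.
apply: (quotient_consistency (X := jet R d) (Y := 'rV[R]_d -> R^o) (pi := fst)
  sval (@H10_jetL2 _ _ D) NC sL2 (fun _ => id) NCY _ _ ler01 (sqr_ge0 _) _ tdp proj_p tddp
  weight_ge0 weight_integrable _ drho_p_bound tau0).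
- by move=> *; exact: fst_lin.
- by move=> v [].
- by move=> v _; rewrite mul1r.
- by move=> r _; exact: ddp_le_weight.
Qed.

Let displacement_consistency (a b x : R) i : 0 <= a -> b <= T -> b - a <= 2 * tau ->
  a <= t i -> t i.+1 <= b -> a <= x <= b ->
  NL (div (quotient_error T N (fun j => ubar (t j)) i (du x))) <=
  disp_consist_const * Num.sqrt (tau^-1 * \int[leb]_(r in `[a, b]) W r).
Proof.
have NC v : vjetL2 D v -> sipnorm (fun w z : vjet R d => ip D (div w) (div z)) v
    <= div_const * vH1norm D v by exact: L2norm_div_le_vH1norm.
have NCY v : vjetL2 D v -> sipnorm (vipH1 D) v <= 1 * vH1norm D v.
  by move=> Lv; rewrite mul1r (vH1normE mD).
have [[tdu _] _ _] := sol; have [_ _ _ tddu _] := smooth_sol.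
have A0 : 0 <= 2 * (proj_const / sqrt_bulk) ^+ 2 by rewrite mulr_ge0 ?sqr_ge0.
apply: (quotient_consistency (X := vjet R d) (Y := vjet R d) (pi := id)
  sdiv (@vH10_vjetL2 _ _ D) NC svH1 (@vH10_vjetL2 _ _ D) NCY _ _ div_const_ge0 A0 _
  tdu proj_u tddu weight_ge0 weight_integrable _ drho_u_bound tau0) => //.
- by move=> v Lv; rewrite -(vH1normE mD)//; exact: L2norm_div_le_vH1norm.
- move=> r rT; rewrite -(vH1normE mD); first exact: ddu_le_weight.
  by apply: vH10_vjetL2; case: tddu => /(_ r rT).
Qed.

Let Vub j : (j <= N)%N -> Vh (ubar (t j)).
Proof. by move=> jN; case: (proj (t_in jN)). Qed.

Let Qpb j : (j <= N)%N -> Qh (pbar (t j)).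
Proof. by move=> jN; case: (proj (t_in jN)). Qed.

Let Vuh j : (j <= N)%N -> Vh (uh j).
Proof. by case: dsol => mem _ _ _ /mem[]. Qed.

Let Qph j : (j <= N)%N -> Qh (ph j).
Proof. by case: dsol => mem _ _ _ /mem[]. Qed.

Let discrete_momentum j : (j <= N)%N -> momentum_eq D lam mu al Vh fh uh ph j.
Proof.
case: dsol => _ [init _] [first _] efs.
case: j => [//|[//|j]] jN v Vv.
have jN' : (1 <= j.+1 <= N.-1)%N by rewrite /= -ltnS prednK.
by have [_ ->] := efs _ jN'; [rewrite addrC addKr|exact: Vv].
Qed.

Let ip_divC v q : vjetL2 D v -> jetL2 D q -> ip D q.1 (div v) = div_ip v q.
Proof. by move=> Lv Lq; exact: (sip_sym sL2 Lq.1 (L2_div mD Lv)). Qed.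

Let div_ip_linl k' v w q : vjetL2 D v -> vjetL2 D w -> jetL2 D q ->
  div_ip (k' *: v + w) q = k' * div_ip v q + div_ip w q.
Proof.
move=> Lv Lw Lq; rewrite /div_ip div_lin.
exact: (sip_lin sL2 _ (L2_div mD Lv) (L2_div mD Lw) Lq.1).
Qed.

Let div_ip_linr k' v q q' : vjetL2 D v -> jetL2 D q -> jetL2 D q' ->
  div_ip v (k' *: q + q') = k' * div_ip v q + div_ip v q'.
Proof.
move=> Lv Lq Lq'; rewrite /div_ip fst_lin.
have Lkq : L2 D (k' *: q.1) := lin_closedZ (L2_lin_closed mD) k' Lq.1.
by rewrite (sipDr sL2 Lkq Lq'.1 (L2_div mD Lv)) (sipZr sL2 _ Lq.1 (L2_div mD Lv)).
Qed.

Let div_ip_nd v q : vjetL2 D v -> jetL2 D q ->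
  `|div_ip v q| <= NL (div v) * sipnorm pres_ip q.
Proof. by move=> Lv Lq; exact: (sip_CauchySchwarz sL2 (L2_div mD Lv) Lq.1). Qed.

(** The quotients over which the supremum is taken are at most [M], including those with
    zero denominator, which vanish. *)
Let inf_sup_bound q M : Qh q -> 0 <= M ->
  (forall v, Vh v -> div_ip v q <= M * sipnorm (aform D lam mu) v) ->
  eta / sqrt_bulk * sipnorm pres_ip q <= M.
Proof.
move=> Qq M0 hM; apply: le_trans (infsup Qq) _.
set A := [set _ | _ in _].
have AM x : A x -> x <= M.
  move=> [v [Vv _] <-].
  have [->|N0'] := eqVneq (normA D lam mu v) 0; first by rewrite invr0 mulr0.
  have Npos : 0 < normA D lam mu v by rewrite lt_neqAle eq_sym N0' sqrtr_ge0.
  by rewrite ler_pdivrMr//; exact: hM.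
have [->|A0] := eqVneq A set0; first by rewrite sup0.
by apply: ge_sup => //; exact/set0P.
Qed.

Let exact_momentum j : (j <= N)%N -> forall v, Vh v ->
  aform D lam mu (ubar (t j)) v - al * div_ip v (pbar (t j)) = vip D (fh j) (value v).
Proof.
move=> jN v Vv.
have [_ _ _ /(_ v Vv) projE] := proj (t_in jN).
have Hv : vH10 D v by case: fe => _ _ /(_ v Vv)[].
have [_ _ /(_ _ (t_in jN))[_ _ /(_ v Hv) exE _]] := sol.
have [/(_ j jN)[_ /(_ v Vv) dataE] _ _] := data.
by rewrite -(ip_divC (VhS Vv) (QhS (Qpb jN))) projE exE dataE.
Qed.

Let exact_mass j : (j < N)%N -> forall q, Qh q ->
  be^-1 * pres_ip (dp (t j.+1)) q + al * div_ip (du (t j.+1)) q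
    + bform D kap (pbar (t j.+1)) q = ip D (gh j.+1) q.1.
Proof.
move=> jN q Qq.
have Hq : H10 D q by case: fe => _ _ _ /(_ q Qq)[].
have [_ _ /(_ _ (t_in jN))[_ _ _ /(_ q Hq) exE]] := sol.
have [_ _ /(_ q Qq) -> _] := proj (t_in jN).
have [_ _ dataE] := data.
by rewrite dataE// -exE.
Qed.

Let window j : (j.+2 <= N)%N ->
  [/\ 0 <= t j, t j.+2 <= T, t j.+2 - t j <= 2 * tau & t j <= t j.+2 <= t j.+2].
Proof.
move=> jN; have /andP[a0 _] := t_in (ltnW (ltnW jN)); have /andP[_ bT] := t_in jN.
split=> //; last by rewrite lexx t_le// ltnW.
by rewrite -(subrKA (t j.+1)) !tS mulr_natl.
Qed.

Let window0 : [/\ 0 <= t 0, t 1 <= T, t 1 - t 0 <= 2 * tau & t 0 <= t 1 <= t 1].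
Proof.
have /andP[_ bT] := t_in N0.
split=> //; [by rewrite t0|by rewrite tS ler_peMl ?(ltW tau0)// ler1n|by rewrite lexx t_le].
Qed.

Definition residual_bound : R := residual_const al be L pres_consist_const disp_consist_const.

(** Every time step belongs to at most two windows. *)
Let sum_weight n : (n <= N)%N ->
  \sum_(j < n) \int[leb]_(r in `[t j.-1, t j.+1]) W r <=
  2 * \int[leb]_(r in `[t 0, t n]) W r.
Proof.
move=> nN; pose F j := \int[leb]_(r in `[t 0, t j]) W r.
have F0 j : 0 <= F j by apply: Rintegral_ge0 => r _; exact: weight_ge0.
have FB i j : (i <= j)%N -> (j <= N)%N ->
    \int[leb]_(r in `[t i, t j]) W r = F j - F i.
  move=> ij jN; have /andP[_ jT] := t_in jN.
  rewrite -(Rintegral_itv_split (t_le (leq0n i)) (t_le ij))//.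
  by apply: weight_integrable_itv => //; rewrite t0.
have Fle i j : (i <= j)%N -> (j <= N)%N -> F i <= F j.
  move=> ij jN; rewrite -subr_ge0 -FB//.
  by apply: Rintegral_ge0 => r _; exact: weight_ge0.
suff : \sum_(j < n) \int[leb]_(r in `[t j.-1, t j.+1]) W r <= F n + F n.-1.
  move=> hs; apply: le_trans hs _; rewrite mulr_natl mulr2n lerD2l.
  exact: Fle (leq_pred n) nN.
elim: n nN => [|n IH] nN; first by rewrite big_ord0 addr_ge0.
rewrite big_ord_recr/= FB//; last exact: leq_trans (leq_pred _) (leqnSn _).
by rewrite addrCA lerD2l lerBlDr IH// ltnW.
Qed.

Let projected_error_bound n : (1 <= n <= N)%N ->
  let P := 2 * residual_bound ^+ 2 * \int[leb]_(r in `[t 0, t n]) W r in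
  let E := Num.sqrt (growth be L) *
    (NB (lsub (pbar (t 0)) (ph 0)) + Num.sqrt be * Num.sqrt P) in
  let M := (eta / sqrt_bulk)^-1 * al^-1 * NA (lsub (ubar (t 0)) (uh 0))
    + Num.sqrt (T * be) * E in
  [/\ NB (lsub (pbar (t n)) (ph n)) <= E,
      NL (lsub (pbar (t n)) (ph n)).1 <= M &
      NA (lsub (ubar (t n)) (uh n)) <= al / sqrt_bulk * M].
Proof.
move=> nN P.
have sumP : \sum_(j < n) tau * (residual_bound * window_error j) ^+ 2 <= P.
  have -> : \sum_(j < n) tau * (residual_bound * window_error j) ^+ 2 =
      residual_bound ^+ 2 * \sum_(j < n) \int[leb]_(r in `[t j.-1, t j.+1]) W r.
    rewrite mulr_sumr; apply: eq_bigr => j _.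
    have I0 : 0 <= \int[leb]_(r in `[t j.-1, t j.+1]) W r.
      by apply: Rintegral_ge0 => r _; exact: weight_ge0.
    rewrite exprMn sqr_sqrtr; last by rewrite mulr_ge0// invr_ge0 ltW.
    by rewrite mulrCA mulVKf// gt_eqF.
  rewrite /P [leRHS]mulrAC [leRHS]mulrC ler_wpM2l ?sqr_ge0// sum_weight//.
  by case/andP: nN.
have [cp cu0] : (forall j, (j < N)%N ->
    sipnorm pres_ip (quotient_error T N (fun j => pbar (t j)) j (dp (t j.+1)))
      <= pres_consist_const * window_error j) /\
    NL (div (quotient_error T N (fun j => ubar (t j)) 0 (du (t 1)))) <=
      disp_consist_const * window_error 0.
  split; last first.
    have [a0 bT ba xab] := window0.
    exact: displacement_consistency a0 bT ba (lexx _) (lexx _) xab.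
  case=> [|j] jN.
    have [a0 bT ba xab] := window0.
    exact: pressure_consistency a0 bT ba (lexx _) (lexx _) xab.
  have [a0 bT ba xab] := window jN.
  exact: pressure_consistency a0 bT ba (t_le (leqnSn _)) (lexx _) xab.
have cp' j : (j.+2 <= N)%N ->
    sipnorm pres_ip (quotient_error T N (fun j => pbar (t j)) j (dp (t j.+2)))
      <= pres_consist_const * window_error j.+1.
  move=> jN; have [a0 bT ba xab] := window jN.
  exact: pressure_consistency a0 bT ba (lexx _) (t_le (leqnSn _)) xab.
have cu j : (j.+2 <= N)%N ->
    NL (div (quotient_error T N (fun j => ubar (t j)) j (du (t j.+2))))
      <= disp_consist_const * window_error j.+1.
  move=> jN; have [a0 bT ba xab] := window jN.
  exact: displacement_consistency a0 bT ba (lexx _) (t_le (leqnSn _)) xab.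
have dmom j : (j <= N)%N -> forall v, Vh v ->
    aform D lam mu (uh j) v - al * div_ip v (ph j) = vip D (fh j) (value v).
  move=> jN v Vv; rewrite -(ip_divC (VhS Vv) (QhS (Qph jN))).
  exact: discrete_momentum.
have [_ _ [_ fmass] efs] := dsol.
have smass j : (j.+2 <= N)%N -> forall q, Qh q ->
    be^-1 * pres_ip (bdiff T N ph j.+1) q + L * pres_ip (bdiff T N ph j.+1) q
      + bform D kap (ph j.+2) q =
    - al * div_ip (bdiff T N uh j) q + L * pres_ip (bdiff T N ph j) q
      + ip D (gh j.+2) q.1.
  move=> jN; have jN' : (1 <= j.+1 <= N.-1)%N by rewrite /= -ltnS prednK.
  by have [] := efs _ jN'.
exact: (error_estimate (V := vjet R d) (Q := jet R d) (m := pres_ip)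
  (ub := fun j => ubar (t j)) (pb := fun j => pbar (t j))
  (dut := fun j => du (t j)) (dpt := fun j => dp (t j))
  (F := fun j v => vip D (fh j) (value v)) (G := fun j q => ip D (gh j) q.1)
  sA sB sval VhS QhS Vlin Qlin
  div_ip_linl div_ip_linr ip_div_le div_ip_nd al0 be0 sqrt_bulk_gt0 T0 N0
  stabilization_large (divr_gt0 eta0 sqrt_bulk_gt0) inf_sup_bound Vub Vuh Qpb Qph
  (fun j jN => (Su (t_in jN)).2) (fun j jN => (Sp (t_in jN)).2)
  exact_momentum dmom exact_mass fmass smass (sqrtr_ge0 _) (fun j => sqrtr_ge0 _)
  cp cp' cu0 cu nN sumP).
Qed.

Definition energy_const : R := Num.sqrt (growth be L) *
  ((1 + proj_const) + Num.sqrt be * (residual_bound * Num.sqrt 2)).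

Definition pressure_const : R :=
  (eta / sqrt_bulk)^-1 * al^-1 * (1 + proj_const) + Num.sqrt (T * be) * energy_const.

Definition error_const : R := 3 * proj_const + energy_const + pressure_const
  + al / sqrt_bulk * pressure_const + 1.

Let L0 : 0 <= L.
Proof. by apply: le_trans stabilization_large; rewrite divr_ge0 ?sqr_ge0. Qed.

Lemma residual_bound_ge0 : 0 <= residual_bound.
Proof.
rewrite addr_ge0// mulr_ge0 ?sqrtr_ge0 ?(ltW al0)//.
by rewrite addr_ge0 ?invr_ge0 ?(ltW be0)// mulr_ge0.
Qed.

Lemma energy_const_ge0 : 0 <= energy_const.
Proof.
rewrite mulr_ge0 ?sqrtr_ge0// addr_ge0//.
  by rewrite addr_ge0 ?proj_const_ge0.
by rewrite !mulr_ge0 ?sqrtr_ge0 ?residual_bound_ge0.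
Qed.

Lemma pressure_const_ge0 : 0 <= pressure_const.
Proof.
have sd := sqrt_bulk_gt0.
rewrite addr_ge0//; last by rewrite mulr_ge0 ?sqrtr_ge0 ?energy_const_ge0.
rewrite mulr_ge0 ?addr_ge0 ?proj_const_ge0// mulr_ge0// invr_ge0.
  by rewrite divr_ge0 ?(ltW eta0) ?(ltW sd).
exact: ltW.
Qed.

Lemma error_const_gt0 : 0 < error_const.
Proof.
have pc0 := proj_const_ge0; have ec0 := energy_const_ge0.
have pr0 := pressure_const_ge0.
have k0 := mulr_ge0 (divr_ge0 (ltW al0) (ltW sqrt_bulk_gt0)) pr0.
rewrite /error_const; lra.
Qed.

Let sqrt_weight_integral b : b <= T ->
  Num.sqrt (\int[leb]_(r in `[t 0, b]) W r) <=
  tau * (Num.sqrt (\int[leb]_(r in `[t 0, b]) NL (ddp r) ^+ 2)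
         + Num.sqrt (\int[leb]_(r in `[t 0, b]) vH1norm D (ddu r) ^+ 2))
  + h ^+ s * Num.sqrt (\int[leb]_(r in `[t 0, b])
      (vHsemi D k.+1 (du r) ^+ 2 + Hsemi D l.+1 (dp r).1 ^+ 2)).
Proof.
move=> bT; have a0 : 0 <= t 0 by rewrite t0.
have [_ int_u int_p [_ int_ddu _] [_ int_ddp _]] := smooth_sol.
have i1 := integrable_itvS a0 bT int_u; have i2 := integrable_itvS a0 bT int_p.
have i3 := integrable_itvS a0 bT int_ddu; have i4 := integrable_itvS a0 bT int_ddp.
have i12 : leb.-integrable `[t 0, b]
    (fun r => (vHsemi D k.+1 (du r) ^+ 2 + Hsemi D l.+1 (dp r).1 ^+ 2)%:E).
  exact: integrable_add.
have i43 : leb.-integrable `[t 0, b]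
    (fun r => (NL (ddp r) ^+ 2 + vH1norm D (ddu r) ^+ 2)%:E).
  exact: integrable_add.
have i12' : leb.-integrable `[t 0, b]
    (fun r => ((h ^+ s) ^+ 2 *
      (vHsemi D k.+1 (du r) ^+ 2 + Hsemi D l.+1 (dp r).1 ^+ 2))%:E).
  exact: integrable_scale.
have -> : \int[leb]_(r in `[t 0, b]) W r =
    tau ^+ 2 * (\int[leb]_(r in `[t 0, b]) NL (ddp r) ^+ 2
      + \int[leb]_(r in `[t 0, b]) vH1norm D (ddu r) ^+ 2)
    + (h ^+ s) ^+ 2 * \int[leb]_(r in `[t 0, b])
      (vHsemi D k.+1 (du r) ^+ 2 + Hsemi D l.+1 (dp r).1 ^+ 2).
  by rewrite /weight Rintegral_lin// RintegralD// RintegralZl.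
set Ip := Rintegral _ _ _; set Iu := Rintegral _ _ _; set Iq := Rintegral _ _ _.
have Ip0 : 0 <= Ip by apply: Rintegral_ge0 => r _; exact: sqr_ge0.
have Iu0 : 0 <= Iu by apply: Rintegral_ge0 => r _; exact: sqr_ge0.
have Iq0 : 0 <= Iq.
  by apply: Rintegral_ge0 => r _; apply: addr_ge0; exact: sqr_ge0.
have Ipu0 := addr_ge0 Ip0 Iu0.
apply: le_trans (sqrtrD_le (mulr_ge0 (sqr_ge0 _) Ipu0) (mulr_ge0 (sqr_ge0 _) Iq0)) _.
have sqrt_sqrM x y : 0 <= x -> Num.sqrt (x ^+ 2 * y) = x * Num.sqrt y.
  by move=> x0; rewrite sqrtrM ?sqr_ge0// sqrtr_sqr ger0_norm.
rewrite !sqrt_sqrM ?(ltW tau0) ?exprn_ge0//.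
by rewrite lerD2r ler_wpM2l ?(ltW tau0)// sqrtrD_le.
Qed.

(** Split each error into the projection error and the error between the projection and
    the scheme; then every contribution is a constant times the total [X]. *)
Lemma error_bound n : (1 <= n <= N.-1)%N ->
  NA (u (t n) - uh n) + NB (p (t n) - ph n) + NL (p (t n) - ph n).1 <=
    error_const * (NA (u (t 0%N) - uh 0%N) + NB (p (t 0%N) - ph 0%N))
  + error_const * h ^+ s * (vHsemi D k.+1 (u (t 0%N)) + Hsemi D l.+1 (p (t 0%N)).1
                  + vHsemi D k.+1 (u (t n)) + Hsemi D l.+1 (p (t n)).1)
  + error_const * tau *
      (Num.sqrt (\int[leb]_(r in `[t 0%N, t n.+1]) NL (ddp r) ^+ 2)
       + Num.sqrt (\int[leb]_(r in `[t 0%N, t n.+1]) vH1norm D (ddu r) ^+ 2))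
  + error_const * h ^+ s *
      (Num.sqrt (\int[leb]_(r in `[t 0%N, t n.+1]) Hsemi D l.+1 (dp r).1 ^+ 2)
       + Num.sqrt (\int[leb]_(r in `[t 0%N, t n.+1])
                     (vHsemi D k.+1 (du r) ^+ 2
                      + Hsemi D l.+1 (dp r).1 ^+ 2))).
Proof.
rewrite !vjet_subE !jet_subE.
move=> /andP[n1 nN1].
have nSN : (n.+1 <= N)%N by rewrite -(prednK N0) ltnS.
have nN := ltnW nSN.
have sd := sqrt_bulk_gt0; have pc0 := proj_const_ge0.
have [n0T nT] := (t_in (leq0n N), t_in nN).
have hs0 : 0 <= h ^+ s by rewrite exprn_ge0.
have hnN : (1 <= n <= N)%N by rewrite n1.
have [_ bT] := andP (t_in nSN).
pose R3 := Num.sqrt (\int[leb]_(r in `[t 0%N, t n.+1]) NL (ddp r) ^+ 2)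
  + Num.sqrt (\int[leb]_(r in `[t 0%N, t n.+1]) vH1norm D (ddu r) ^+ 2).
pose I3 := Num.sqrt (\int[leb]_(r in `[t 0%N, t n.+1]) Hsemi D l.+1 (dp r).1 ^+ 2).
pose I4 := Num.sqrt (\int[leb]_(r in `[t 0%N, t n.+1])
  (vHsemi D k.+1 (du r) ^+ 2 + Hsemi D l.+1 (dp r).1 ^+ 2)).
pose A0 := NA (lsub (u (t 0)) (uh 0%N)); pose B0 := NB (lsub (p (t 0)) (ph 0%N)).
pose v0 := vHsemi D k.+1 (u (t 0)); pose q0 := Hsemi D l.+1 (p (t 0)).1.
pose vn := vHsemi D k.+1 (u (t n)); pose qn := Hsemi D l.+1 (p (t n)).1.
pose X := (A0 + B0) + h ^+ s * (v0 + q0 + vn + qn) + tau * R3 + h ^+ s * (I3 + I4).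
suff : NA (lsub (u (t n)) (uh n)) + NB (lsub (p (t n)) (ph n))
    + NL (lsub (p (t n)) (ph n)).1 <=
    error_const * X by rewrite distribute_const.
have sqrtI : Num.sqrt (\int[leb]_(r in `[t 0, t n.+1]) W r) <= tau * R3 + h ^+ s * I4.
  exact: sqrt_weight_integral bT.
have R30 : 0 <= R3 by rewrite addr_ge0 ?sqrtr_ge0.
have I30 : 0 <= I3 by exact: sqrtr_ge0.
have I40 : 0 <= I4 by exact: sqrtr_ge0.
have A00 : 0 <= A0 by exact: sqrtr_ge0.
have B00 : 0 <= B0 by exact: sqrtr_ge0.
have v00 : 0 <= v0 by exact: vHsemi0.
have q00 : 0 <= q0 by exact: Hsemi0.
have vn0 : 0 <= vn by exact: vHsemi0.
have qn0 : 0 <= qn by exact: Hsemi0.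
have bounds : [/\ 0 <= X, A0 <= X, B0 <= X, h ^+ s * (v0 + q0) <= X &
    [/\ h ^+ s * q0 <= X, h ^+ s * (vn + qn) <= X, h ^+ s * qn <= X &
        tau * R3 + h ^+ s * I4 <= X]].
  exact: bounds_by_total A00 B00 v00 q00 vn0 qn0 R30 I30 I40 hs0 (ltW tau0).
have [X0 AX BX vqX [qX vqnX qnX RIX]] := bounds.
have [/estimates_uniform[rA0 rB0 _] _] := approx n0T.
have [/estimates_uniform[rAn rBn rLn] _] := approx nT.
rewrite vjet_subE in rA0; rewrite jet_subE in rB0.
rewrite vjet_subE in rAn; rewrite jet_subE in rBn; rewrite jet_subE in rLn.
have Lub j (jN : (j <= N)%N) := VhS (Vub jN).
have Luh j (jN : (j <= N)%N) := VhS (Vuh jN).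
have Lpb j (jN : (j <= N)%N) := QhS (Qpb jN).
have Lph j (jN : (j <= N)%N) := QhS (Qph jN).
have [_ spA0] := error_splitting sA (Su n0T).1 (Lub _ (leq0n N)) (Luh _ (leq0n N)).
have [_ spB0] := error_splitting sB (Sp n0T).1 (Lpb _ (leq0n N)) (Lph _ (leq0n N)).
have [spAn _] := error_splitting sA (Su nT).1 (Lub _ nN) (Luh _ nN).
have [spBn _] := error_splitting sB (Sp nT).1 (Lpb _ nN) (Lph _ nN).
have [spLn _] := error_splitting sval (Sp nT).1 (Lpb _ nN) (Lph _ nN).
have [hB hL hA] := projected_error_bound hnN.
have scale z : h ^+ s * z <= X -> proj_const * h ^+ s * z <= proj_const * X.
  by move=> ez; rewrite -mulrA ler_wpM2l.
have sum1 x y : x <= X -> y <= proj_const * X -> x + y <= (1 + proj_const) * X.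
  by move=> xX yX; rewrite mulrDl mul1r lerD.
have eA0 := le_trans spA0 (sum1 _ _ AX (le_trans rA0 (scale _ vqX))).
have eB0 := le_trans spB0 (sum1 _ _ BX (le_trans rB0 (scale _ qX))).
have sqrtP : Num.sqrt (2 * residual_bound ^+ 2 * \int[leb]_(r in `[t 0, t n]) W r)
    <= residual_bound * Num.sqrt 2 * X.
  have -> : 2 * residual_bound ^+ 2 * \int[leb]_(r in `[t 0, t n]) W r =
      residual_bound ^+ 2 * (2 * \int[leb]_(r in `[t 0, t n]) W r).
    by rewrite -mulrA mulrCA.
  have rb0 := residual_bound_ge0.
  rewrite sqrtrM ?sqr_ge0// sqrtr_sqr ger0_norm// sqrtrM// -mulrA ler_wpM2l//.
  rewrite ler_wpM2l ?sqrtr_ge0//; apply: le_trans RIX; apply: le_trans sqrtI.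
  rewrite ler_wsqrtr//; apply: le_Rintegral_itvS => //.
  - exact: t_le.
  - by move=> r _; exact: weight_ge0.
  - by apply: weight_integrable_itv => //; rewrite t0.
have k1 : 0 <= (eta / sqrt_bulk)^-1 * al^-1.
  by rewrite mulr_ge0// invr_ge0 ?divr_ge0 ?(ltW eta0) ?(ltW al0) ?(ltW sd).
have := collect_bounds (sqrtr_ge0 _) (sqrtr_ge0 be) k1 (sqrtr_ge0 (T * be))
  (divr_ge0 (ltW al0) (ltW sd)) X0 eA0 eB0 sqrtP
  (le_trans rAn (scale _ vqnX)) (le_trans rBn (scale _ qnX)) (le_trans rLn (scale _ qnX))
  hB hL hA.
apply: le_trans.
exact: (lerD (lerD spAn spBn) spLn).
Qed.

End biot_discretization.

Theorem theorem1 (R : realType) (d : nat) (Omega : set 'rV[R]_d)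
    (lam mu alpha beta kappa T eta omega c : R) (k l : nat) :
  d = 2%N \/ d = 3%N -> polyhedral_domain Omega ->
  0 < lam -> 0 < mu -> 0 < alpha -> 0 < beta -> 0 < kappa ->
  0 < T -> 0 < eta -> 1 <= omega -> 0 < c ->
  exists2 C : R, 0 < C &
  forall (m : nat) (K : 'I_m -> 'I_d.+1 -> 'rV[R]_d)
    (Vh : set (vjet R d)) (Qh : set (jet R d)) (N : nat)
    (f : R -> 'I_d -> 'rV[R]_d -> R) (g : R -> 'rV[R]_d -> R)
    (u du ddu : R -> vjet R d) (p dp : R -> jet R d) (ddp : R -> 'rV[R]_d -> R^o)
    (fh : nat -> 'I_d -> 'rV[R]_d -> R) (gh : nat -> 'rV[R]_d -> R)
    (uh : nat -> vjet R d) (ph : nat -> jet R d),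
  let h := mesh_size K in
  let L := omega * (alpha ^+ 2 / (lam + 2 * mu / d%:R)) in
  let t := tj T N in
  let s := minn k l in
  let nA := normA Omega lam mu in
  let nB := normB Omega kappa in
  simplicial_partition Omega K ->
  fe_pair Omega K Vh Qh ->
  inf_sup Omega lam mu eta Vh Qh ->
  biot_solution Omega lam mu alpha beta kappa T f g u du p dp ->
  smooth_solution Omega T k l u du ddu p dp ddp ->
  projection_approx Omega lam mu alpha kappa T k l c h Vh Qh u du p dp ->
  discrete_data Omega T N Vh Qh f g fh gh ->
  discrete_solution Omega lam mu alpha beta kappa T N Vh Qh L fh gh uh ph ->
  forall n : nat, (1 <= n <= N.-1)%N ->
  nA (u (t n) - uh n) + nB (p (t n) - ph n) + L2norm Omega (p (t n) - ph n).1 <=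
    C * (nA (u (t 0%N) - uh 0%N) + nB (p (t 0%N) - ph 0%N))
  + C * h ^+ s * (vHsemi Omega k.+1 (u (t 0%N)) + Hsemi Omega l.+1 (p (t 0%N)).1
                  + vHsemi Omega k.+1 (u (t n)) + Hsemi Omega l.+1 (p (t n)).1)
  + C * tau T N *
      (Num.sqrt (\int[lebesgue_measure]_(r in `[t 0%N, t n.+1])
                   L2norm Omega (ddp r) ^+ 2)
       + Num.sqrt (\int[lebesgue_measure]_(r in `[t 0%N, t n.+1])
                     vH1norm Omega (ddu r) ^+ 2))
  + C * h ^+ s *
      (Num.sqrt (\int[lebesgue_measure]_(r in `[t 0%N, t n.+1])
                   Hsemi Omega l.+1 (dp r).1 ^+ 2)
       + Num.sqrt (\int[lebesgue_measure]_(r in `[t 0%N, t n.+1])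
                     (vHsemi Omega k.+1 (du r) ^+ 2
                      + Hsemi Omega l.+1 (dp r).1 ^+ 2))).
Proof.
move=> d23 polyD lam0 mu0 al0 be0 kap0 T0 eta0 om1 c0.
have d0 : (0 < d)%N by case: d23 => ->.
have mD := polyhedral_domain_measurable polyD.
have [H H1 meshH] := mesh_size_bounded polyD.
exists (error_const (d := d) lam mu alpha beta T eta omega c H k l).
  exact: error_const_gt0.
move=> m K Vh Qh N f g u du ddu p dp ddp fh gh uh ph h L t s nA nB.
move=> partK fe infsup sol smooth_sol.
move=> [ubar [pbar [drho_u [drho_p [proj proj_u proj_p approx]]]]].
move=> data dsol n nN.
have N0 : (0 < N)%N by case: N nN {data dsol t} => // /andP[]; case: n.
exact: (error_bound d0 mD lam0 mu0 al0 be0 kap0 T0 eta0 om1 c0 H1 (meshH m K partK)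
  fe infsup sol smooth_sol proj proj_u proj_p approx data dsol N0 nN).
Qed.
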